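(* Let $k$ be an algebraically closed field of characteristic $5$ and let $\Gamma\subset\mathbb{P}^2$ be a $k$-Hermitian curve. Let $G$ be the graph whose set of vertices is the set $\mathcal{Q}$ of non-singular conics totally tangent to $\Gamma$ and whose set of edges is the set of pairs $\{Q,Q'\}$ of distinct conics in $\mathcal{Q}$ such that $Q$ and $Q'$ intersect transversely (that is, $|Q\cap Q'|=4$) and $|\mathcal{S}(Q)\cap\mathcal{S}(Q')|=3$. Then $G$ has exactly $150$ connected components, and each connected component is isomorphic to the triangular graph $T(7)$.
   Context: Work over an algebraically closed field $k$ of characteristic $5$. A $k$-Hermitian curve is a projective plane curve $\Gamma\subset\mathbb{P}^2$ of degree $6$ that is projectively isomorphic (via $\mathrm{PGL}_3(k)$) to the Fermat curve $\Gamma_5: x^6+y^6+z^6=0$. $\mathcal{P}$ denotes the set of Weierstrass points of $\Gamma$; equivalently, the set of points $P\in\Gamma$ whose tangent line meets $\Gamma$ at $P$ with intersection multiplicity $6$ (for $\Gamma=\Gamma_5$, the $\mathbb{F}_{25}$-rational points). One has $|\mathcal{P}|=126$. A line of $\mathbb{P}^2$ is a special secant line of $\Gamma$ if it passes through two distinct points of $\mathcal{P}$. A non-singular conic $Q\subset\mathbb{P}^2$ is totally tangent to $\Gamma$ if $Q$ meets $\Gamma$ at six distinct points, each with intersection multiplicity $2$. $\mathcal{Q}$ denotes the set of all such conics; one has $|\mathcal{Q}|=3150$ and $Q\cap\Gamma\subset\mathcal{P}$ for $Q\in\mathcal{Q}$. For $Q\in\mathcal{Q}$, $\mathcal{S}(Q)$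 is the set of the $15$ special secant lines of $\Gamma$ passing through two distinct points of $Q\cap\Gamma$. The triangular graph $T(m)$ has as vertices the unordered pairs of distinct elements of $\{1,\dots,m\}$, two distinct pairs being adjacent if and only if they have non-empty intersection. *)

(* Defs.v *)
From HB Require Import structures.
From Stdlib Require Import Relation_Operators.
From mathcomp Require Import all_boot all_order all_algebra.
From mathcomp Require Import mpoly.
From mathcomp Require Import boolp classical_sets functions cardinality.

Set Implicit Arguments.
Unset Strict Implicit.
Unset Printing Implicit Defensive.

Import GRing.Theory.
Local Open Scope ring_scope.
Local Open Scope classical_set_scope.
Local Open Scope card_scope.

Local Notation "x %:F" := (FracField.tofrac x).

Record graph (T : Type) := Graph {
  vertices : set T;
  adjacent : T -> T -> Prop;
  adjacent_sym : forall x y, adjacent x y -> adjacent y x;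
  adjacent_irrefl : forall x, ~ adjacent x x }.

Definition induced_subgraph (T : Type) (G : graph T) (C : set T) : graph T :=
  Graph (vertices G `&` C) (@adjacent_sym T G) (@adjacent_irrefl T G).

Definition edge (T : Type) (G : graph T) (x y : T) : Prop :=
  [/\ vertices G x, vertices G y & adjacent G x y].

Definition component (T : Type) (G : graph T) (x : T) : set T :=
  [set y | vertices G y /\ clos_refl_trans T (edge G) x y].

Definition components (T : Type) (G : graph T) : set (set T) :=
  component G @` vertices G.

Definition graph_isomorphic (T T' : Type) (G : graph T) (G' : graph T') :
    Prop :=
  exists2 f : T -> T',
    set_bij (vertices G) (vertices G') f &
    forall x y, vertices G x -> vertices G y ->
      (adjacent G x y <-> adjacent G' (f x) (f y)).

Definition triangular_adjacent (m : nat) (A B : {set 'I_m}) : Prop :=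
  A <> B /\ A :&: B <> finset.set0.

Lemma triangular_adjacent_sym (m : nat) (A B : {set 'I_m}) :
  triangular_adjacent A B -> triangular_adjacent B A.
Proof. by case=> AB AIB; split; [exact: nesym | rewrite finset.setIC]. Qed.

Lemma triangular_adjacent_irrefl (m : nat) (A : {set 'I_m}) :
  ~ triangular_adjacent A A.
Proof. by case. Qed.

Definition triangular_graph (m : nat) : graph {set 'I_m} :=
  Graph [set A : {set 'I_m} | #|A| = 2%N]
    (@triangular_adjacent_sym m) (@triangular_adjacent_irrefl m).

Definition projectivization (k : fieldType) (V : vectType k) : Type :=
  {U : {vspace V} | \dim U == 1%N}.

Notation plane_point k := (projectivization 'rV[k]_3).

(* A curve of degree d is a nonzero form of degree d in three variables, up to
   scalars; in particular a line is a curve of degree 1. *)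
Notation plane_curve k d := (projectivization (dhomog 3 k d)).
Notation plane_line k := (plane_curve k 1).
Notation plane_conic k := (plane_curve k 2).

Section Curves.
Variable k : closedFieldType.

(* Homogeneous coordinates of a point and an equation of a curve: a chosen
   generator of the corresponding line of vectors.  All the notions below are
   invariant under rescaling these. *)
Definition coord_of (P : plane_point k) : 'rV[k]_3 := vpick (sval P).

Definition equation (d : nat) (C : plane_curve k d) : {mpoly k[3]} :=
  vpick (sval C).

Definition eval_at (P : plane_point k) (F : {mpoly k[3]}) : k :=
  F.@[fun i => coord_of P 0 i].

Definition points (d : nat) (C : plane_curve k d) : set (plane_point k) :=
  [set P | eval_at P (equation C) = 0].

Definition nonsingular (d : nat) (C : plane_curve k d) : Prop :=
  forall P, points C P -> exists i : 'I_3, eval_at P (equation C)^`M(i) <> 0.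

Definition tangent_line (d : nat) (C : plane_curve k d) (P : plane_point k)
    (l : plane_line k) : Prop :=
  points C P /\
  exists2 c : k, c != 0 &
    equation l = c *: \sum_(i < 3) eval_at P (equation C)^`M(i) *: 'X_i.

(* The local ring of P^2 at P, inside the field of fractions of k[x,y,z]. *)
Definition local_ring (P : plane_point k) : set {fraction {mpoly k[3]}} :=
  [set f | exists (m : nat) (a b : {mpoly k[3]}),
    [/\ a \is m.-homog, b \is m.-homog, eval_at P b <> 0 & f = a%:F / b%:F]].

(* The ideal of C in the local ring at P. *)
Definition local_ideal (P : plane_point k) (d : nat) (C : plane_curve k d) :
    set {fraction {mpoly k[3]}} :=
  [set f | exists (m : nat) (a b : {mpoly k[3]}),
    [/\ a \is m.-homog, b \is (m + d).-homog, eval_at P b <> 0 &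
        f = (a * equation C)%:F / b%:F]].

(* The two curves have intersection multiplicity n at P: the quotient of the
   local ring at P by the sum of the two ideals has a k-basis of n elements. *)
Definition intersection_multiplicity (P : plane_point k)
    (d : nat) (C : plane_curve k d) (e : nat) (D : plane_curve k e) (n : nat) :
    Prop :=
  exists u : 'I_n -> {fraction {mpoly k[3]}},
    (forall i, local_ring P (u i)) /\
    (forall f, local_ring P f ->
      exists! c : 'rV[k]_n, exists g h : {fraction {mpoly k[3]}},
        [/\ local_ideal P C g, local_ideal P D h &
            f = \sum_(i < n) ((c 0 i)%:MP)%:F * u i + (g + h)]).

Definition fermat_sextic : {mpoly k[3]} := \sum_(i < 3) 'X_i ^+ 6.

Definition hermitian_curve (Gam : plane_curve k 6) : Prop :=
  exists2 A : 'M[k]_3, A \in unitmx &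
  exists2 c : k, c != 0 &
    equation Gam \mPo [tuple \sum_(j < 3) A i j *: 'X_j | i < 3]
      = c *: fermat_sextic.

(* For a Hermitian curve these are its Weierstrass points. *)
Definition weierstrass_points (Gam : plane_curve k 6) : set (plane_point k) :=
  [set P | points Gam P /\
    exists2 l : plane_line k, tangent_line Gam P l &
      intersection_multiplicity P Gam l 6].

Definition special_secant_lines (Gam : plane_curve k 6) : set (plane_line k) :=
  [set l | exists P P' : plane_point k,
    [/\ weierstrass_points Gam P, weierstrass_points Gam P', P <> P',
        points l P & points l P']].

Definition totally_tangent_conics (Gam : plane_curve k 6) :
    set (plane_conic k) :=
  [set Q | [/\ nonsingular Q, points Q `&` points Gam #= `I_6 &
    forall P, points Q P -> points Gam P ->
      intersection_multiplicity P Q Gam 2]].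

Definition secants_of_conic (Gam : plane_curve k 6) (Q : plane_conic k) :
    set (plane_line k) :=
  [set l | special_secant_lines Gam l /\
    exists P P' : plane_point k,
      [/\ (points Q `&` points Gam) P, (points Q `&` points Gam) P', P <> P',
          points l P & points l P']].

Definition conic_adjacent (Gam : plane_curve k 6) (Q Q' : plane_conic k) :
    Prop :=
  [/\ Q <> Q', points Q `&` points Q' #= `I_4 &
      secants_of_conic Gam Q `&` secants_of_conic Gam Q' #= `I_3].

Lemma conic_adjacent_sym (Gam : plane_curve k 6) (Q Q' : plane_conic k) :
  conic_adjacent Gam Q Q' -> conic_adjacent Gam Q' Q.
Proof. by case=> QQ' p s; split; [exact: nesym | rewrite setIC..]. Qed.

Lemma conic_adjacent_irrefl (Gam : plane_curve k 6) (Q : plane_conic k) :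
  ~ conic_adjacent Gam Q Q.
Proof. by case. Qed.

Definition conic_graph (Gam : plane_curve k 6) : graph (plane_conic k) :=
  Graph (totally_tangent_conics Gam)
    (@conic_adjacent_sym Gam) (@conic_adjacent_irrefl Gam).

End Curves.

(* Main.v *)
(** In suitable coordinates Gamma is [herm x x = 0] for the Hermitian form
    x0 y2^5 - 2 x1 y1^5 + x2 y0^5.  The conic x1^2 = x0 x2, parametrized by (1, t, t^2),
    is totally tangent to it, because the form restricts to (t^5 - t)^2.  Conversely,
    normalise a totally tangent conic so that three of its six tangency points are at
    t = 0, 1, infinity.  The form restricts to a polynomial in t whose exponents are all
    of the shape i + 5j with i, j <= 2 and which is a constant times the square of a
    quintic; the vanishing coefficients force the quintic to be t^5 - t, and comparing
    coefficients shows that the normalising frame is unitary up to a scalar.  Hence the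
    vertices are the images of one conic under the unitary group, whose matrices have
    entries in F_25.

    Adjacency of the conics with frames g and w g depends on w alone: the quartic
    obtained by restricting one conic to the other must have four distinct roots, and
    exactly three of the fifteen secants of the first six points must meet the second
    six points twice.  To find the neighbours of the base conic, move one shared secant
    to x1 = 0 by SL_2(F_5) acting on both conics; this leaves a small enumeration over
    F_25, which produces ten neighbours.  A list of 21 frames containing them is closed
    under adjacency and carries the adjacency of T(7), so by transitivity it describes
    every component.

    Each of the 126 isotropic points over F_25 lies on exactly one of the 21 conics of
    the list, hence on exactly one conic of every component.  The components thus
    correspond to the totally tangent conics through one fixed such point, and these are
    the 150 conics given by the unitary triangular frames up to the stabiliser of the
    base conic. *)

From HB Require Import structures.
From Stdlib Require Import Relation_Operators Operators_Properties.
Require Import Defs.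
From mathcomp Require Import all_boot all_order all_algebra.
From mathcomp Require Import ring zify.
From mathcomp Require Import mpoly.
From mathcomp Require Import boolp classical_sets functions cardinality.

Set Implicit Arguments.
Unset Strict Implicit.
Unset Printing Implicit Defensive.

(** A frame is an invertible matrix [g]; its conic is the image of the base conic under [x -> x g].
    Left factors preserving the base conic do not change the conic of a frame, and right unitary
    factors are symmetries of the curve, so every question about two frames [g], [h] reduces to
    [h g^-1] up to left factors. The unitary group over F_25 has 2268000 elements, too many for a
    naive search of neighbours. A shared secant moved to x1 = 0 makes two rows of the frame lose
    their middle entry; orthogonality then makes the third row a multiple of (0, 1, 0), leaving two
    isotropic binary vectors and a scalar of norm 1. The quartic of such a frame is even in t, so
    that having four distinct roots is a discriminant condition decidable over F_25. The Gram matrix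
    is, up to sign, also the polar matrix of x1^2 - x0 x2. This is why substitutions of t over F_5
    give unitary matrices. The counts agree: 21 conics with 6 points each exhaust the 126 points,
    and 6 * 5 * 5 = 150 = 3150 / 21 triangular frames remain. Multiplicities, defined through local
    rings, are computed once and for all from a parametrization of one of the two curves. *)

Module ConicFrames.

(* The field with 25 elements as a plain inductive type: the arithmetic of ['F_p]
   does not reduce well enough for the enumerations below. *)
Inductive f5 := A0 | A1 | A2 | A3 | A4.

Definition nat_of_f5 x := match x with
  A0 => 0%N | A1 => 1%N | A2 => 2 | A3 => 3 | A4 => 4 end.

Lemma nat_of_f5_inj : injective nat_of_f5. Proof. by case; case. Qed.

HB.instance Definition _ := Equality.copy f5 (inj_type nat_of_f5_inj).

Definition f5_succ x :=
  match x with A0 => A1 | A1 => A2 | A2 => A3 | A3 => A4 | A4 => A0 end.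

Definition f5_add x y := match x with
  | A0 => y | A1 => f5_succ y | A2 => f5_succ (f5_succ y)
  | A3 => f5_succ (f5_succ (f5_succ y))
  | A4 => f5_succ (f5_succ (f5_succ (f5_succ y))) end.

Definition f5_opp x :=
  match x with A0 => A0 | A1 => A4 | A2 => A3 | A3 => A2 | A4 => A1 end.

Definition f5_mul x y := match x with
  | A0 => A0 | A1 => y | A2 => f5_add y y | A3 => f5_opp (f5_add y y)
  | A4 => f5_opp y end.

Definition f5_is0 x := if x is A0 then true else false.

Definition f5_all := [:: A0; A1; A2; A3; A4].

(* [F25 a b] stands for [a + b * sqrt 2]. *)
Inductive f25 := F25 of f5 & f5.

Definition pair_of_f25 x := let: F25 a b := x in (a, b).

Lemma pair_of_f25_inj : injective pair_of_f25.
Proof. by case=> a b [c d] [-> ->]. Qed.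

HB.instance Definition _ := Equality.copy f25 (inj_type pair_of_f25_inj).

Definition f25_add x y :=
  let: F25 a b := x in let: F25 c d := y in F25 (f5_add a c) (f5_add b d).

Definition f25_opp x := let: F25 a b := x in F25 (f5_opp a) (f5_opp b).

Definition f25_mul x y := let: F25 a b := x in let: F25 c d := y in
  let bd := f5_mul b d in
  F25 (f5_add (f5_mul a c) (f5_add bd bd)) (f5_add (f5_mul a d) (f5_mul b c)).

(** The Frobenius map x^5: 2 is not a square modulo 5, so the fifth power of sqrt 2 is 4 sqrt 2 = -
    sqrt 2. *)
Definition f25_conj x := let: F25 a b := x in F25 a (f5_opp b).

Definition f25_is0 x := let: F25 a b := x in f5_is0 a && f5_is0 b.

Definition f25_all := [seq F25 a b | b <- f5_all, a <- f5_all].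

Lemma mem_f25_all x : x \in f25_all. Proof. by case: x => -[] []. Qed.

Lemma f25_all_uniq : uniq f25_all. Proof. by []. Qed.

Definition f25_0 := F25 A0 A0.
Definition f25_1 := F25 A1 A0.
Definition f25_2 := F25 A2 A0.
Definition f25_3 := F25 A3 A0.

Declare Scope f25_scope.
Delimit Scope f25_scope with F25.
Bind Scope f25_scope with f25.
Local Notation "x + y" := (f25_add x y) : f25_scope.
Local Notation "x * y" := (f25_mul x y) : f25_scope.
Local Notation "- x" := (f25_opp x) : f25_scope.
Local Notation "x - y" := (f25_add x (f25_opp y)) : f25_scope.
Local Open Scope f25_scope.

(** * Matrices over F_25 and the finite checks *)

Inductive vec := Vec of f25 & f25 & f25.
Inductive mat := Mat of vec & vec & vec.

Definition tuple_of_vec x := let: Vec a b c := x in (a, b, c).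

Lemma tuple_of_vec_inj : injective tuple_of_vec.
Proof. by case=> a b c [d e f] [-> -> ->]. Qed.

HB.instance Definition _ := Equality.copy vec (inj_type tuple_of_vec_inj).

Definition tuple_of_mat g := let: Mat u v w := g in (u, v, w).

Lemma tuple_of_mat_inj : injective tuple_of_mat.
Proof. by case=> u v w [u' v' w'] [-> -> ->]. Qed.

HB.instance Definition _ := Equality.copy mat (inj_type tuple_of_mat_inj).

Definition vec_mul (x : vec) (g : mat) : vec :=
  let: Vec x0 x1 x2 := x in
  let: Mat (Vec a b c) (Vec d e f) (Vec p q r) := g in
  Vec (x0 * a + (x1 * d + x2 * p)) (x0 * b + (x1 * e + x2 * q))
      (x0 * c + (x1 * f + x2 * r)).

Definition mat_mul (g h : mat) : mat :=
  let: Mat u v w := g in Mat (vec_mul u h) (vec_mul v h) (vec_mul w h).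

Definition mat_1 : mat :=
  Mat (Vec f25_1 f25_0 f25_0) (Vec f25_0 f25_1 f25_0) (Vec f25_0 f25_0 f25_1).

Definition vec_dot (x y : vec) : f25 :=
  let: Vec x0 x1 x2 := x in let: Vec y0 y1 y2 := y in
  x0 * y0 + (x1 * y1 + x2 * y2).

Definition vec_cross (x y : vec) : vec :=
  let: Vec x0 x1 x2 := x in let: Vec y0 y1 y2 := y in
  Vec (x1 * y2 - x2 * y1) (x2 * y0 - x0 * y2) (x0 * y1 - x1 * y0).

Definition vec_herm (x y : vec) : f25 :=
  let: Vec x0 x1 x2 := x in let: Vec y0 y1 y2 := y in
  x0 * f25_conj y2 + (f25_3 * (x1 * f25_conj y1) + x2 * f25_conj y0).

Definition vec_conic (x : vec) : f25 :=
  let: Vec x0 x1 x2 := x in x1 * x1 - x0 * x2.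

(* The inverse [H g* H^-1] of a unitary [g]. *)
Definition mat_inv (g : mat) : mat :=
  let: Mat (Vec a b c) (Vec d e f) (Vec p q r) := g in
  let k := f25_conj in
  Mat (Vec (k r) (f25_2 * k f) (k c))
      (Vec (f25_3 * k q) (k e) (f25_3 * k b))
      (Vec (k p) (f25_2 * k d) (k a)).

Definition f25_eq x y := f25_is0 (x - y).

Definition vec_eq (x y : vec) : bool :=
  let: Vec x0 x1 x2 := x in let: Vec y0 y1 y2 := y in
  [&& f25_eq x0 y0, f25_eq x1 y1 & f25_eq x2 y2].

(** Six Gram entries suffice, the other three being conjugate to some of these; the entry 3 is the
    -2 of [gram]. *)
Definition mat_unitary (g : mat) : bool :=
  let: Mat u v w := g in
  [&& f25_is0 (vec_herm u u), f25_is0 (vec_herm u v), f25_eq (vec_herm u w) f25_1,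
      f25_eq (vec_herm v v) f25_3, f25_is0 (vec_herm v w) & f25_is0 (vec_herm w w)].

(* Coefficients of [conic_value (conic_pt t *m g)]. *)
Definition quartic (g : mat) : seq f25 :=
  let: Mat (Vec a b c) (Vec d e f) (Vec p q r) := g in
  [:: b * b - a * c; f25_2 * (b * e) - (a * f + d * c);
      e * e + f25_2 * (b * q) - (d * f + (a * r + p * c));
      f25_2 * (e * q) - (d * r + p * f); q * q - p * r].

Definition same_conic (g : mat) : bool := all f25_is0 (quartic g).

(** The six points where the base conic touches the curve, infinity first, in the order of
    [P1F5]. *)
Definition pt (i : nat) : vec :=
  let f a := Vec f25_1 (F25 a A0) (F25 (f5_mul a a) A0) in
  nth (Vec f25_0 f25_0 f25_1) (Vec f25_0 f25_0 f25_1 :: map f f5_all) i.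

Definition index_pairs n := [seq (i, j) | j <- iota 0 n, i <- iota 0 j].

(** A secant of the base conic is also one of the second conic when it contains two of the latter's
    six points, so incidences replace a comparison of two lists of lines. *)
Definition shares (g : mat) (ij : nat * nat) : bool :=
  let s := vec_cross (pt ij.1) (pt ij.2) in
  (1 < count (fun r => f25_is0 (vec_dot (vec_mul (pt r) g) s)) (iota 0 6))%N.

Definition count_shared (g : mat) : nat := count (shares g) (index_pairs 6).

(* [u i] are homogeneous coordinates of the points of the projective line over
   F_5; [sl2_frame i j] is the symmetric square of the matrix of determinant 1
   with rows proportional to [u i] and [u j]. *)
Definition line_pt (i : nat) : f5 * f5 := nth (A0, A1) ((A0, A1) :: map (pair A1) f5_all) i.

Definition sl2_frame (i j : nat) : mat :=
  let: (a, b) := line_pt i in let: (c', d') := line_pt j in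
  let det := f5_add (f5_mul a d') (f5_opp (f5_mul b c')) in
  (* In F_5 the cube of a non-zero element is its inverse. *)
  let inv := f5_mul det (f5_mul det det) in
  let c := f5_mul inv c' in let d := f5_mul inv d' in
  let e x := F25 x A0 in let two x := f5_add x x in
  Mat (Vec (e (f5_mul a a)) (e (f5_mul a b)) (e (f5_mul b b)))
      (Vec (e (two (f5_mul a c))) (e (f5_add (f5_mul a d) (f5_mul b c))) (e (two (f5_mul b d))))
      (Vec (e (f5_mul c c)) (e (f5_mul c d)) (e (f5_mul d d))).

Definition f25_of_nat (n : nat) : f25 := nth f25_0 f25_all n.

Definition mat_of_seq (s : seq nat) : mat :=
  let e i := f25_of_nat (nth 0%N s i) in
  Mat (Vec (e 0%N) (e 1%N) (e 2)) (Vec (e 3) (e 4) (e 5)) (Vec (e 6) (e 7) (e 8)).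

(* Frames of the conics of the connected component of the conic [z1^2 = z0 z2],
   listed in the order of [index_pairs 7]; the entry [a + 5 * b] stands for
   [F25 a b]. *)
Definition component_frames : seq mat := map mat_of_seq [::
  [:: 1; 0; 0; 0; 1; 0; 0; 0; 1];
  [:: 2; 0; 10; 0; 1; 0; 10; 0; 2];
  [:: 10; 0; 3; 0; 1; 0; 3; 0; 10];
  [:: 13; 1; 2; 1; 1; 0; 17; 5; 10];
  [:: 5; 5; 9; 0; 1; 2; 1; 1; 21];
  [:: 16; 1; 7; 11; 0; 8; 15; 6; 5];
  [:: 12; 15; 10; 3; 1; 0; 12; 3; 2];
  [:: 20; 15; 6; 0; 4; 1; 4; 3; 6];
  [:: 8; 1; 19; 7; 0; 14; 5; 21; 15];
  [:: 8; 17; 2; 13; 2; 12; 3; 12; 7];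
  [:: 2; 1; 13; 0; 1; 1; 10; 5; 17];
  [:: 21; 1; 1; 2; 1; 0; 9; 5; 5];
  [:: 5; 6; 15; 8; 0; 11; 7; 1; 16];
  [:: 11; 17; 1; 1; 7; 21; 16; 2; 11];
  [:: 2; 10; 1; 15; 0; 5; 4; 5; 2];
  [:: 2; 3; 12; 0; 1; 3; 10; 15; 12];
  [:: 6; 15; 20; 1; 4; 0; 6; 3; 4];
  [:: 7; 3; 14; 11; 0; 8; 20; 12; 15];
  [:: 1; 10; 2; 5; 0; 15; 2; 5; 4];
  [:: 23; 4; 8; 6; 8; 1; 2; 6; 7];
  [:: 2; 17; 8; 12; 2; 13; 7; 12; 3]].

Definition triangular_index (i j : nat) : bool :=
  let: (a, b) := nth (0, 0)%N (index_pairs 7) i in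
  let: (c, d) := nth (0, 0)%N (index_pairs 7) j in
  (i != j) && [|| a == c, a == d, b == c | b == d].

Definition component_frame i := nth mat_1 component_frames i.

(** Entry 0 is the identity frame and carries the pair {0, 1}; these are the ten pairs that meet it
    in one element. *)
Definition neighbour_indices := [seq n <- iota 0 21 | triangular_index 0 n].

(** Two frames have the same conic when their quotient preserves the base conic. The quotient is
    meaningful only for unitary [h], where [mat_inv] is the inverse. *)
Definition same_frames g h : bool := same_conic (mat_mul g (mat_inv h)).

Definition check_component_frames : bool :=
  (size component_frames == 21) && all mat_unitary component_frames.

Definition vec_0 : vec := Vec f25_0 f25_0 f25_0.

Definition vec_parallel (x y : vec) : bool :=
  [&& ~~ vec_eq x vec_0, ~~ vec_eq y vec_0 & vec_eq (vec_cross x y) vec_0].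

(** The middle column of [g^-1] holds the coefficients of the line that [g^-1] moves to x1 = 0; the
    last test says that this line is the secant through the points [i] and [j]. *)
Definition check_sl2_frames : bool :=
  all (fun i => all (fun j => (i == j) ||
    let g := sl2_frame i j in
    let: Mat u v w := g in
    let: Mat (Vec a b c) (Vec d e f) (Vec p q r) := mat_inv g in
    [&& mat_unitary g, same_conic g, vec_parallel u (pt i), vec_parallel w (pt j) &
        vec_parallel (Vec b e q) (vec_cross (pt i) (pt j))])
    (iota 0 6)) (iota 0 6).

Definition is_neighbour (g : mat) : bool :=
  has (fun n => same_frames g (component_frame n)) neighbour_indices.

(** Stability of the ten neighbours under the stabiliser of the base conic, needed to undo the
    normalisation of a shared secant. *)
Definition check_neighbour_moves : bool :=
  all (fun n => all (fun i => all (fun j => (i == j) ||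
    is_neighbour (mat_mul (component_frame n) (sl2_frame i j)))
    (iota 0 6)) (iota 0 6)) neighbour_indices.

Definition isotropic_pairs : seq (f25 * f25) :=
  [seq u <- [seq (a, b) | a <- f25_all, b <- f25_all] |
     f25_is0 (u.1 * f25_conj u.2 + u.2 * f25_conj u.1)].

(** Both outer rows lie on x1 = 0: the points 0 and infinity of the second conic are on that
    line. *)
Definition secant_frame (u : f25 * f25) (e : f25) (v : f25 * f25) : mat :=
  Mat (Vec u.1 f25_0 u.2) (Vec f25_0 e f25_0) (Vec v.1 f25_0 v.2).

(* For [g = secant_frame u e v] the quartic is [a + b t^2 + c t^4]. *)
Definition separable_quartic (g : mat) : bool :=
  if quartic g is [:: a; _; b; _; c] then
    [&& ~~ f25_is0 a, ~~ f25_is0 c & ~~ f25_is0 (b * b - (f25_2 * f25_2) * (a * c))]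
  else false.

Definition check_secant_frames : bool :=
  all (fun u => all (fun v =>
    if f25_eq (u.1 * f25_conj v.2 + u.2 * f25_conj v.1) f25_1 then
      (* This determinant is that of the two orthogonality relations on the outer entries of the
         middle row; being non-zero, it forces them to vanish. *)
      ~~ f25_is0 (f25_conj u.2 * f25_conj v.1 - f25_conj u.1 * f25_conj v.2) &&
      all (fun e => if f25_eq (e * f25_conj e) f25_1 then
        let g := secant_frame u e v in
        if separable_quartic g then
          if count_shared g == 3 then is_neighbour g else true
        else true
      else true) f25_all
    else true)
    isotropic_pairs) isotropic_pairs.

(** Representatives of the ten neighbours under the moves [sl2_frame], both of them secant frames,
    so that their quartics are even and can be tested by a discriminant. *)
Definition base_neighbours : seq nat := [:: 1; 2].

Definition check_base_neighbours : bool :=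
  all (fun n => let g := component_frame n in
    [&& separable_quartic g, count_shared g == 3,
        f25_is0 (nth f25_0 (quartic g) 1) & f25_is0 (nth f25_0 (quartic g) 3)])
    base_neighbours &&
  all (fun n => has (fun m => has (fun i => has (fun j => (i != j) &&
    same_frames (component_frame n) (mat_mul (component_frame m) (sl2_frame i j)))
    (iota 0 6)) (iota 0 6)) base_neighbours) neighbour_indices.

(** Each quotient of two listed frames is again a listed frame up to the stabiliser, and its index
    [m] tells whether it is a neighbour of the base conic. *)
Definition check_adjacency : bool :=
  all (fun i => all (fun j =>
    let w := mat_mul (component_frame j) (mat_inv (component_frame i)) in
    has (fun m => same_frames w (component_frame m) &&
           ((m \in neighbour_indices) == triangular_index i j)) (iota 0 21))
    (iota 0 21)) (iota 0 21).

Definition check_closed : bool :=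
  all (fun i => all (fun n => has (fun j =>
    same_frames (mat_mul (component_frame n) (component_frame i)) (component_frame j))
    (iota 0 21)) neighbour_indices) (iota 0 21).

Definition check_distinct : bool :=
  all (fun i => all (fun j => (i != j) ==>
    ~~ same_frames (component_frame i) (component_frame j)) (iota 0 21)) (iota 0 21).

Definition on_frame (x : vec) (g : mat) : bool :=
  f25_is0 (vec_conic (vec_mul x (mat_inv g))).

(** An isotropic vector with last coordinate 0 is a multiple of (1, 0, 0), since its middle
    coordinate b satisfies -2 b^6 = 0; all others are scaled to last coordinate 1. *)
Definition check_partition : bool :=
  let one x := count (on_frame x) component_frames == 1 in
  one (Vec f25_1 f25_0 f25_0) &&
  all (fun a => all (fun b => let x := Vec a b f25_1 in
    if f25_is0 (vec_herm x x) then one x else true) f25_all) f25_all.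

(** The conjugate divided by the norm a^2 - 2 b^2, which is inverted in F_5 by cubing. *)
Definition f25_inv (x : f25) : f25 :=
  let: F25 a b := x in
  let n := f5_add (f5_mul a a) (f5_mul A3 (f5_mul b b)) in
  let i := f5_mul n (f5_mul n n) in
  F25 (f5_mul i a) (f5_opp (f5_mul i b)).

(** Frames fixing the point (0, 0, 1), scaled to middle entry 1. Unitarity determines the first two
    entries of the first row from [mu] and [x]; it only restricts the trace of a multiple of [w],
    which leaves five values. *)
Definition borel_frame (mu x w : f25) : mat :=
  let l := f25_conj (f25_inv mu) in
  Mat (Vec l (f25_3 * (l * f25_conj x)) w) (Vec f25_0 f25_1 x) (Vec f25_0 f25_0 mu).

(** Representatives of the six classes of non-zero elements of F_25 modulo those of F_5. *)
Definition borel_scales : seq f25 := f25_1 :: [seq F25 a A1 | a <- f5_all].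

(* One frame for each conic of the family through the point (0,0,1). *)
Definition pencil_frames : seq mat :=
  [seq g <- [seq borel_frame ms.1 (F25 A0 ms.2 * ms.1) w |
               ms <- [seq (m, s) | m <- borel_scales, s <- f5_all], w <- f25_all] |
     mat_unitary g].

(** For non-zero [a], the substitution t -> a t on the base conic: a^3 is 1/a. *)
Definition diag_frame (a : f5) : mat :=
  Mat (Vec (F25 (f5_mul a (f5_mul a a)) A0) f25_0 f25_0) (Vec f25_0 f25_1 f25_0)
      (Vec f25_0 f25_0 (F25 a A0)).

(** The substitution t -> t + r on the base conic. *)
Definition shear_frame (r : f5) : mat :=
  Mat (Vec f25_1 (F25 r A0) (F25 (f5_mul r r) A0))
      (Vec f25_0 f25_1 (F25 (f5_add r r) A0)) (Vec f25_0 f25_0 f25_1).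

(** A diagonal left factor scales [mu] by F_5, then a shear adds [2 r mu'] to [x]; this brings [mu]
    to one of the six scales and [x / mu'] to a multiple of sqrt 2. *)
Definition check_normalisation : bool :=
  all (fun r => same_conic (shear_frame r) && mat_unitary (shear_frame r)) f5_all &&
  all (fun mu => f25_is0 mu || all (fun x =>
    has (fun a => [&& same_conic (diag_frame a), mat_unitary (diag_frame a) &
      has (fun r => let mu' := F25 a A0 * mu in
        (mu' \in borel_scales) &&
        has (fun s => f25_eq (x + F25 (f5_add r r) A0 * mu') (F25 A0 s * mu')) f5_all)
      f5_all]) f5_all) f25_all) f25_all.

Definition check_pencil : bool :=
  (size pencil_frames == 150) && pairwise (fun g h => ~~ same_frames g h) pencil_frames.

Lemma component_framesP : check_component_frames. Proof. by vm_compute. Qed.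
Lemma sl2_framesP : check_sl2_frames. Proof. by vm_compute. Qed.
Lemma neighbour_movesP : check_neighbour_moves. Proof. by vm_compute. Qed.
Lemma secant_framesP : check_secant_frames. Proof. by vm_compute. Qed.
Lemma base_neighboursP : check_base_neighbours. Proof. by vm_compute. Qed.
Lemma adjacencyP : check_adjacency. Proof. by vm_compute. Qed.
Lemma closedP : check_closed. Proof. by vm_compute. Qed.
Lemma distinctP : check_distinct. Proof. by vm_compute. Qed.
Lemma partitionP : check_partition. Proof. by vm_compute. Qed.
Lemma normalisationP : check_normalisation. Proof. by vm_compute. Qed.
Lemma pencilP : check_pencil. Proof. by vm_compute. Qed.

End ConicFrames.
Import ConicFrames.

Import GRing.Theory.
Local Open Scope ring_scope.
Local Open Scope classical_set_scope.
Local Open Scope card_scope.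

Local Notation "x %:F" := (FracField.tofrac x).
Local Notation pullback phi := (mmap (@polyC _) phi).

(** * Projective spaces and intersection multiplicities *)

Section Projective.
Variables (k : fieldType) (V : vectType k).
Implicit Types (P Q : projectivization V) (u v w : V) (s : seq V).

Definition generator P : V := vpick (sval P).

Definition proportional u v : Prop := exists2 c : k, c != 0 & u = c *: v.

Lemma proportional_refl u : proportional u u.
Proof. by exists 1; rewrite ?oner_eq0 ?scale1r. Qed.

Lemma proportional_sym u v : proportional u v -> proportional v u.
Proof.
by case=> c c0 ->; exists c^-1; rewrite ?invr_eq0 // scalerA mulVf ?scale1r.
Qed.

Lemma proportional_trans v u w :
  proportional u v -> proportional v w -> proportional u w.
Proof.
by case=> c c0 -> [d d0 ->]; exists (c * d); rewrite ?mulf_neq0 ?scalerA.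
Qed.

Lemma generator_neq0 P : generator P != 0.
Proof.
case: P => U dU; rewrite /generator vpick0 /=.
by apply: contraTneq dU => ->; rewrite dimv0.
Qed.

Lemma sval_generator P : sval P = <[generator P]>%VS.
Proof.
apply/esym/eqP; rewrite eqEdim dim_vline generator_neq0.
rewrite -memvE memv_pick /=.
by case: P => U /= /eqP ->.
Qed.

Lemma generator_inj P Q : proportional (generator P) (generator Q) -> P = Q.
Proof.
case=> c c0 PQ; apply: val_inj => /=; rewrite !sval_generator PQ.
apply/eqP; rewrite eqEdim !dim_vline scaler_eq0 (negPf c0) /=.
by rewrite leqnn andbT -memvE memvZ ?memv_line.
Qed.

Lemma exists_generator v : v != 0 -> exists P, proportional (generator P) v.
Proof.
move=> v0; have dv : \dim <[v]>%VS == 1%N by rewrite dim_vline v0.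
pose P : projectivization V := exist _ <[v]>%VS dv.
have /vlineP[c gE] : generator P \in <[v]>%VS.
  by have /= -> := sval_generator P; rewrite memv_line.
exists P, c => //; apply: contraTneq (generator_neq0 P) => c0.
by rewrite negbK gE c0 scale0r.
Qed.

Definition nonproportional s : Prop :=
  [/\ uniq s, 0 \notin s & {in s &, forall u v, proportional u v -> u = v}].

(** Points and lines are both counted through lists of pairwise non-proportional vectors. *)
Lemma card_projective s (X : set (projectivization V)) : nonproportional s ->
  (forall P, X P <-> exists2 v, v \in s & proportional (generator P) v) ->
  X #= `I_(size s).
Proof.
case=> us s0 sprop XE.
have /choice[f fP] : forall i : 'I_(size s),
    exists P, proportional (generator P) (nth 0 s i).
  move=> i; apply: exists_generator; apply: contraNneq s0 => <-.
  exact: mem_nth.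
have -> : X = f @` setT.
  apply/seteqP; split=> P.
    case/XE => v vs Pv; have iv : (index v s < size s)%N by rewrite index_mem.
    exists (Ordinal iv) => //; apply: generator_inj.
    apply: (proportional_trans (fP _)); rewrite /= nth_index //.
    exact: proportional_sym.
  case=> i _ <-; apply/XE; exists (nth 0 s i); [exact: mem_nth|exact: fP].
apply: card_eq_trans (card_esym card_II).
apply: inj_card_eq => i j _ _ fij; apply/val_inj/eqP.
rewrite /= -(nth_uniq 0 (ltn_ord i) (ltn_ord j) us); apply/eqP.
apply: sprop; rewrite ?mem_nth //.
by apply: proportional_trans (proportional_sym (fP i)) _; rewrite fij.
Qed.

Lemma card_projectiveP n (X : set (projectivization V)) : X #= `I_n ->
  exists s, [/\ size s = n, uniq s &
    forall v, v \in s <-> exists2 P, X P & v = generator P].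
Proof.
move=> /card_esym XI.
have /card_bijP[f [g fK gK]] := card_eq_trans (card_esym card_II) XI.
pose F (i : 'I_n) : projectivization V := val (f (SigSub (mem_setT i))).
have Finj : injective F.
  by move=> i j /val_inj/(can_inj fK)/(congr1 val).
have FX i : X (F i) by apply: set_mem; exact: valP.
have Fsurj P : X P -> exists i, F i = P.
  move=> /mem_set XP; exists (val (g (SigSub XP))); rewrite /F.
  have -> : SigSub (mem_setT (val (g (SigSub XP)))) = g (SigSub XP).
    exact: val_inj.
  by rewrite gK.
exists [seq generator (F i) | i <- enum 'I_n]; split.
- by rewrite size_map size_enum_ord.
- rewrite map_inj_uniq ?enum_uniq // => i j fij; apply: Finj.
  by apply: generator_inj; rewrite fij; exact: proportional_refl.
- move=> v; split=> [/mapP[i _ ->]|[_ /Fsurj[i <-] ->]]; first by exists (F i).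
  by apply/mapP; exists i; rewrite ?mem_enum.
Qed.

End Projective.

Lemma dhomog_mmapZ (R : comNzRingType) (S : comNzRingType) (f : {rmorphism R -> S})
    (n m : nat) (h : 'I_n -> S) (c : S) (a : {mpoly R[n]}) :
  a \is m.-homog -> mmap f (fun i => c * h i) a = c ^+ m * mmap f h a.
Proof.
move=> /dhomogP a_m; rewrite /mmap big_distrr /=.
rewrite big_seq [RHS]big_seq; apply: eq_bigr => mm /a_m <-.
rewrite mulrCA; congr (_ * _); rewrite /mmap1 /= mdegE -prodrXr -big_split /=.
by apply: eq_bigr => i _; rewrite exprMn.
Qed.

Lemma horner_pullback (k : comNzRingType) (n : nat) (phi : 'I_n -> {poly k}) (t : k)
    (a : {mpoly k[n]}) :
  (pullback phi a).[t] = a.@[fun i => (phi i).[t]].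
Proof.
rewrite /meval /mmap horner_sum; apply: eq_bigr => m _.
rewrite hornerM hornerC; congr (_ * _); rewrite /mmap1 horner_prod.
by apply: eq_bigr => i _; rewrite horner_exp.
Qed.

Lemma size_pullback (k : idomainType) (n d m : nat) (phi : 'I_n -> {poly k})
    (a : {mpoly k[n]}) :
  (forall i, (size (phi i) <= d.+1)%N) -> a \is m.-homog ->
  (size (pullback phi a) <= (d * m).+1)%N.
Proof.
move=> phi_d /dhomogP a_m; rewrite /mmap big_seq.
apply: (leq_trans (size_sum _ _ _)); apply/bigmax_leqP_seq => mm _ mm_a.
apply: leq_trans (size_polyMleq _ _) _.
have := size_polyC_leq1 (a@_mm); set s1 := size _.
suff : (size (mmap1 phi mm) <= (d * m).+1)%N.
  set s2 := size _; case: s1 => [|[|]] //= s2_le _; rewrite ?add1n //.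
  exact: leq_trans (leq_pred _) s2_le.
rewrite -(a_m _ mm_a) /= mdegE /mmap1 big_distrr /=.
elim/big_rec2: _ => [|i p x _ xp]; first by rewrite size_poly1.
have := size_polyMleq (phi i ^+ mm i) x.
have := size_poly_exp_leq (phi i) (mm i).
have : ((size (phi i)).-1 * mm i <= d * mm i)%N.
  by rewrite leq_mul2r; apply/orP; right; have := phi_d i; case: (size _).
rewrite -ltnS => h1 h2 h3; apply: leq_trans h3 _.
by have := leq_add (leq_trans h2 h1) xp; rewrite addSn addnS; case: (_ + _)%N.
Qed.

(* [phi] parametrizes [C] near [P], the image of [0]; the forms [M m j] of degree [m]
   restrict to [t^j].  The quotient of the local ring at [P] by the two ideals is then
   identified with [k[t]/(t^r)], where [t^r u] is the restriction of [D]. *)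
Section Multiplicity.
Variables (k : closedFieldType) (P : plane_point k) (d e : nat).
Variables (C : plane_curve k d) (D : plane_curve k e).
Variables (phi : 'I_3 -> {poly k}) (M : nat -> nat -> {mpoly k[3]}).
Variables (r : nat) (u : {poly k}).

Local Notation pb := (pullback phi).

Hypothesis phi_P :
  exists2 c : k, c != 0 & forall i, coord_of P 0 i = c * (phi i).[0].
Hypothesis phi_d : forall i, (size (phi i) <= d.+1)%N.
Hypothesis M_homog : forall m j, (j <= d * m)%N -> M m j \is m.-homog.
Hypothesis pb_M : forall m j, (j <= d * m)%N -> pb (M m j) = 'X^j.
Hypothesis pb_ker : forall n a, a \is (n + d).-homog -> pb a = 0 ->
  exists2 q, q \is n.-homog & a = q * equation C.
Hypothesis pb_C : pb (equation C) = 0.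
Hypothesis pb_D : pb (equation D) = 'X^r * u.
Hypothesis u0 : u.[0] != 0.
Hypothesis d_gt0 : (0 < d)%N.
Hypothesis le_de : (d <= e)%N.

Lemma eval_at_pullback m a : a \is m.-homog ->
  (eval_at P a == 0) = ((pb a).[0] == 0).
Proof.
move=> a_m; case: phi_P => c c0 PE.
have -> : eval_at P a = c ^+ m * (pb a).[0].
  rewrite horner_pullback /eval_at /meval -(dhomog_mmapZ _ _ _ a_m).
  by rewrite -/(meval _ _); apply: meval_eq => i.
by rewrite mulf_eq0 expf_eq0 (negPf c0) andbF.
Qed.

(* [f] is congruent to [v] modulo [t^r] along the parametrization [phi]. *)
Definition expands (f : {fraction {mpoly k[3]}}) (v : {poly k}) : Prop :=
  exists m a b, [/\ a \is m.-homog, b \is m.-homog, (pb b).[0] != 0,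
    f = a%:F / b%:F & 'X^r %| pb a - pb b * v].

Lemma frac_neq0 b : (pb b).[0] != 0 -> b%:F != 0 :> {fraction {mpoly k[3]}}.
Proof. by apply: contra; rewrite tofrac_eq0 => /eqP->; rewrite rmorph0 horner0. Qed.

Lemma local_ringP f : local_ring P f <->
  exists m a b, [/\ a \is m.-homog, b \is m.-homog, (pb b).[0] != 0 &
    f = a%:F / b%:F].
Proof.
split=> -[m [a [b [am bm b0 ->]]]]; exists m, a, b; split=> //.
  by rewrite -(eval_at_pullback bm); apply/eqP.
by apply/eqP; rewrite (eval_at_pullback bm).
Qed.

Lemma coprime_Xr (p : {poly k}) : p.[0] != 0 -> coprimep 'X^r p.
Proof.
move=> p0; rewrite coprimep_sym; apply: coprimep_expr.
by rewrite coprimepX rootE.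
Qed.

(** The denominator is a unit modulo [t^r], by a Bezout relation, so the expansion is a remainder
    modulo [t^r]. *)
Lemma exists_expansion f : local_ring P f ->
  exists2 v : {poly k}, (size v <= r)%N & expands f v.
Proof.
case/local_ringP => m [a [b [am bm b0 ->]]].
case/Bezout_coprimepP: (coprime_Xr b0) => -[x y] /=.
rewrite -size_poly_eq1 => /size_poly1P[c c0 xy].
exists ((c^-1 *: (y * pb a)) %% 'X^r).
  by have := ltn_modp (c^-1 *: (y * pb a)) 'X^r; rewrite size_polyXn ltnS => ->;
     rewrite -size_poly_eq0 size_polyXn.
exists m, a, b; split=> //.
have -> : pb a - pb b * ((c^-1 *: (y * pb a)) %% 'X^r)
        = (c^-1 *: x * pb a) * 'X^r
          + pb b * ((c^-1 *: (y * pb a)) %/ 'X^r) * 'X^r.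
  have := divp_eq (c^-1 *: (y * pb a)) 'X^r.
  set q := _ %/ _; set w := _ %% _ => E.
  have E2 : pb a = c^-1 *: x * 'X^r * pb a + c^-1 *: y * pb b * pb a.
    rewrite -mulrDl -!scalerAl -scalerDr xy -mul_polyC -polyCM mulVf //.
    by rewrite mul1r.
  rewrite {1}E2; move: E; rewrite -!mul_polyC => E.
  have -> : w = c^-1%:P * (y * pb a) - q * 'X^r by rewrite E; ring.
  ring.
by rewrite -mulrDl dvdp_mull.
Qed.

Lemma expands_unique f v w : expands f v -> expands f w -> 'X^r %| v - w.
Proof.
case=> m [a [b [am bm b0 fE va]]] [m' [a' [b' [am' bm' b0' fE' wa']]]].
have E : a * b' = a' * b.
  apply/eqP; rewrite -tofrac_eq !tofracM; apply/eqP.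
  move: fE'; rewrite fE => /eqP; rewrite eqr_div ?frac_neq0 //.
  by move/eqP.
have /Gauss_dvdpr <- : coprimep 'X^r (pb b * pb b').
  by apply: coprime_Xr; rewrite hornerM mulf_neq0.
have -> : pb b * pb b' * (v - w) =
   pb b * (pb a' - pb b' * w) - pb b' * (pb a - pb b * v).
  have := congr1 pb E; rewrite !rmorphM /= => E'.
  rewrite !mulrBr [pb b' * pb a]mulrC E'; ring.
by rewrite dvdp_sub // dvdp_mull.
Qed.

Lemma expands_local f v : expands f v -> local_ring P f.
Proof. by case=> m [a [b [am bm b0 fE _]]]; apply/local_ringP; exists m, a, b. Qed.

Lemma expandsD f g v w : expands f v -> expands g w -> expands (f + g) (v + w).
Proof.
case=> m [a [b [am bm b0 fE va]]] [m' [a' [b' [am' bm' b0' fE' wa']]]].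
exists (m + m')%N, (a * b' + b * a'), (b * b'); split.
- by rewrite rpredD // dhomogM.
- by rewrite dhomogM.
- by rewrite rmorphM hornerM mulf_neq0.
- by rewrite fE fE' addf_div ?frac_neq0 // tofracD !tofracM [b%:F * a'%:F]mulrC.
have -> : pb (a * b' + b * a') - pb (b * b') * (v + w) =
   pb b' * (pb a - pb b * v) + pb b * (pb a' - pb b' * w).
  rewrite rmorphD !rmorphM /=; ring.
by rewrite dvdp_add // dvdp_mull.
Qed.

Lemma expandsZ (c : k) f v : expands f v -> expands ((c%:MP)%:F * f) (c *: v).
Proof.
case=> m [a [b [am bm b0 fE va]]].
exists m, (c *: a), b; split=> //.
- by rewrite rpredZ.
- by rewrite fE mulrA -tofracM mul_mpolyC.
by rewrite mmapZ /= mul_polyC -scalerAr -scalerBr -mul_polyC dvdp_mull.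
Qed.

(** The surjective half of the identification with polynomials in [t]; the hypothesis [pb_ker]
    describes the kernel. *)
Lemma lift_pullback m (p : {poly k}) : (size p <= (d * m).+1)%N ->
  exists2 a, a \is m.-homog & pb a = p.
Proof.
move=> sp; exists (\sum_(i < size p) p`_i *: M m i).
  apply: rpred_sum => i _; rewrite rpredZ // M_homog //.
  by rewrite -ltnS (leq_trans (ltn_ord i)).
rewrite rmorph_sum -[RHS]coefK poly_def /=; apply: eq_bigr => i _.
by rewrite mmapZ /= mul_polyC pb_M // -ltnS (leq_trans (ltn_ord i)).
Qed.

Lemma equation_homog d' (E : plane_curve k d') : equation E \is d'.-homog.
Proof. exact: valP. Qed.

(** If [a] restricts to [t^r a'], lift [a'] to [A] and [u] to [U]. Then [a U - A D] restricts to 0,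
    hence is a multiple of [C], and dividing by [b U], which does not vanish at [P], splits [a / b]
    between the two ideals. *)
Lemma expands0_ideal f : expands f 0 ->
  exists g h, [/\ local_ideal P C g, local_ideal P D h & f = g + h].
Proof.
case=> m [a [b [am bm b0 ->]]]; rewrite mulr0 subr0 => /dvdpP[a' aE].
have u_neq0 : u != 0 by apply: contraNneq u0 => ->; rewrite horner0.
have [U Ue UE] : exists2 a, a \is e.-homog & pb a = u.
  apply: lift_pullback.
  have := size_pullback phi_d (equation_homog D).
  by rewrite pb_D mulrC size_Mmonic ?monicXn // size_polyXn addnS /=;
    apply: leq_trans; rewrite leq_addr.
have [A Am AE] : exists2 a, a \is m.-homog & pb a = a'.
  apply: lift_pullback; have := size_pullback phi_d am; rewrite aE.
  have [->|a'0] := eqVneq a' 0; first by rewrite size_poly0.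
  by rewrite size_Mmonic ?monicXn // size_polyXn addnS /=;
    apply: leq_trans; rewrite leq_addr.
have homU : a * U - A * equation D \is (m + e - d + d).-homog.
  rewrite subnK ?(leq_trans le_de) ?leq_addl //.
  by rewrite rpredB // dhomogM // equation_homog.
have [|q qn qE] := pb_ker homU.
  by rewrite rmorphB !rmorphM /= AE UE aE pb_D; ring.
have bU0 : (pb (b * U)).[0] != 0 by rewrite rmorphM /= hornerM UE mulf_neq0.
exists ((q * equation C)%:F / (b * U)%:F), ((A * equation D)%:F / (b * U)%:F).
split.
- exists (m + e - d)%N, q, (b * U); split=> //.
    by rewrite subnK ?(leq_trans le_de) ?leq_addl // dhomogM.
  by apply/eqP; rewrite (eval_at_pullback (dhomogM bm Ue)).
- exists m, A, (b * U); split=> //; first by rewrite dhomogM.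
  by apply/eqP; rewrite (eval_at_pullback (dhomogM bm Ue)).
rewrite -mulrDl -tofracD -qE subrK !tofracM.
apply/eqP; rewrite eqr_div ?mulf_neq0 ?frac_neq0 ?UE //.
by rewrite mulrCA mulrA; apply/eqP; ring.
Qed.

Lemma local_ideal_expands0 g h :
  local_ideal P C g -> local_ideal P D h -> expands (g + h) 0.
Proof.
move=> gC hD; rewrite -[0]addr0; apply: expandsD.
  case: gC => m [a [b [am bm b0 ->]]]; exists (m + d)%N, (a * equation C), b.
  split=> //; first by rewrite dhomogM // equation_homog.
    by rewrite -(eval_at_pullback bm); apply/eqP.
  by rewrite rmorphM /= pb_C !mulr0 subr0 dvdp0.
case: hD => m [a [b [am bm b0 ->]]]; exists (m + e)%N, (a * equation D), b.
split=> //; first by rewrite dhomogM // equation_homog.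
  by rewrite -(eval_at_pullback bm); apply/eqP.
by rewrite rmorphM /= pb_D mulr0 subr0 mulrCA dvdp_mulr.
Qed.

Lemma expands_comb n (w : 'I_n -> {fraction {mpoly k[3]}}) (T : 'M[k]_(n, r))
    (c : 'rV[k]_n) :
  (forall i, expands (w i) (rVpoly (row i T))) ->
  expands (\sum_(i < n) ((c 0 i)%:MP)%:F * w i) (rVpoly (c *m T)).
Proof.
move=> wT; rewrite mulmx_sum_row linear_sum /=.
elim/big_ind2: _ => [|f v g v' fv gv|i _].
- exists 0%N, 0, 1; rewrite rpred0 dhomog1 !rmorph0 rmorph1 hornerC oner_neq0.
  by split=> //; rewrite ?mul0r // mulr0 subr0 dvdp0.
- exact: expandsD.
by rewrite linearZ; exact: expandsZ.
Qed.

Lemma expands_rVpoly_inj f (v w : 'rV[k]_r) :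
  expands f (rVpoly v) -> expands f (rVpoly w) -> v = w.
Proof.
move=> fv fw; apply: (can_inj rVpolyK); apply/eqP.
rewrite -subr_eq0; have := expands_unique fv fw.
apply: contraTT => vw; apply/negP => /(dvdp_leq vw).
rewrite size_polyXn -linearB /= leqNgt ltnS.
by rewrite size_poly.
Qed.

(** The powers of the local parameter [M 1 1 / M 1 0] expand to the monomials. *)
Lemma standard_expansion : exists w : 'I_r -> {fraction {mpoly k[3]}},
  forall i, expands (w i) (rVpoly (row i 1%:M)).
Proof.
exists (fun i => (M 1 1 ^+ i)%:F / (M 1 0 ^+ i)%:F) => i.
exists i, (M 1 1 ^+ i), (M 1 0 ^+ i); split=> //.
- by rewrite -[X in X.-homog]mul1n dhomogMn // M_homog // muln1.
- by rewrite -[X in X.-homog]mul1n dhomogMn // M_homog.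
- by rewrite rmorphXn /= pb_M // expr0 expr1n hornerC oner_neq0.
rewrite !rmorphXn /= !pb_M ?muln1 // expr0 expr1n expr1 mul1r row1 rVpoly_delta.
by rewrite subrr dvdp0.
Qed.

(** The expansions of any basis form an [n] by [r] matrix: uniqueness of coefficients makes it row
    free, spanning makes it row full, so its rank is both [n] and [r]. *)
Lemma intersection_multiplicityP n : intersection_multiplicity P C D n <-> n = r.
Proof.
have [w wE] := standard_expansion.
have opp f v : expands f v -> expands (- f) (- v).
  move=> /(expandsZ (-1)); rewrite scaleN1r rmorphN1 tofracN tofrac1.
  by rewrite mulN1r.
have local0 : exists g h, [/\ local_ideal P C g, local_ideal P D h & 0 = g + h].
  apply: expands0_ideal; exists 0%N, 0, 1.
  rewrite rpred0 dhomog1 !rmorph0 rmorph1 hornerC oner_neq0.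
  by split=> //; rewrite ?mul0r // mulr0 subr0 dvdp0.
split=> [[z [z_local zE]]|->]; last first.
  exists w; split=> [i|f]; first exact: expands_local (wE i).
  case/exists_expansion => v sv fv; exists (poly_rV v); split.
    have := expandsD fv (opp _ _ (expands_comb (poly_rV v) wE)).
    rewrite mulmx1 poly_rV_K // subrr => /expands0_ideal[g [h [gC hD E]]].
    by exists g, h; split=> //; rewrite -E addrC subrK.
  move=> c [g [h [gC hD fE]]].
  have := expandsD (expands_comb c wE) (local_ideal_expands0 gC hD).
  rewrite -fE addr0 mulmx1 => fc; rewrite -(poly_rV_K sv) in fv.
  exact: expands_rVpoly_inj fv fc.
have /choice[T0 T0E] : forall i, exists v : 'rV[k]_r, expands (z i) (rVpoly v).
  move=> i; case: (exists_expansion (z_local i)) => v sv zv.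
  by exists (poly_rV v); rewrite poly_rV_K.
pose T := \matrix_i T0 i.
have zT i : expands (z i) (rVpoly (row i T)) by rewrite rowK.
have Tfree : row_free T.
  apply: inj_row_free => c cT0.
  have := expands_comb c zT; rewrite cT0 linear0 => /opp; rewrite oppr0.
  case/expands0_ideal => g [h [gC hD E]].
  have [|c0 [_ c0U]] := zE 0.
    by apply: (@expands_local _ 0); case: local0 => g0 [h0 [g0C h0D ->]];
      apply: local_ideal_expands0.
  rewrite -(c0U c); first rewrite -(c0U 0) //.
    case: local0 => g0 [h0 [g0C h0D E0]]; exists g0, h0; split=> //.
    by rewrite -E0 addr0 big1 // => i _; rewrite mxE mpolyC0 tofrac0 mul0r.
  by exists g, h; split=> //; rewrite -E subrr.
have Tfull : row_full T.
  rewrite -sub1mx; apply/row_subP => i.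
  have [|c [[g [h [gC hD E]]] _]] := zE (w i); first exact: expands_local (wE i).
  have := expandsD (expands_comb c zT) (local_ideal_expands0 gC hD).
  rewrite -E addr0 => /expands_rVpoly_inj/(_ (wE i)) <-.
  exact: submxMl.
exact: etrans (esym (eqP Tfree)) (eqP Tfull).
Qed.

End Multiplicity.

Section Coordinates.
Variable (k : fieldType).
Implicit Types (B : 'M[k]_3) (x : 'rV[k]_3).

(** The linear forms that read off the coordinates of a row vector in the basis formed by the rows
    of [B]. *)
Definition coordinates B : 'rV[{mpoly k[3]}]_3 :=
  (\row_j 'X_j) *m map_mx (@mpolyC 3 k) (invmx B).

Lemma coordinatesE B i : coordinates B 0 i = \sum_j invmx B j i *: 'X_j.
Proof. by rewrite mxE; apply: eq_bigr => j _; rewrite !mxE mulrC mul_mpolyC. Qed.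

Lemma coordinates_homog B i : coordinates B 0 i \is 1.-homog.
Proof.
rewrite coordinatesE; apply: rpred_sum => j _.
by rewrite rpredZ // dhomogX /= mdeg1.
Qed.

Lemma coordinates_inv B : B \in unitmx ->
  coordinates B *m map_mx (@mpolyC 3 k) B = \row_j 'X_j.
Proof. by move=> Bu; rewrite -mulmxA -map_mxM mulVmx // map_mx1 mulmx1. Qed.

Lemma mmap_coordinates (S : comNzRingType) (f : {rmorphism k -> S})
    (h : 'I_3 -> S) B :
  map_mx (mmap f h) (coordinates B) = (\row_j h j) *m map_mx f (invmx B).
Proof.
apply/rowP => i; rewrite mxE coordinatesE rmorph_sum mxE /=.
by apply: eq_bigr => j _; rewrite mmapZ mmapX mmap1U !mxE mulrC.
Qed.

Lemma meval_coordinates x B i : (coordinates B 0 i).@[x 0] = (x *m invmx B) 0 i.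
Proof.
rewrite coordinatesE [LHS]raddf_sum mxE; apply: eq_bigr => j _ /=.
by rewrite mevalZ mevalXU mulrC.
Qed.

End Coordinates.

Lemma mpolyX_seq (R : comNzRingType) n (m : 'X_{1..n}) :
  exists2 s : seq 'I_n, size s = mdeg m & 'X_[R, m] = \prod_(i <- s) 'X_i.
Proof.
exists (flatten [seq nseq (m i) i | i <- enum 'I_n]).
  rewrite size_flatten /shape -map_comp sumnE big_map big_enum mdegE /=.
  by apply: eq_bigr => i _; rewrite /= size_nseq.
rewrite big_flatten big_map big_enum mpolyXE_id /=.
by apply: eq_bigr => i _; rewrite big_nseq iter_mulr_1.
Qed.

(** * Restriction of forms to a parametrized curve and its kernel *)

Section Parametrization.
Variables (k : closedFieldType) (d : nat) (B : 'M[k]_3).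
Variables (eps : 'rV[{poly k}]_3) (F : {mpoly k[3]}).
Variable M : nat -> nat -> {mpoly k[3]}.

Definition parametrization i : {poly k} := (eps *m map_mx (@polyC k) B) 0 i.

Local Notation pb := (pullback parametrization).
Local Notation Y := (coordinates B).

Hypothesis B_unit : B \in unitmx.
Hypothesis eps_d : forall i, (size (eps 0%R i) <= d.+1)%N.
Hypothesis M_homog : forall m j, (j <= d * m)%N -> M m j \is m.-homog.
Hypothesis pb_M : forall m j, (j <= d * m)%N -> pb (M m j) = 'X^j.
Hypothesis pb_F : pb F = 0.
Hypothesis d_gt0 : (0 < d)%N.

Lemma pb_coordinates i : pb (Y 0 i) = eps 0 i.
Proof.
have /rowP/(_ i) := mmap_coordinates (@polyC k) parametrization B.
rewrite mxE => ->.
have -> : \row_j parametrization j = eps *m map_mx (@polyC k) B.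
  by apply/rowP => j; rewrite mxE.
by rewrite -mulmxA -map_mxM mulmxV // map_mx1 mulmx1.
Qed.

(* [a] is a combination of the [M m j] modulo the multiples of [F]. *)
Definition reduces m (a : {mpoly k[3]}) : Prop :=
  exists (q : {mpoly k[3]}) (c : nat -> k),
    [/\ q \is (m - d).-homog, (m < d)%N -> q = 0 &
        a = q * F + \sum_(j < (d * m).+1) c j *: M m j].

Hypothesis M_0 : M 0 0 = 1.
Hypothesis M_mul : forall m j i, (j <= d * m)%N -> reduces m.+1 (M m j * Y 0 i).

Lemma reduces0 m : reduces m 0.
Proof.
exists 0, (fun=> 0); rewrite rpred0 mul0r add0r; split=> //.
by rewrite big1 // => i _; rewrite scale0r.
Qed.

Lemma reducesD m a b : reduces m a -> reduces m b -> reduces m (a + b).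
Proof.
case=> q [c [qm q0 ->]] [q' [c' [qm' q0' ->]]].
exists (q + q'), (fun j => c j + c' j); split; first by rewrite rpredD.
  by move=> md; rewrite q0 // q0' // addr0.
rewrite mulrDl addrACA; congr (_ + _); rewrite -big_split /=.
by apply: eq_bigr => j _; rewrite scalerDl.
Qed.

Lemma reducesZ m x a : reduces m a -> reduces m (x *: a).
Proof.
case=> q [c [qm q0 ->]]; exists (x *: q), (fun j => x * c j).
split; [by rewrite rpredZ|by move=> md; rewrite q0 // scaler0|].
rewrite scalerDr scalerAl; congr (_ + _); rewrite scaler_sumr.
by apply: eq_bigr => j _; rewrite scalerA.
Qed.

Lemma reduces_sum m (I : Type) (s : seq I) (G : I -> {mpoly k[3]}) :
  (forall i, reduces m (G i)) -> reduces m (\sum_(i <- s) G i).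
Proof.
by move=> Gm; elim/big_ind: _ => //; [exact: reduces0|exact: reducesD].
Qed.

Lemma reduces_mulY m a i : reduces m a -> reduces m.+1 (a * Y 0 i).
Proof.
case=> q [c [qm q0 ->]]; rewrite mulrDl mulr_suml; apply: reducesD.
  exists (q * Y 0 i), (fun=> 0); split; last 1 first.
  - by rewrite mulrAC big1 ?addr0 // => j _; rewrite scale0r.
  (* The truncated difference [m.+1 - d] is the successor of [m - d] only for [d <= m]; below that
     the quotient is 0. *)
  - have [md|dm] := ltnP m d; first by rewrite q0 // mul0r rpred0.
    by rewrite subSn // -[X in X.-homog]addn1 dhomogM // coordinates_homog.
  - by move=> md; rewrite q0 ?mul0r // ltnW.
apply: reduces_sum => j; rewrite -scalerAl; apply: reducesZ.
by apply: M_mul; rewrite -ltnS.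
Qed.

Lemma reduces_homog m a : a \is m.-homog -> reduces m a.
Proof.
have step n b i : reduces n b -> reduces n.+1 (b * 'X_i).
  move=> bn; have /rowP/(_ i) := coordinates_inv B_unit.
  rewrite [RHS]mxE => <-; rewrite mxE mulr_sumr; apply: reduces_sum => j.
  rewrite [map_mx _ _ _ _]mxE mulrA mulrC mul_mpolyC; apply: reducesZ.
  exact: reduces_mulY.
move=> /dhomogP a_m; rewrite (mpolyE a) big_seq_cond.
rewrite (eq_bigl (fun mm => mm \in msupp a)) => [|mm]; last by rewrite andbT.
elim/big_rec: _ => [|mm b /a_m /= <- ba]; first exact: reduces0.
apply: reducesD => //; apply: reducesZ => {b ba}.
have mono (s : seq 'I_3) : reduces (size s) (\prod_(i <- s) 'X_i).
  elim: s => [|i s IH]; last by rewrite big_cons mulrC; apply: step.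
  rewrite big_nil /=; exists 0, (fun=> 1); rewrite rpred0 muln0 big_ord1 M_0.
  by split=> //; rewrite mul0r add0r scale1r.
have [s <- ->] := mpolyX_seq k mm; exact: mono.
Qed.

(** Modulo [F] the form is a combination of the [M m j], which restrict to distinct powers of [t]; a
    zero restriction kills every coefficient. *)
Lemma pb_kernel n a : a \is (n + d).-homog -> pb a = 0 ->
  exists2 q, q \is n.-homog & a = q * F.
Proof.
move=> /reduces_homog[q [c [qn _ aE]]] pa; exists q; first by rewrite addnK in qn.
rewrite aE [X in _ + X](_ : _ = 0) ?addr0 //.
apply: big1 => j _; suff -> : c j = 0 by rewrite scale0r.
have : (pb a)`_j = 0 by rewrite pa coef0.
rewrite aE rmorphD rmorphM /= pb_F mulr0 add0r rmorph_sum /= coef_sum.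
rewrite (bigD1 j) //= big1 ?addr0 => [|i ij].
  by rewrite mmapZ /= mul_polyC pb_M -1?ltnS // coefZ coefXn eqxx mulr1.
rewrite mmapZ /= mul_polyC pb_M -1?ltnS // coefZ coefXn.
by rewrite eq_sym [_ == _ :> nat](negPf ij) mulr0.
Qed.

Lemma parametrized_multiplicity (e : nat) (C : plane_curve k d)
    (D : plane_curve k e) (P : plane_point k) (c : k) (r n : nat) (u : {poly k}) :
  c != 0 -> equation C = c *: F ->
  proportional (coord_of P) (\row_i (parametrization i).[0]) ->
  pb (equation D) = 'X^r * u -> u.[0] != 0 -> (d <= e)%N ->
  (intersection_multiplicity P C D n <-> n = r).
Proof.
move=> c0 CE [b b0 PE] pD u0 de.
apply: (@intersection_multiplicityP _ _ _ _ _ _ parametrization M r u) => //.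
- by exists b => // i; rewrite PE !mxE.
- move=> i; rewrite /parametrization mxE; apply: leq_trans (size_sum _ _ _) _.
  apply/bigmax_leqP => j _; rewrite mxE mulrC mul_polyC.
  exact: leq_trans (size_scale_leq _ _) _.
- move=> m a am pa; have [q qm ->] := pb_kernel am pa.
  exists (c^-1 *: q); first by rewrite rpredZ.
  by rewrite CE -scalerAl -scalerAr scalerA mulVf ?scale1r.
- by rewrite CE mmapZ pb_F mulr0.
Qed.

End Parametrization.

Definition i0 : 'I_3 := @Ordinal 3 0 isT.
Definition i1 : 'I_3 := @Ordinal 3 1 isT.
Definition i2 : 'I_3 := @Ordinal 3 2 isT.

Lemma ord3P (i : 'I_3) : [\/ i = i0, i = i1 | i = i2].
Proof.
case: i => [[|[|[|]]]] // p; [constructor 1|constructor 2|constructor 3];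
exact: val_inj.
Qed.

Lemma sum3 (R : nmodType) (G : 'I_3 -> R) : \sum_i G i = G i0 + G i1 + G i2.
Proof.
rewrite !big_ord_recr big_ord0 /= add0r.
by congr (G _ + G _ + G _); apply: val_inj.
Qed.

Definition vec3 (R : nmodType) (a b c : R) : 'rV[R]_3 :=
  \row_i nth 0 [:: a; b; c] i.

Lemma row3P (R : nmodType) (x y : 'rV[R]_3) :
  x 0 i0 = y 0 i0 -> x 0 i1 = y 0 i1 -> x 0 i2 = y 0 i2 -> x = y.
Proof. by move=> e0 e1 e2; apply/rowP => i; case: (ord3P i) => ->. Qed.

(** * Conics and lines as parametrized curves *)

Section ConicsAndLines.
Variable (k : closedFieldType).
Implicit Types (B : 'M[k]_3) (x z : 'rV[k]_3) (P : plane_point k).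

Definition conic_form B : {mpoly k[3]} :=
  coordinates B 0 i1 ^+ 2 - coordinates B 0 i0 * coordinates B 0 i2.

(** The normal form of monomials modulo Y1^2 = Y0 Y2, in which Y1 has exponent at most 1. *)
Definition conic_monomial B m j : {mpoly k[3]} :=
  coordinates B 0 i0 ^+ (m - uphalf j) * coordinates B 0 i1 ^+ odd j *
  coordinates B 0 i2 ^+ j./2.

Definition line_monomial B m j : {mpoly k[3]} :=
  coordinates B 0 i0 ^+ (m - j) * coordinates B 0 i1 ^+ j.

Definition conic_param B := parametrization B (vec3 1 'X ('X ^+ 2)).
Definition line_param B := parametrization B (vec3 1 'X 0).

Let Yhom B i n : coordinates B 0 i ^+ n \is n.-homog.
Proof. by rewrite -[X in X.-homog]mul1n dhomogMn ?coordinates_homog. Qed.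

Lemma conic_form_homog B : conic_form B \is 2.-homog.
Proof.
by rewrite rpredB ?Yhom // (@dhomogM _ _ _ 1 _ 1) ?coordinates_homog.
Qed.

Lemma conic_monomial_homog B m j : (j <= 2 * m)%N -> conic_monomial B m j \is m.-homog.
Proof.
move=> jm; rewrite -[X in X.-homog](_ : m - uphalf j + odd j + j./2 = m)%N.
  by rewrite !dhomogM.
lia.
Qed.

Lemma reduces_monomial d F M m j (a : {mpoly k[3]}) : (j <= d * m)%N ->
  a = M m j -> @reduces k d F M m a.
Proof.
move=> jm ->; exists 0, (fun i => (i == j)%:R); rewrite rpred0 mul0r add0r.
split=> //; rewrite -ltnS in jm; rewrite (bigD1 (Ordinal jm)) //= eqxx scale1r.
rewrite big1 ?addr0 // => i; rewrite -val_eqE /= => /negPf->.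
by rewrite scale0r.
Qed.

Lemma conic_monomial_mul B m j i : (j <= 2 * m)%N ->
  reduces 2 (conic_form B) (conic_monomial B) m.+1
    (conic_monomial B m j * coordinates B 0 i).
Proof.
move=> jm; have jm' : (uphalf j <= m)%N by lia.
case: (ord3P i) => -> {i}; rewrite /conic_monomial.
- apply: (@reduces_monomial _ _ _ _ j); first by rewrite mulnS (leq_trans jm) ?leq_addl.
  by rewrite /conic_monomial subSn // exprS; ring.
- case odd_j: (odd j).
    have j_gt0 : (0 < j)%N by case: j odd_j {jm jm'}.
    have hE : (uphalf j = j./2.+1)%N by rewrite uphalf_half odd_j.
    have mE : (m - j./2 = (m - j./2.+1).+1)%N by lia.
    (* The product contains Y1^2, which is Y0 Y2 plus the conic form: the cofactor of Y1^2 is the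
       quotient, and the monomial of index [j.+1] remains. *)
    exists (coordinates B 0 i0 ^+ (m - uphalf j) * coordinates B 0 i2 ^+ j./2).
    exists (fun i => (i == j.+1)%:R).
    have jm2 : (j.+1 < (2 * m.+1).+1)%N by rewrite mulnS ltnS add2n ltnS leqW.
    split=> [|m0|].
    + have -> : (m.+1 - 2 = m - uphalf j + j./2)%N by lia.
      by rewrite dhomogM.
    + lia.
    rewrite (bigD1 (Ordinal jm2)) //= eqxx scale1r big1 ?addr0 => [|i].
      rewrite /conic_monomial /= odd_j /= hE subSS mE /conic_form !exprS ?expr0; ring.
    by rewrite -val_eqE /= => /negPf->; rewrite scale0r.
  apply: (@reduces_monomial _ _ _ _ j.+1).
    by rewrite mulnS add2n ltnS leqW.
  rewrite /conic_monomial /= odd_j /=.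
  by rewrite (_ : uphalf j = j./2) ?uphalf_half ?odd_j // subSS; ring.
- apply: (@reduces_monomial _ _ _ _ j.+2); first by rewrite mulnS add2n !ltnS.
  by rewrite /conic_monomial /= negbK subSS exprS; ring.
Qed.

Lemma line_monomial_homog B m j : (j <= 1 * m)%N -> line_monomial B m j \is m.-homog.
Proof.
rewrite mul1n => jm; rewrite -[X in X.-homog](subnK jm).
by rewrite dhomogM.
Qed.

Lemma line_monomial_mul B m j i : (j <= 1 * m)%N ->
  reduces 1 (coordinates B 0 i2) (line_monomial B) m.+1
    (line_monomial B m j * coordinates B 0 i).
Proof.
rewrite mul1n => jm; case: (ord3P i) => -> {i}.
- apply: (@reduces_monomial _ _ _ _ j); first by rewrite mul1n leqW.
  by rewrite /line_monomial subSn // exprS; ring.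
- apply: (@reduces_monomial _ _ _ _ j.+1); first by rewrite mul1n.
  by rewrite /line_monomial subSS exprS; ring.
exists (line_monomial B m j), (fun=> 0); split=> //.
  by rewrite subn1 line_monomial_homog ?mul1n.
by rewrite big1 ?addr0 // => ? _; rewrite scale0r.
Qed.

Lemma pullback_conic_coordinates B i : B \in unitmx ->
  pullback (conic_param B) (coordinates B 0 i) = (vec3 1 'X ('X ^+ 2)) 0 i.
Proof. by move=> Bu; exact: pb_coordinates. Qed.

Lemma pullback_line_coordinates B i : B \in unitmx ->
  pullback (line_param B) (coordinates B 0 i) = (vec3 1 'X 0) 0 i.
Proof. by move=> Bu; exact: pb_coordinates. Qed.

Lemma pullback_conic_form B : B \in unitmx ->
  pullback (conic_param B) (conic_form B) = 0.
Proof.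
move=> Bu; rewrite rmorphB rmorphXn rmorphM /= !pullback_conic_coordinates //.
by rewrite !mxE /= mul1r subrr.
Qed.

Lemma pullback_conic_monomial B m j : B \in unitmx ->
  pullback (conic_param B) (conic_monomial B m j) = 'X^j.
Proof.
move=> Bu; rewrite !rmorphM !rmorphXn /= !pullback_conic_coordinates //.
by rewrite !mxE /= expr1n mul1r -exprM -exprD mul2n odd_double_half.
Qed.

Lemma pullback_line_monomial B m j : B \in unitmx ->
  pullback (line_param B) (line_monomial B m j) = 'X^j.
Proof.
move=> Bu; rewrite !rmorphM !rmorphXn /= !pullback_line_coordinates //.
by rewrite !mxE /= expr1n mul1r.
Qed.

Let size_conic_eps i : (size ((vec3 1 'X ('X ^+ 2) : 'rV[{poly k}]_3) 0%R i) <= 3)%N.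
Proof.
by case: (ord3P i) => ->; rewrite mxE /= ?size_poly1 ?size_polyX ?size_polyXn.
Qed.

Let size_line_eps i : (size ((vec3 1 'X 0 : 'rV[{poly k}]_3) 0%R i) <= 2)%N.
Proof.
by case: (ord3P i) => ->; rewrite mxE /= ?size_poly1 ?size_polyX ?size_poly0.
Qed.

Lemma conic_kernel B n a : B \in unitmx -> a \is (n + 2).-homog ->
  pullback (conic_param B) a = 0 -> exists2 q, q \is n.-homog & a = q * conic_form B.
Proof.
move=> Bu; apply: (@pb_kernel _ _ _ _ _ (conic_monomial B)) => //.
- by move=> m j _; exact: pullback_conic_monomial.
- exact: pullback_conic_form.
- by rewrite /conic_monomial !expr0 !mul1r.
- exact: conic_monomial_mul.
Qed.

Lemma conic_param0 B : \row_i (conic_param B i).[0] = row i0 B.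
Proof.
apply/rowP => i; rewrite !mxE /conic_param /line_param /parametrization mxE.
rewrite horner_sum sum3 !hornerM !mxE /= !hornerE.
by rewrite expr0n /= !mul0r !addr0.
Qed.

Lemma line_param0 B : \row_i (line_param B i).[0] = row i0 B.
Proof.
apply/rowP => i; rewrite !mxE /conic_param /line_param /parametrization mxE.
rewrite horner_sum sum3 !hornerM !mxE /= !hornerE.
by rewrite ?mul0r ?addr0.
Qed.

Lemma conic_multiplicity B (Q : plane_conic k) e (D : plane_curve k e) P c r n u :
  B \in unitmx -> c != 0 -> equation Q = c *: conic_form B ->
  proportional (coord_of P) (row i0 B) ->
  pullback (conic_param B) (equation D) = 'X^r * u -> u.[0] != 0 -> (2 <= e)%N ->
  (intersection_multiplicity P Q D n <-> n = r).
Proof.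
move=> Bu c0 QE; rewrite -conic_param0 => PB DE u0 e2.
apply: (@parametrized_multiplicity _ _ _ _ _ (conic_monomial B)) QE PB DE u0 e2 => //.
- exact: conic_monomial_homog.
- by move=> m j _; exact: pullback_conic_monomial.
- exact: pullback_conic_form.
- by rewrite /conic_monomial !expr0 !mul1r.
- exact: conic_monomial_mul.
Qed.

Lemma line_multiplicity B (l : plane_line k) e (D : plane_curve k e) P c r n u :
  B \in unitmx -> c != 0 -> equation l = c *: coordinates B 0 i2 ->
  proportional (coord_of P) (row i0 B) ->
  pullback (line_param B) (equation D) = 'X^r * u -> u.[0] != 0 -> (1 <= e)%N ->
  (intersection_multiplicity P l D n <-> n = r).
Proof.
move=> Bu c0 lE; rewrite -line_param0 => PB DE u0 e1.
apply: (@parametrized_multiplicity _ _ _ _ _ (line_monomial B)) lE PB DE u0 e1 => //.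
- exact: line_monomial_homog.
- by move=> m j _; exact: pullback_line_monomial.
- by rewrite pullback_line_coordinates // mxE.
- by rewrite /line_monomial !expr0 !mul1r.
- exact: line_monomial_mul.
Qed.

(** The multiplicity computations put the parametrized curve first, while [weierstrass_points] puts
    the tangent line second. *)
Lemma intersection_multiplicityC P d (C : plane_curve k d) e (D : plane_curve k e) n :
  intersection_multiplicity P C D n -> intersection_multiplicity P D C n.
Proof.
case=> u [u_loc uE]; exists u; split=> // f /uE[c [[g [h [gC hD fE]]] cU]].
exists c; split; first by exists h, g; split=> //; rewrite [h + g]addrC.
by move=> c' [g' [h' [? ? ?]]]; apply: cU; exists h', g'; split=> //; rewrite [h' + g']addrC.
Qed.

End ConicsAndLines.

(** * The Hermitian form *)

Definition frob_adj (R : pzRingType) m n (A : 'M[R]_(m, n)) : 'M[R]_(n, m) :=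
  (map_mx (fun x => x ^+ 5) A)^T.

Definition mx3 (R : nmodType) (a b c : 'rV[R]_3) : 'M[R]_3 :=
  \matrix_i nth 0 [:: a; b; c] i.

Definition gram (R : pzRingType) : 'M[R]_3 :=
  mx3 (vec3 0 0 1) (vec3 0 (- 2%:R) 0) (vec3 1 0 0).

(* Chosen so that its value at [(1, t, t^2)] is [(t^5 - t)^2]: the conic
   [x1^2 = x0 x2] is tangent to [herm x x = 0] at its points over F_5. *)
Definition herm (R : pzRingType) (x y : 'rV[R]_3) : R :=
  (x *m gram R *m frob_adj y) 0 0.

Definition unitary (R : pzRingType) (g : 'M[R]_3) : Prop :=
  g *m gram R *m frob_adj g = gram R.

Section Adjoint.
Variable (R : comNzRingType).
Hypothesis char5 : 5%N \in [pchar R].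

Lemma nat5 : 5%:R = 0 :> R. Proof. exact: pcharf0 char5. Qed.

Lemma pow5D (x y : R) : (x + y) ^+ 5 = x ^+ 5 + y ^+ 5.
Proof. exact: pFrobenius_autD_comm char5 _ _ (mulrC _ _). Qed.

Lemma frob_adjE m n (A : 'M[R]_(m, n)) :
  frob_adj A = (map_mx (pFrobenius_aut char5) A)^T.
Proof. by apply/matrixP => i j; rewrite !mxE. Qed.

Lemma frob_adjM m n p (A : 'M[R]_(m, n)) (B : 'M[R]_(n, p)) :
  frob_adj (A *m B) = frob_adj B *m frob_adj A.
Proof. by rewrite !frob_adjE map_mxM trmx_mul. Qed.

Lemma frob_adjZ m n a (A : 'M[R]_(m, n)) : frob_adj (a *: A) = a ^+ 5 *: frob_adj A.
Proof. by apply/matrixP => i j; rewrite !mxE exprMn. Qed.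

Lemma frob_adj_gram : frob_adj (gram R) = gram R.
Proof.
have n5 : (- 2%:R) ^+ 5 = - 2%:R :> R.
  have := nat5 => n5.
  have -> : (- 2%:R) ^+ 5 = - 2%:R - (6%:R * 5%:R) :> R by ring.
  by rewrite n5 mulr0 subr0.
apply/matrixP => i j; rewrite !mxE.
by case: (ord3P i) (ord3P j) => -> [] ->; rewrite !mxE /= ?expr0n ?expr1n ?n5.
Qed.

Lemma hermE (x y : 'rV[R]_3) :
  herm x y = x 0 i0 * y 0 i2 ^+ 5 - 2%:R * x 0 i1 * y 0 i1 ^+ 5 + x 0 i2 * y 0 i0 ^+ 5.
Proof. by rewrite /herm !(mxE, sum3) /=; ring. Qed.

Lemma hermZ (a : R) (x : 'rV[R]_3) : herm (a *: x) (a *: x) = a ^+ 6 * herm x x.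
Proof. by rewrite !hermE !mxE; ring. Qed.

Lemma herm_unitary (g : 'M[R]_3) (x y : 'rV[R]_3) :
  unitary g -> herm (x *m g) (y *m g) = herm x y.
Proof.
by move=> gu; rewrite /herm frob_adjM !mulmxA -(mulmxA x) -(mulmxA x) gu.
Qed.

Lemma unitaryM (g h : 'M[R]_3) : unitary g -> unitary h -> unitary (g *m h).
Proof.
move=> gu hu; rewrite /unitary frob_adjM !mulmxA -(mulmxA g) -(mulmxA g).
by rewrite hu gu.
Qed.

(** [x *m frob_adj x] is the Fermat form, so such a [B] carries it to [herm]. *)
Lemma herm_orthogonal (B : 'M[R]_3) (y : 'rV[R]_3) : B *m frob_adj B = gram R ->
  ((y *m B) *m frob_adj (y *m B)) 0 0 = herm y y.
Proof. by move=> BE; rewrite frob_adjM mulmxA -(mulmxA y) BE. Qed.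

Lemma frob_adj1 n : frob_adj (1%:M : 'M[R]_n) = 1%:M.
Proof. by rewrite frob_adjE map_mx1 trmx1. Qed.

Lemma unitary1 : unitary (1%:M : 'M[R]_3).
Proof. by rewrite /unitary mul1mx frob_adj1 mulmx1. Qed.

End Adjoint.

Section AdjointMorphism.
Variables (R S : comNzRingType) (f : {rmorphism R -> S}).

Lemma map_frob_adj m n (A : 'M[R]_(m, n)) : map_mx f (frob_adj A) = frob_adj (map_mx f A).
Proof. by apply/matrixP => i j; rewrite !mxE rmorphXn. Qed.

Lemma map_gram : map_mx f (gram R) = gram S.
Proof.
apply/matrixP => i j; rewrite !mxE.
case: (ord3P i) (ord3P j) => -> [] ->;
by rewrite !mxE /= ?rmorph0 ?rmorph1 ?rmorphN ?rmorph_nat.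
Qed.

Lemma map_herm (x y : 'rV[R]_3) : f (herm x y) = herm (map_mx f x) (map_mx f y).
Proof. by rewrite /herm -map_gram -map_frob_adj -!map_mxM [RHS]mxE. Qed.

Lemma map_unitary (g : 'M[R]_3) : unitary g -> unitary (map_mx f g).
Proof. by move=> gu; rewrite /unitary -map_gram -map_frob_adj -!map_mxM gu. Qed.

Lemma map_orthogonal (B : 'M[R]_3) : B *m frob_adj B = gram R ->
  map_mx f B *m frob_adj (map_mx f B) = gram S.
Proof. by move=> BE; rewrite -map_gram -map_frob_adj -!map_mxM BE. Qed.

End AdjointMorphism.

Section UnitaryGroup.
Variable (k : fieldType).
Hypothesis char5 : 5%N \in [pchar k].
Implicit Types (g h : 'M[k]_3).

Lemma unitary_herm g :
  unitary g <-> forall i j, herm (row i g) (row j g) = gram k i j.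
Proof.
rewrite /unitary; split=> [hu i j|hE].
  have /matrixP/(_ i j) := hu => <-.
  by rewrite /herm !(mxE, sum3).
by apply/matrixP => i j; rewrite -hE /herm !(mxE, sum3).
Qed.

Lemma gram_unit : gram k \in unitmx.
Proof.
suff /mulmx1_unit[] : gram k *m mx3 (vec3 0 0 1) (vec3 0 2%:R 0) (vec3 1 0 0) = 1%:M by [].
have n4 : - 2%:R * 2%:R = 1 :> k.
  have := nat5 char5 => n5; have -> : - 2%:R * 2%:R = 1 - 5%:R :> k by ring.
  by rewrite n5 subr0.
apply/matrixP => i j; rewrite !mxE sum3 !mxE.
case: (ord3P i) (ord3P j) => -> [] ->;
by rewrite /= ?mxE /= ?(mul0r, mulr0, mul1r, mulr1, add0r, addr0, n4).
Qed.

Lemma unitary_unit g : unitary g -> g \in unitmx.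
Proof.
move=> gu; have : g *m gram k *m frob_adj g \in unitmx by rewrite gu gram_unit.
by rewrite !unitmx_mul => /andP[/andP[]].
Qed.

Lemma unitary_inv g : unitary g -> unitary (invmx g).
Proof.
move=> gu; have gU := unitary_unit gu; rewrite /unitary -{1}gu.
by rewrite !mulmxA mulVmx // mul1mx -mulmxA -frob_adjM // mulVmx // frob_adj1 // mulmx1.
Qed.

Lemma frob_adjK m n (A : 'M[k]_(m, n)) : frob_adj (frob_adj A) = map_mx (fun x => x ^+ 25) A.
Proof. by apply/matrixP => i j; rewrite !mxE -exprM. Qed.

(* Taking adjoints turns [g H g* = H] into [g** H g* = H], whence [g** = g]. *)
Lemma unitary_pow25 g i j : unitary g -> g i j ^+ 25 = g i j.
Proof.
move=> gu; have gU := unitary_unit gu.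
have hU : gram k *m frob_adj g \in unitmx.
  have : g *m (gram k *m frob_adj g) \in unitmx by rewrite mulmxA gu gram_unit.
  by rewrite unitmx_mul => /andP[].
have : frob_adj (frob_adj g) *m (gram k *m frob_adj g) = g *m (gram k *m frob_adj g).
  have := congr1 (@frob_adj _ _ _) gu; rewrite !frob_adjM // frob_adj_gram // => ->.
  by rewrite mulmxA gu.
move/(congr1 (mulmxr (invmx (gram k *m frob_adj g)))) => /=.
rewrite !mulmxK // frob_adjK => /matrixP/(_ i j).
by rewrite mxE.
Qed.

End UnitaryGroup.

(** * From the Fermat equation to the Hermitian form *)

Section HermitianCurve.
Variable k : closedFieldType.
Hypothesis char5 : 5%N \in [pchar k].

Lemma pchar5_mpoly : 5%N \in [pchar {mpoly k[3]}].
Proof. exact: (rmorph_pchar (@mpolyC 3 k)). Qed.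

Lemma pchar5_poly : 5%N \in [pchar {poly k}].
Proof. exact: (rmorph_pchar (@polyC k)). Qed.

Lemma exists_orthogonal_basis : exists B : 'M[k]_3, B *m frob_adj B = gram k.
Proof.
have n5 : 5%:R = 0 :> k := nat5 char5.
have /closed_rootP[nu /rootP] : size ('X^6 + 2%:R%:P : {poly k}) != 1%N.
  by rewrite size_polyDl size_polyXn // ltnS (leq_trans (size_polyC_leq1 _)).
rewrite hornerD hornerXn hornerC => nuE.
have {}nuE : nu ^+ 6 = - 2%:R by apply/eqP; rewrite -addr_eq0 nuE.
(* Modulo 5 the vectors (1, 2) and (3, 4) are isotropic for x^6 + y^6, as 1 + 2^6 = 65 and 3^6 + 4^6
   = 4825, and their product is 3 + 8 = 1; the middle row supplies nu^6 = -2. *)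
exists (mx3 (vec3 1 2%:R 0) (vec3 0 0 nu) (vec3 3%:R 4%:R 0)).
have nat_pow5 n : n%:R ^+ 5 = n%:R :> k by exact: pFrobenius_aut_nat char5 n.
have z5 : 0 ^+ 5 = 0 :> k by rewrite expr0n.
have cong5 (x y : k) m : x = y + m * 5%:R -> x = y by rewrite n5 mulr0 addr0.
apply/matrixP => i j; rewrite mxE sum3.
case: (ord3P i) (ord3P j) => -> [] ->;
rewrite !mxE /= ?mxE /= ?nat_pow5 ?z5 ?expr1n ?(mulr0, mul0r, addr0, add0r) //.
- by apply: (cong5 _ _ 1); ring.
- by apply: (cong5 _ _ 2%:R); ring.
- by apply: (cong5 _ _ 2%:R); ring.
- by apply: (cong5 _ _ 5%:R); ring.
Qed.

Lemma eq_mmap (S : comNzRingType) (f f' : k -> S) (h h' : 'I_3 -> S)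
    (p : {mpoly k[3]}) : f =1 f' -> h =1 h' -> mmap f h p = mmap f' h' p.
Proof.
move=> ff hh; rewrite /mmap; apply: eq_bigr => m _; rewrite ff; congr (_ * _).
by rewrite /mmap1; apply: eq_bigr => i _; rewrite hh.
Qed.

Lemma mmap_comp_mpoly (S : comNzRingType) (f : {rmorphism {mpoly k[3]} -> S})
    (lq : 3.-tuple {mpoly k[3]}) (p : {mpoly k[3]}) :
  f (p \mPo lq) = mmap (f \o @mpolyC 3 k) (fun i => f (tnth lq i)) p.
Proof.
rewrite /comp_mpoly /mmap rmorph_sum; apply: eq_bigr => m _.
rewrite rmorphM /=; congr (_ * _); rewrite /mmap1 rmorph_prod.
by apply: eq_bigr => i _; rewrite rmorphXn.
Qed.

Lemma hermitian_coordinates (Gam : plane_curve k 6) : hermitian_curve Gam ->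
  exists E : 'M[k]_3, exists c : k, [/\ E \in unitmx, c != 0 &
    equation Gam = c *: herm (coordinates E) (coordinates E)].
Proof.
case=> A Au [c c0 GE]; have [B BE] := exists_orthogonal_basis.
have Bu : B \in unitmx.
  have : B *m frob_adj B \in unitmx by rewrite BE gram_unit.
  by rewrite unitmx_mul => /andP[].
have Eu : B *m A^T \in unitmx by rewrite unitmx_mul Bu unitmx_tr.
exists (B *m A^T), c; split=> //; set Y := coordinates _.
(* Substituting [X] for the variables undoes the change of coordinates [A], by [XA] below. *)
pose X : 'rV[{mpoly k[3]}]_3 := Y *m map_mx (@mpolyC 3 k) B.
have XA : X *m map_mx (@mpolyC 3 k) A^T = \row_j 'X_j.
  by rewrite -mulmxA -map_mxM; apply: coordinates_inv.
pose lX := [tuple X 0 i | i < 3].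
have := congr1 (comp_mpoly lX) GE.
rewrite (mmap_comp_mpoly (comp_mpoly lX)) linearZ /=.
have -> : mmap (comp_mpoly lX \o @mpolyC 3 k)
    (fun i => comp_mpoly lX (tnth [tuple \sum_j A i0 j *: 'X_j | i0 < 3] i))
    (equation Gam) = equation Gam.
  rewrite -[RHS]comp_mpoly_id /comp_mpoly; apply: eq_mmap => [a|i].
    exact: comp_mpolyC.
  have /rowP/(_ i) := XA; rewrite [RHS]mxE !tnth_mktuple => <-.
  rewrite mxE rmorph_sum; apply: eq_bigr => j _ /=.
  rewrite mmapZ mmapX mmap1U tnth_mktuple mulrC; congr (_ * _).
  by rewrite !mxE.
move=> ->; congr (_ *: _); rewrite /fermat_sextic rmorph_sum /=.
transitivity ((X *m frob_adj X) 0 0).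
  rewrite [RHS]mxE; apply: eq_bigr => i _.
  by rewrite rmorphXn /= comp_mpolyXU -tnth_nth tnth_mktuple [frob_adj _ _ _]mxE [map_mx _ _ _ _]mxE exprS.
exact: (herm_orthogonal pchar5_mpoly _ (map_orthogonal _ BE)).
Qed.

End HermitianCurve.

(** * Totally tangent conics *)

Definition conic_value (R : pzRingType) (x : 'rV[R]_3) : R :=
  x 0 i1 ^+ 2 - x 0 i0 * x 0 i2.

Lemma conic_valueZ (R : comNzRingType) (a : R) (x : 'rV[R]_3) :
  conic_value (a *: x) = a ^+ 2 * conic_value x.
Proof. by rewrite /conic_value !mxE; ring. Qed.

(* [None] is the point at infinity of the projective line. *)
Definition conic_pt (R : nzRingType) (p : option R) : 'rV[R]_3 :=
  if p is Some t then vec3 1 t (t ^+ 2) else vec3 0 0 1.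

Section ClosedField.
Variable k : closedFieldType.
Implicit Types (B g : 'M[k]_3) (x z : 'rV[k]_3) (P : plane_point k).

(** A root of the product of the [X - a], plus 1, lies outside the list. *)
Lemma exists_notin (s : seq k) : exists t, t \notin s.
Proof.
have [->|s0] := eqVneq s [::]; first by exists 0.
have /closed_rootP[t /rootP tE] : size (\prod_(a <- s) ('X - a%:P) + 1) != 1%N.
  rewrite size_polyDl ?size_prod_XsubC ?size_poly1; case: s s0 => //.
exists t; apply/negP => ts; move/eqP: tE.
rewrite hornerD hornerC (_ : _.[t] = 0) ?add0r ?oner_eq0 //.
by apply/rootP; rewrite root_prod_XsubC.
Qed.

Lemma poly_eq0_horner (p : {poly k}) : (forall t, p.[t] = 0) -> p = 0.
Proof.
move=> p0; apply/eqP; apply/negPn/negP => p_neq0.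
have [s pE] := closed_field_poly_normal p.
have [t ts] := exists_notin s.
have := p0 t; rewrite pE hornerZ => /eqP; rewrite mulf_eq0 lead_coef_eq0.
by rewrite (negPf p_neq0) /= -[_ == 0]/(root _ _) root_prod_XsubC (negPf ts).
Qed.

Lemma conic_pt_neq0 (p : option k) : conic_pt p != 0.
Proof.
by case: p => [t|]; apply/eqP => /rowP; [move/(_ i0)|move/(_ i2)]; rewrite !mxE /=;
  move/eqP; rewrite oner_eq0.
Qed.

Lemma conic_value_pt (p : option k) : conic_value (conic_pt p) = 0.
Proof. by case: p => [t|]; rewrite /conic_value !mxE /=; ring. Qed.

Lemma conic_pt_inj (p q : option k) :
  proportional (conic_pt p) (conic_pt q) -> p = q.
Proof.
case=> c c0 /rowP pq; have := (pq i0, pq i1, pq i2).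
case: p q {pq} => [t|] [u|]; rewrite !mxE /= ?mulr1 ?mulr0 => -[[e0 e1] e2] //.
- by rewrite e1 -e0 mul1r.
- by move/eqP: e0; rewrite oner_eq0.
- by move/eqP: c0; rewrite e0.
Qed.

Lemma conic_valueP x : x != 0 ->
  (conic_value x = 0 <-> exists p, proportional x (conic_pt p)).
Proof.
move=> x0; split=> [|[p [c c0 ->]]]; last by rewrite conic_valueZ conic_value_pt mulr0.
move=> /eqP; rewrite subr_eq0 => /eqP xE.
have [x00|x00] := eqVneq (x 0 i0) 0.
  have x10 : x 0 i1 = 0 by apply/eqP; rewrite -sqrf_eq0 xE x00 mul0r.
  exists None, (x 0 i2); last by apply: row3P; rewrite !mxE /= ?x00 ?x10; ring.
  apply: contraNneq x0 => x20; apply/eqP; apply: row3P;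
  by rewrite !mxE.
exists (Some (x 0 i1 / x 0 i0)), (x 0 i0) => //.
apply: row3P; rewrite !mxE /=; [by rewrite mulr1|by rewrite mulrCA divff ?mulr1|].
by rewrite expr_div_n xE; field.
Qed.

Lemma invmxM n (A B : 'M[k]_n) : A \in unitmx -> B \in unitmx ->
  invmx (A *m B) = invmx B *m invmx A.
Proof.
move=> Au Bu; have ABu : A *m B \in unitmx by rewrite unitmx_mul Au.
by apply: (can_inj (mulmxK ABu)); rewrite /= mulVmx // mulmxA mulmxKV // mulVmx.
Qed.

Lemma coordinatesM g B : g \in unitmx -> B \in unitmx ->
  coordinates (g *m B) = coordinates B *m map_mx (@mpolyC 3 k) (invmx g).
Proof.
move=> gu Bu; rewrite /coordinates (invmxM gu Bu).
rewrite (map_mxM (@mpolyC 3 k)).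
exact: mulmxA.
Qed.

Lemma conic_form_neq0 B : B \in unitmx -> conic_form B != 0.
Proof.
move=> Bu; apply/eqP => /(congr1 (meval ((vec3 0 1 0 *m B) 0))).
rewrite rmorph0 rmorphB rmorphXn rmorphM /= !meval_coordinates mulmxK // !mxE /=.
by rewrite expr1n mul0r subr0; apply/eqP/oner_neq0.
Qed.

Lemma exists_conic B : exists Q : plane_conic k,
  B \in unitmx -> exists2 a, a != 0 & equation Q = a *: conic_form B.
Proof.
(* A singular [B] gets an arbitrary conic, so that [conic_of] is total. *)
have [Bu|Bu] := boolP (B \in unitmx); last first.
  have X0 : 'X_i0 ^+ 2 \is [in k[3], 2.-homog].
    by rewrite (@dhomogMn _ _ _ 1) // dhomogX /= mdeg1.
  have [|Q _] := exists_generator (V := dhomog 3 k 2) (v := DHomog X0).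
    by rewrite -val_eqE /= mpolyXn -msupp_eq0 msuppX.
  by exists Q.
have [Q [a a0 QE]] := exists_generator (V := dhomog 3 k 2)
  (v := DHomog (conic_form_homog B)) (conic_form_neq0 Bu).
by exists Q => _; exists a => //; rewrite /equation -/(generator Q) QE.
Qed.

Definition conic_of B : plane_conic k := projT1 (cid (exists_conic B)).

Lemma conic_ofE B : B \in unitmx ->
  exists2 a, a != 0 & equation (conic_of B) = a *: conic_form B.
Proof. exact: projT2 (cid (exists_conic B)). Qed.

Lemma equation_neq0 d (C : plane_curve k d) : equation C != 0.
Proof. by have := generator_neq0 C; rewrite -val_eqE. Qed.

Lemma equation_inj d (C D : plane_curve k d) a : a != 0 ->
  equation C = a *: equation D -> C = D.
Proof. by move=> a0 CD; apply: generator_inj; exists a => //; apply: val_inj. Qed.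

Lemma eval_atE P F : eval_at P F = F.@[coord_of P 0].
Proof. by []. Qed.

Lemma conic_of_points B P : B \in unitmx ->
  points (conic_of B) P <-> conic_value (coord_of P *m invmx B) = 0.
Proof.
move=> Bu; have [a a0 QE] := conic_ofE Bu.
rewrite /points /= QE eval_atE mevalZ rmorphB rmorphXn rmorphM /= !meval_coordinates.
rewrite -/(conic_value _); split=> [/eqP|->]; last by rewrite mulr0.
by rewrite mulf_eq0 (negPf a0) => /eqP.
Qed.

Lemma dhomog0_const (q : {mpoly k[3]}) : q \is 0.-homog -> q = (q@_0%MM)%:MP.
Proof.
move=> /dhomogP q0; apply/mpolyP => m; rewrite mcoeffC.
have [->|m0] := eqVneq m 0%MM; first by rewrite mulr1.
rewrite mulr0.
apply/eqP; rewrite mcoeff_eq0; apply: contra m0 => /q0 /= /eqP.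
by rewrite mdeg_eq0.
Qed.

(** By the kernel of the restriction the equation is a multiple of the conic form, and the quotient
    has degree 0. *)
Lemma conic_of_unique B (Q : plane_conic k) : B \in unitmx ->
  pullback (conic_param B) (equation Q) = 0 -> Q = conic_of B.
Proof.
move=> Bu pQ; have [q q0 qE] := conic_kernel (n := 0) Bu (equation_homog Q) pQ.
have [a a0 CE] := conic_ofE Bu; have := equation_neq0 Q.
rewrite (dhomog0_const q0) mul_mpolyC in qE; rewrite qE => Q0.
apply: (@equation_inj _ _ _ (q@_0%MM / a)).
  apply: contraNneq Q0 => /eqP; rewrite mulf_eq0 invr_eq0 (negPf a0) orbF.
  by move/eqP->; rewrite scale0r.
by rewrite qE CE scalerA divfK.
Qed.

Lemma map_param B (eps : 'rV[{poly k}]_3) t :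
  (fun i => (parametrization B eps i).[t]) =
  ((map_mx (fun p : {poly k} => p.[t]) eps) *m B) 0.
Proof.
apply/funext => i; rewrite mxE /parametrization mxE horner_sum.
by apply: eq_bigr => j _; rewrite !mxE hornerM hornerC.
Qed.

Lemma horner_conic_param B t (F : {mpoly k[3]}) :
  (pullback (conic_param B) F).[t] = F.@[(conic_pt (Some t) *m B) 0].
Proof.
rewrite horner_pullback map_param; congr (_.@[(_ *m _) 0]).
by apply: row3P; rewrite !mxE /= ?hornerE.
Qed.

End ClosedField.

(** The substitution t -> t + r or t -> 1/t on the base conic; it carries the parameter 0 to [p], so
    that local questions need only be treated at 0. *)
Definition frame_at (R : nzRingType) (p : option R) : 'M[R]_3 :=
  if p is Some r then mx3 (vec3 1 r (r ^+ 2)) (vec3 0 1 (r *+ 2)) (vec3 0 0 1)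
  else mx3 (vec3 0 0 1) (vec3 0 1 0) (vec3 1 0 0).

Lemma row_frame_at (R : nzRingType) (p : option R) : row i0 (frame_at p) = conic_pt p.
Proof. by case: p => [r|]; rewrite /frame_at rowK. Qed.

Lemma mul_frame_at (R : comNzRingType) (r : R) (x : 'rV[R]_3) :
  x *m frame_at (Some r) =
  vec3 (x 0 i0) (x 0 i0 * r + x 0 i1) (x 0 i0 * r ^+ 2 + x 0 i1 * (r *+ 2) + x 0 i2).
Proof. by apply: row3P; rewrite !mxE sum3 !mxE /= ?mxE /=; ring. Qed.

Lemma mul_frame_None (R : comNzRingType) (x : 'rV[R]_3) :
  x *m frame_at None = vec3 (x 0 i2) (x 0 i1) (x 0 i0).
Proof. by apply: row3P; rewrite !mxE sum3 !mxE /= ?mxE /=; ring. Qed.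

Lemma conic_value_frame_at (R : comNzRingType) (p : option R) (x : 'rV[R]_3) :
  conic_value (x *m frame_at p) = conic_value x.
Proof.
by case: p => [r|]; rewrite ?mul_frame_at ?mul_frame_None /conic_value !mxE /=; ring.
Qed.

Lemma proportionalM (k : fieldType) (g : 'M[k]_3) (x y : 'rV[k]_3) :
  proportional x y -> proportional (x *m g) (y *m g).
Proof. by case=> a a0 ->; exists a; rewrite ?scalemxAl. Qed.
Arguments proportionalM {k} g {x y}.

Definition F5 (R : nzRingType) : seq R := [seq n%:R | n <- iota 0 5].

Definition P1F5 (R : nzRingType) : seq (option R) := None :: map Some (F5 R).

Lemma mem_P1F5 (R : nzRingType) (t : R) : (Some t \in P1F5 R) = (t \in F5 R).
Proof. by rewrite in_cons (mem_map Some_inj). Qed.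

Section Coordinatized.
Variable k : closedFieldType.
Hypothesis char5 : 5%N \in [pchar k].
Variables (Gam : plane_curve k 6) (E : 'M[k]_3) (c : k).
Hypothesis E_unit : E \in unitmx.
Hypothesis c_neq0 : c != 0.
Hypothesis GamE : equation Gam = c *: herm (coordinates E) (coordinates E).
Implicit Types (g w : 'M[k]_3) (P : plane_point k) (p : option k).

Definition frame_coord P : 'rV[k]_3 := coord_of P *m invmx E.

(** [E] is the coordinate change that turns the curve into [herm]; [g] acts inside these
    coordinates. *)
Definition frame_conic g : plane_conic k := conic_of (g *m E).

Lemma frame_coordK P : coord_of P = frame_coord P *m E.
Proof. by rewrite mulmxKV. Qed.

Lemma frame_coord_neq0 P : frame_coord P != 0.
Proof.
apply: contra (generator_neq0 P) => /eqP P0.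
by rewrite -[generator P]/(coord_of P) frame_coordK P0 mul0mx.
Qed.

Lemma proportional_coord P (x : 'rV[k]_3) :
  proportional (coord_of P) (x *m E) <-> proportional (frame_coord P) x.
Proof.
split=> [/(proportionalM (invmx E))|/(proportionalM E)].
  by rewrite mulmxK.
by rewrite -frame_coordK.
Qed.

Lemma exists_coord (x : 'rV[k]_3) : x != 0 -> exists P, proportional (frame_coord P) x.
Proof.
move=> x0; have [|P PE] := @exists_generator _ _ (x *m E).
  by apply: contraNneq x0 => xE; rewrite -(mulmxK E_unit x) xE mul0mx.
by exists P; apply/proportional_coord.
Qed.

Lemma frame_coord_inj P Q : proportional (frame_coord P) (frame_coord Q) -> P = Q.
Proof.
by move/proportional_coord; rewrite -frame_coordK; exact: generator_inj.
Qed.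

Lemma gam_value (x : 'rV[k]_3) : (equation Gam).@[(x *m E) 0] = c * herm x x.
Proof.
have -> : herm x x = herm (map_mx (meval ((x *m E) 0)) (coordinates E))
                          (map_mx (meval ((x *m E) 0)) (coordinates E)).
  suff -> : map_mx (meval ((x *m E) 0)) (coordinates E) = x by [].
  by apply/rowP => i; rewrite mxE meval_coordinates mulmxK.
by rewrite -map_herm GamE mevalZ.
Qed.

Lemma gam_points P : points Gam P <-> herm (frame_coord P) (frame_coord P) = 0.
Proof.
rewrite /points /= eval_atE frame_coordK gam_value.
by split=> [/eqP|->]; rewrite ?mulr0 // mulf_eq0 (negPf c_neq0) => /eqP.
Qed.

Lemma frame_conic_points g P : g \in unitmx ->
  points (frame_conic g) P <-> conic_value (frame_coord P *m invmx g) = 0.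
Proof.
move=> gu; rewrite conic_of_points ?unitmx_mul ?gu //.
by rewrite invmxM // mulmxA.
Qed.

Lemma frame_conic_pointsP g P : g \in unitmx ->
  points (frame_conic g) P <-> exists p, proportional (frame_coord P) (conic_pt p *m g).
Proof.
move=> gu; rewrite (frame_conic_points _ gu) conic_valueP; last first.
  apply: contra (frame_coord_neq0 P) => /eqP P0.
  by rewrite -(mulmxKV gu (frame_coord P)) P0 mul0mx.
split=> -[p pE]; exists p.
  by have := proportionalM g pE; rewrite mulmxKV.
by have := proportionalM (invmx g) pE; rewrite mulmxK.
Qed.

Lemma frame_conic_eq g w : g \in unitmx -> w \in unitmx ->
  frame_conic (w *m g) = frame_conic g <->
  forall p, conic_value (conic_pt p *m w) = 0.
Proof.
move=> gu wu; have wgu : w *m g \in unitmx by rewrite unitmx_mul wu.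
split=> [wg p|w0].
  have [|P PE] := @exists_coord (conic_pt p *m (w *m g)).
    apply: contra (conic_pt_neq0 p) => /eqP p0.
    by rewrite -(mulmxK wgu (conic_pt p)) p0 mul0mx.
  have : points (frame_conic (w *m g)) P by apply/frame_conic_pointsP => //; exists p.
  rewrite wg => /(frame_conic_points P gu).
  case: PE => a a0 ->; rewrite -scalemxAl mulmxA mulmxK // conic_valueZ => /eqP.
  by rewrite mulf_eq0 expf_eq0 (negPf a0) => /eqP.
apply/esym/conic_of_unique; first by rewrite unitmx_mul wgu.
apply: poly_eq0_horner => t; rewrite horner_conic_param.
have gEu : g *m E \in unitmx by rewrite unitmx_mul gu.
have [a a0 ->] := conic_ofE gEu.
rewrite mevalZ /conic_form rmorphB rmorphXn rmorphM /= !meval_coordinates.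
have -> : conic_pt (Some t) *m (w *m g *m E) *m invmx (g *m E) =
    conic_pt (Some t) *m w.
  by rewrite -(mulmxA w) (mulmxA (conic_pt _)) mulmxK.
by rewrite -[X in _ * X]/(conic_value (conic_pt (Some t) *m w)) w0 mulr0.
Qed.

Lemma frame_at_unit p : frame_at p \in unitmx.
Proof.
suff /mulmx1_unit[] : frame_at p *m frame_at (omap -%R p) = 1%:M by [].
apply/row_matrixP => i; rewrite row_mul row1.
case: p => [r|] /=; rewrite ?mul_frame_at ?mul_frame_None;
by case: (ord3P i) => ->; apply: row3P; rewrite !mxE /= ?mxE //=; ring.
Qed.

Lemma frame_conic_frame_at g p : g \in unitmx ->
  frame_conic (frame_at p *m g) = frame_conic g.
Proof.
move=> gu; apply/frame_conic_eq => //; first exact: frame_at_unit.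
by move=> q; rewrite conic_value_frame_at conic_value_pt.
Qed.

Lemma pow5_fixed (t : k) : (t ^+ 5 == t) = (t \in F5 k).
Proof.
have n5 := nat5 char5.
have E5 : t ^+ 5 - t = \prod_(a <- F5 k) (t - a).
  rewrite /F5 /= !big_cons big_nil /=.
  (* The multiple of 5 separating t^5 - t from t (t - 1)(t - 2)(t - 3)(t - 4) over the integers. *)
  transitivity (t ^+ 5 - t + 5%:R * (- 2%:R * t ^+ 4 + 7%:R * t ^+ 3 - 10%:R * t ^+ 2 + 5%:R * t)).
    by rewrite n5 mul0r addr0.
  ring.
rewrite -subr_eq0 E5 prodf_seq_eq0 -has_pred1.
by apply: eq_has => a /=; rewrite subr_eq0 eq_sym.
Qed.

Lemma herm_conic_pt (R : comNzRingType) (t : R) :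
  herm (conic_pt (Some t)) (conic_pt (Some t)) = (t ^+ 5 - t) ^+ 2.
Proof. by rewrite hermE !mxE /=; ring. Qed.

Lemma herm_ptP p : herm (conic_pt p) (conic_pt p) = 0 <-> p \in P1F5 k.
Proof.
case: p => [t|]; last by rewrite hermE !mxE /= inE eqxx; split=> // _; ring.
rewrite herm_conic_pt mem_P1F5 -pow5_fixed -subr_eq0.
by split=> [/eqP|/eqP ->]; rewrite ?expf_eq0 ?expr0n.
Qed.

Lemma frame_at_unitary p : p \in P1F5 k -> unitary (frame_at p).
Proof.
move=> pF; have n5 := nat5 char5.
have n25 : (2%:R : k) ^+ 5 = 2%:R by exact: pFrobenius_aut_nat char5 2.
apply/unitary_herm => i j; rewrite hermE.
case: p pF => [r|_]; last first.
  by case: (ord3P i) (ord3P j) => -> [] ->; rewrite !mxE /= ?mxE /=; ring.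
rewrite mem_P1F5 -pow5_fixed => /eqP rE.
have r2 : (r ^+ 2) ^+ 5 = r ^+ 2 by rewrite exprAC rE.
have r2' : (r *+ 2) ^+ 5 = r *+ 2 by rewrite -mulr_natl exprMn rE n25.
have z5 : (0 : k) ^+ 5 = 0 by rewrite expr0n.
case: (ord3P i) (ord3P j) => -> [] ->;
  rewrite !mxE /= ?mxE /= ?r2 ?r2' ?rE ?z5 ?expr1n; ring.
Qed.

End Coordinatized.

(** * Unitary frames give totally tangent conics *)

Section Tangency.
Variable k : closedFieldType.
Hypothesis char5 : 5%N \in [pchar k].
Variables (Gam : plane_curve k 6) (E : 'M[k]_3) (c : k).
Hypothesis E_unit : E \in unitmx.
Hypothesis c_neq0 : c != 0.
Hypothesis GamE : equation Gam = c *: herm (coordinates E) (coordinates E).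
Implicit Types (g w : 'M[k]_3) (P : plane_point k) (p : option k).

Local Notation frame_coord := (frame_coord E).
Local Notation frame_conic := (frame_conic E).
Local Notation eps := (vec3 1 'X ('X ^+ 2) : 'rV[{poly k}]_3).

Lemma gam_param g :
  pullback (conic_param (g *m E)) (equation Gam) =
  c *: herm (eps *m map_mx (@polyC k) g) (eps *m map_mx (@polyC k) g).
Proof.
rewrite GamE mmapZ /= mul_polyC (map_herm (pullback _)) mmap_coordinates.
suff -> : (\row_j conic_param (g *m E) j) *m map_mx (@polyC k) (invmx E) =
  eps *m map_mx (@polyC k) g by [].
rewrite -[in RHS](mulmxK E_unit g) (map_mxM (@polyC k) _ (invmx E)).
by rewrite [RHS]mulmxA; congr (_ *m _); apply/rowP => j; rewrite mxE.
Qed.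

Lemma gam_param_unitary g : unitary g ->
  pullback (conic_param (g *m E)) (equation Gam) = c *: ('X^5 - 'X) ^+ 2.
Proof.
move=> gu; rewrite gam_param (herm_unitary (pchar5_poly char5)); last first.
  exact: map_unitary.
by rewrite -(herm_conic_pt 'X).
Qed.

(** On the conic of a unitary frame the Hermitian form is (t^5 - t)^2, whose zeros are the
    parameters in F_5, and it also vanishes at infinity. *)
Lemma mem_tangency g P : unitary g ->
  points (frame_conic g) P /\ points Gam P <->
  exists2 p, p \in P1F5 k & proportional (frame_coord P) (conic_pt p *m g).
Proof.
move=> gu; have gU := unitary_unit char5 gu.
have PQ := frame_conic_pointsP E_unit P gU; have PG := gam_points E_unit c_neq0 GamE P.
split=> [[/PQ[p pE] /PG P0]|[p pF pE]].
  exists p => //; apply/(herm_ptP char5); move: P0; case: pE => a a0 ->.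
  rewrite hermZ herm_unitary // => /eqP.
  by rewrite mulf_eq0 expf_eq0 (negPf a0) => /eqP.
split; first by apply/PQ; exists p.
apply/PG; case: pE => a a0 ->; rewrite hermZ herm_unitary //.
by rewrite (proj2 (herm_ptP char5 p) pF) mulr0.
Qed.

Lemma F5_uniq : uniq (F5 k).
Proof.
rewrite map_inj_in_uniq ?iota_uniq // => i j.
rewrite !mem_iota /= !add0n => i5 j5 /eqP.
wlog ij : i j i5 j5 / (i <= j)%N.
  by move=> H e; case/orP: (leq_total i j) => ij; [exact: H|apply/esym/H; rewrite // eq_sym].
rewrite eq_sym -subr_eq0 -natrB // -(dvdn_pcharf char5) => /dvdn_leq.
case: (posnP (j - i)) => [/eqP|_ /(_ isT)]; first by rewrite subn_eq0 => ji _; apply/eqP; rewrite eqn_leq ij.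
by rewrite leqNgt (leq_ltn_trans (leq_subr _ _)).
Qed.

Lemma P1F5_uniq : uniq (P1F5 k).
Proof.
rewrite cons_uniq (map_inj_uniq Some_inj) F5_uniq andbT.
by apply/mapP => -[].
Qed.

Lemma conic_pts_nonproportional (g : 'M[k]_3) (s : seq (option k)) :
  g \in unitmx -> uniq s -> nonproportional [seq conic_pt p *m g | p <- s].
Proof.
move=> gU us.
have pinj p q : proportional (conic_pt p *m g) (conic_pt q *m g) -> p = q.
  move/(proportionalM (invmx g)); rewrite !mulmxK //.
  exact: conic_pt_inj.
split.
- by rewrite map_inj_uniq // => p q pq; apply: pinj; rewrite pq; exact: proportional_refl.
- apply/mapP => -[p _ /esym/eqP]; apply/negP.
  apply: contra (conic_pt_neq0 p) => /eqP p0.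
  by rewrite -(mulmxK gU (conic_pt p)) p0 mul0mx.
- by move=> _ _ /mapP[p _ ->] /mapP[q _ ->] /pinj ->.
Qed.

Lemma card_conic_pts (g : 'M[k]_3) (s : seq (option k)) (X : set (plane_point k)) :
  g \in unitmx -> uniq s ->
  (forall P, X P <-> exists2 p, p \in s & proportional (frame_coord P) (conic_pt p *m g)) ->
  X #= `I_(size s).
Proof.
move=> gU us XE; have gEu : g *m E \in unitmx by rewrite unitmx_mul gU.
rewrite -(size_map (fun p => conic_pt p *m (g *m E))).
apply: card_projective; first exact: conic_pts_nonproportional.
move=> P; rewrite XE; split=> [[p ps /(proportional_coord E_unit) PE]|[_ /mapP[p ps ->] PE]].
  by exists (conic_pt p *m (g *m E)); [exact: map_f|rewrite mulmxA].
by exists p => //; apply/(proportional_coord E_unit); rewrite -mulmxA.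
Qed.

Lemma frame_conic_nonsingular g : g \in unitmx -> nonsingular (frame_conic g).
Proof.
move=> gU P _; have gEu : g *m E \in unitmx by rewrite unitmx_mul gU.
have [a a0 QE] := conic_ofE gEu.
set B := g *m E in gEu QE *; move zE : (coord_of P *m invmx B) => z.
have z0 : z != 0.
  apply: contra (generator_neq0 P) => /eqP z0.
  by rewrite -[generator P]/(coord_of P) -(mulmxKV gEu (coord_of P)) zE z0 mul0mx.
have deriv i j : (coordinates B 0 i)^`M(j) = (invmx B j i)%:MP.
  rewrite coordinatesE raddf_sum (bigD1 j) //= big1 => [|l lj].
    by rewrite mderivZ mderivX mnm1E eqxx -[X in (X - _)%MM]add0m addmK mpolyX0 scale1r addr0 alg_mpolyC.
  by rewrite mderivZ mderivX mnm1E (negPf lj) scale0r scaler0.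
(* The gradient of x1^2 - x0 x2 in frame coordinates; it is non-zero because 2 is invertible. *)
pose d := vec3 (- z 0 i2) (z 0 i1 *+ 2) (- z 0 i0).
have two0 : 2%:R != 0 :> k.
  by rewrite -(dvdn_pcharf char5).
have d0 : d != 0.
  apply: contra z0 => /eqP/rowP d0; have := (d0 i0, d0 i1, d0 i2).
  rewrite !mxE /= => -[[/eqP e2 /eqP e1] /eqP e0].
  rewrite oppr_eq0 in e0; rewrite oppr_eq0 in e2.
  rewrite -mulr_natr mulf_eq0 (negPf two0) orbF in e1.
  by apply/eqP/row3P; rewrite [RHS]mxE; apply/eqP.
have [i /eqP iE|none] := pickP (fun i => (d *m (invmx B)^T) 0 i != 0); last first.
  case/eqP: d0; have BTu : (invmx B)^T \in unitmx by rewrite unitmx_tr unitmx_inv.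
  rewrite -(mulmxK BTu d) [d *m _](_ : _ = 0) ?mul0mx //.
  by apply/rowP => i; rewrite [RHS]mxE; apply/eqP/negPn; rewrite none.
exists i => E0; apply: iE; move: E0.
rewrite QE mderivZ eval_atE mevalZ => /eqP; rewrite mulf_eq0 (negPf a0) /=.
rewrite /conic_form expr2 linearB /= !mderivM !deriv raddfB /= !raddfD /= !rmorphM /=.
rewrite !mevalC !meval_coordinates zE => /eqP E0.
rewrite mxE sum3 !mxE /= -[RHS]E0; ring.
Qed.

Lemma unitary_totally_tangent g : unitary g ->
  totally_tangent_conics Gam (frame_conic g).
Proof.
move=> gu; have gU := unitary_unit char5 gu.
split; first exact: frame_conic_nonsingular.
  exact: (card_conic_pts gU P1F5_uniq (fun P => mem_tangency P gu)).
move=> P PQ PG; have /(mem_tangency P gu)[p pF pE] := conj PQ PG.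
have su := unitaryM char5 (frame_at_unitary char5 pF) gu.
have sEu : frame_at p *m g *m E \in unitmx.
  by rewrite unitmx_mul (unitary_unit char5 su).
rewrite -(frame_conic_frame_at E_unit p gU).
have [a a0 QE] := conic_ofE sEu.
(* With the tangency point moved to t = 0, the restriction is t^2 (t^4 - 1)^2 up to a constant. *)
apply/(@conic_multiplicity _ _ _ _ Gam P a 2 2 (c *: ('X^4 - 1) ^+ 2) sEu a0 QE) => //.
- rewrite !row_mul row_frame_at.
  exact/(proportional_coord E_unit).
- rewrite gam_param_unitary // -scalerAr; congr (_ *: _).
  by rewrite exprS; ring.
- rewrite hornerZ horner_exp hornerD hornerN hornerXn hornerC expr0n sub0r.
  by rewrite sqrrN expr1n mulr1.
Qed.

End Tangency.

(** * Polar forms and conics through three given points *)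

Section QuadraticForms.
Variable k : closedFieldType.
Implicit Types (F : {mpoly k[3]}) (N : 'M[k]_3) (x y : 'rV[k]_3).

Definition polar N x y : k := (x *m N *m y^T) 0 0.

(** [N] is the matrix of second derivatives; keeping twice the form avoids halves. *)
Definition polarizes F N : Prop := [/\ N^T = N,
  forall x, F.@[x 0] *+ 2 = polar N x x &
  forall x i, F^`M(i).@[x 0] = (x *m N) 0 i].

Lemma polarDl N x x' y : polar N (x + x') y = polar N x y + polar N x' y.
Proof. by rewrite /polar !mulmxDl mxE. Qed.

Lemma polarDr N x y y' : polar N x (y + y') = polar N x y + polar N x y'.
Proof. by rewrite /polar linearD mulmxDr mxE. Qed.

Lemma polarZl N a x y : polar N (a *: x) y = a * polar N x y.
Proof. by rewrite /polar -!scalemxAl mxE. Qed.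

Lemma polarZr N a x y : polar N x (a *: y) = a * polar N x y.
Proof. by rewrite /polar linearZ -scalemxAr mxE. Qed.

Lemma polarC N x y : N^T = N -> polar N x y = polar N y x.
Proof.
move=> NT; rewrite /polar -[LHS]mulr1 -[in LHS](trmxK (x *m N *m y^T)) [LHS]mulr1.
by rewrite mxE !trmx_mul trmxK NT mulmxA.
Qed.

Lemma exists_polar F : F \is 2.-homog -> exists N, polarizes F N.
Proof.
move=> /dhomogP F2; rewrite (mpolyE F) big_seq.
elim/big_rec: _ => [|m F' /F2 /= m2 [N [NT NE dN]]].
  exists 0; split=> [|x|x i]; first by rewrite trmx0.
  - by rewrite rmorph0 mul0rn /polar mulmx0 mul0mx mxE.
  - by rewrite mderiv0 rmorph0 mulmx0 mxE.
have [s ss ->] := mpolyX_seq k m; rewrite m2 in ss.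
case: s ss => [|i [|j [|? ?]]] // _; rewrite big_cons big_seq1.
have xD x (a b l : 'I_3) : (x *m delta_mx a b) 0 l = x 0 a * (l == b)%:R.
  rewrite mxE (bigD1 a) //= mxE eqxx big1 ?addr0 // => l' la.
  by rewrite mxE (negPf la) mulr0.
have sumD (a : 'I_3) (G : 'I_3 -> k) : \sum_l (l == a)%:R * G l = G a.
  rewrite (bigD1 a) //= eqxx mul1r big1 ?addr0 // => l /negPf->.
  exact: mul0r.
pose N' := F@_m *: (delta_mx i j + delta_mx j i) : 'M[k]_3.
have xN' x l : (x *m N') 0 l = F@_m * (x 0 i * (l == j)%:R + x 0 j * (l == i)%:R).
  by rewrite -scalemxAr mxE mulmxDr mxE !xD.
exists (N' + N); split=> [|x|x l].
- rewrite linearD /= NT linearZ linearD /= !trmx_delta; congr (_ *: _ + _).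
  exact: addrC.
- rewrite mevalD mulrnDl NE /polar mulmxDr mulmxDl [RHS]mxE; congr (_ + _).
  rewrite mevalZ mevalM !mevalXU mxE.
  under eq_bigr => l _ do rewrite xN' mxE.
  transitivity (\sum_l ((l == j)%:R * (F@_m * x 0 i * x 0 l)) +
                \sum_l ((l == i)%:R * (F@_m * x 0 j * x 0 l)) : k).
    by rewrite !sumD mulr2n; ring.
  by rewrite -big_split; apply: eq_bigr => l _ /=; ring.
- rewrite mulmxDr [RHS]mxE xN' mderivD mevalD dN; congr (_ + _).
  rewrite mderivZ mevalZ mderivM mevalD !mevalM !mderivX !mevalZ !mevalXU !mnm1E.
  (* For [a != b] the exponent difference is truncated and meaningless, but its coefficient is 0. *)
  have U1 (a b : 'I_3) : (a == b)%:R * ('X_[U_(a) - U_(b)] : {mpoly k[3]}).@[x 0] = (a == b)%:R :> k.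
    have [->|_] := eqVneq a b; last by rewrite mul0r.
    by rewrite -[X in (X - _)%MM]add0m addmK mpolyX0 meval1 mulr1.
  by rewrite !U1 [i == l]eq_sym [j == l]eq_sym; ring.
Qed.

End QuadraticForms.

Section ConicFrame.
Variable k : closedFieldType.
Hypothesis char5 : 5%N \in [pchar k].
Implicit Types (x y : 'rV[k]_3) (P : plane_point k) (Q : plane_conic k).

Let two_neq0 : 2%:R != 0 :> k.
Proof. by rewrite -(dvdn_pcharf char5). Qed.

(** A kernel vector of the polar form would be a singular point of the conic. *)
Lemma nonsingular_unit Q N : nonsingular Q -> polarizes (equation Q) N -> N \in unitmx.
Proof.
move=> nsQ [NT NE dN]; rewrite unitmxE unitfE; apply/det0P => -[v v0 vN].
have [P [a a0 PE']] := exists_generator v0.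
have PE : coord_of P = a *: v := PE'.
have PQ : points Q P.
  have := NE (coord_of P); rewrite /polar {2}PE -scalemxAl vN scaler0 mul0mx mxE.
  rewrite -mulr_natr => /eqP; rewrite mulf_eq0 (negPf two_neq0) orbF.
  by move/eqP.
have [i] := nsQ P PQ; apply.
by rewrite eval_atE dN PE -scalemxAl vN scaler0 mxE.
Qed.

(** Otherwise [x] and [y] span a plane contained in its own orthogonal, which for a non-degenerate
    form in dimension 3 is only a line. *)
Lemma polar_neq0 N x y : N \in unitmx -> N^T = N ->
  x != 0 -> y != 0 -> ~ proportional x y ->
  polar N x x = 0 -> polar N y y = 0 -> polar N x y != 0.
Proof.
move=> Nu NT x0 y0 xy xx yy; apply/negP => /eqP Nxy.
pose W := col_mx x y.
have Wfree : row_free W.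
  apply: inj_row_free => v; rewrite -[v]hsubmxK mul_row_col.
  rewrite [lsubmx v]mx11_scalar [rsubmx v]mx11_scalar !mul_scalar_mx.
  set a := lsubmx v 0 0; set b := rsubmx v 0 0 => /eqP ab.
  have b0 : b = 0.
    apply/eqP/negPn/negP => b0; apply: xy; apply: proportional_sym.
    exists (- a / b); last first.
      move: ab; rewrite addrC addr_eq0 => /eqP ab; apply: (scalerI b0).
      by rewrite ab scalerA mulrCA divff ?mulr1 ?scaleNr.
    rewrite mulf_neq0 ?invr_eq0 ?oppr_eq0 //; apply: contraNneq b0 => a0.
    by move: ab; rewrite a0 scale0r add0r scaler_eq0 (negPf y0) orbF.
  move: ab; rewrite b0 scale0r addr0 scaler_eq0 (negPf x0) orbF => /eqP ->.
  by rewrite !raddf0 row_mx0.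
have W0 : W *m (N *m W^T) = 0.
  rewrite tr_col_mx mul_mx_row mul_col_row.
  have E u v : polar N u v = 0 -> u *m (N *m v^T) = 0.
    by move=> uv; rewrite [LHS]mx11_scalar mulmxA -/(polar N u v) uv raddf0.
  by rewrite !E // ?(polarC y) //; apply/matrixP => i j;
     rewrite [RHS]mxE !mxE; case: splitP => ? _; rewrite !mxE; case: splitP => ? _; rewrite !mxE.
have := mulmx0_rank_max W0; rewrite -(mxrank_tr (N *m W^T)) trmx_mul trmxK.
by rewrite mxrankMfree ?row_free_unit ?unitmx_tr // (eqP Wfree).
Qed.

Lemma conic_frame Q P0 P1 P2 : nonsingular Q ->
  points Q P0 -> points Q P1 -> points Q P2 -> P0 <> P1 -> P0 <> P2 -> P1 <> P2 ->
  exists B, [/\ B \in unitmx, Q = conic_of B,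
    proportional (coord_of P0) (conic_pt (Some 0) *m B),
    proportional (coord_of P1) (conic_pt (Some 1) *m B) &
    proportional (coord_of P2) (conic_pt None *m B)].
Proof.
move=> nsQ PQ0 PQ1 PQ2 P01 P02 P12.
have [N NP] := exists_polar (equation_homog Q).
have Nu := nonsingular_unit nsQ NP; case: NP => NT NE dN.
set v0 := coord_of P0; set v1 := coord_of P1; set v2 := coord_of P2.
have v00 : v0 != 0 := generator_neq0 P0.
have v10 : v1 != 0 := generator_neq0 P1.
have v20 : v2 != 0 := generator_neq0 P2.
have iso P : points Q P -> polar N (coord_of P) (coord_of P) = 0.
  by move=> PQ; rewrite -NE -eval_atE PQ mul0rn.
have /(polar_neq0 Nu NT v00 v10) : ~ proportional v0 v1 by move/generator_inj.
have /(polar_neq0 Nu NT v00 v20) : ~ proportional v0 v2 by move/generator_inj.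
have /(polar_neq0 Nu NT v10 v20) : ~ proportional v1 v2 by move/generator_inj.
move=> /(_ (iso _ PQ1) (iso _ PQ2)) al0 /(_ (iso _ PQ0) (iso _ PQ2)) be0
  /(_ (iso _ PQ0) (iso _ PQ1)) ga0.
set al := polar N v1 v2 in al0; set be := polar N v0 v2 in be0.
set ga := polar N v0 v1 in ga0.
(* The scalars make the rows a basis in which the polar form is a multiple of [gram], which is minus
   the polar matrix of x1^2 - x0 x2; the three rows add up to [be *: v1], the point at t = 1. *)
pose B := mx3 (al *: v0) (be *: v1 - al *: v0 - ga *: v2) (ga *: v2).
have ptB t : conic_pt (Some t) *m B =
    ((1 - t) * al) *: v0 + (t * be) *: v1 + ((t ^+ 2 - t) * ga) *: v2.
  by apply/rowP => i; rewrite !mxE sum3 !mxE /= ?mxE /=; ring.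
have [E0 E1 E2] := And3 (iso _ PQ0) (iso _ PQ1) (iso _ PQ2).
rewrite -/v0 -/v1 -/v2 in E0 E1 E2.
have [C1 C2 C3] := And3 (polarC v1 v0 NT) (polarC v2 v0 NT) (polarC v2 v1 NT).
have BN : B *m N *m B^T = (al * be * ga) *: gram k.
  apply/matrixP => i j.
  have -> : (B *m N *m B^T) i j = polar N (row i B) (row j B).
    by rewrite /polar !(mxE, sum3).
  rewrite [RHS]mxE; case: (ord3P i) (ord3P j) => -> [] ->; rewrite !rowK /= !mxE /= ?mxE /=;
  rewrite -?scaleNr !(polarDl, polarDr, polarZl, polarZr);
  rewrite ?C1 ?C2 ?C3 ?E0 ?E1 ?E2 -/al -/be -/ga; ring.
have Bu : B \in unitmx.
  have : B *m N *m B^T \in unitmx.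
    by rewrite BN unitmxZ ?gram_unit // unitfE !mulf_neq0.
  by rewrite !unitmx_mul => /andP[/andP[]].
exists B; split=> //.
- apply: conic_of_unique => //; apply: poly_eq0_horner => t.
  rewrite horner_conic_param; apply/eqP; rewrite -[_ == 0]orbF -(negPf two_neq0).
  rewrite -mulf_eq0 mulr_natr NE ptB; apply/eqP.
  rewrite !(polarDl, polarDr, polarZl, polarZr).
  rewrite C1 C2 C3 E0 E1 E2 -/al -/be -/ga; ring.
- apply: proportional_sym; exists al => //; rewrite ptB -/v0.
  by rewrite subr0 mul1r !mul0r expr0n subrr mul0r !scale0r !addr0.
- apply: proportional_sym; exists be => //; rewrite ptB -/v1.
  by rewrite subrr mul0r expr1n subrr mul0r !scale0r mul1r addr0 add0r.
- apply: proportional_sym; exists ga => //.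
  by apply/rowP => i; rewrite !mxE sum3 !mxE /= ?mxE /=; ring.
Qed.

End ConicFrame.

(* The exponents [i + 5 j] are pairwise distinct. *)
Definition sesqui_poly (R : nzRingType) (H : 'M[R]_3) : {poly R} :=
  \sum_(i < 3) \sum_(j < 3) H i j *: 'X^(i + 5 * j).

Lemma coef_sesqui_poly (R : nzRingType) (H : 'M[R]_3) n : (sesqui_poly H)`_n =
  \sum_(i < 3) \sum_(j < 3) H i j * (n == (i + 5 * j)%N)%:R.
Proof.
rewrite coef_sum; apply: eq_bigr => i _; rewrite coef_sum; apply: eq_bigr => j _.
by rewrite coefZ coefXn.
Qed.

Lemma coef_sesqui_poly_ij (R : nzRingType) (H : 'M[R]_3) (i j : 'I_3) :
  (sesqui_poly H)`_(i + 5 * j) = H i j.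
Proof.
rewrite coef_sesqui_poly !sum3.
by case: (ord3P i) (ord3P j) => -> [] ->; rewrite /= ?(mulr0, mulr1, addr0, add0r).
Qed.

(** The conjugate of (1, t, t^2) is (1, t^5, t^10), hence the exponents [i + 5 j]. *)
Lemma herm_sesqui_poly (k : fieldType) (g : 'M[k]_3) : 5%N \in [pchar k] ->
  let x := vec3 1 'X ('X ^+ 2) *m map_mx (@polyC k) g in
  herm x x = sesqui_poly (g *m gram k *m frob_adj g).
Proof.
move=> char5 x; rewrite /herm /x frob_adjM ?(rmorph_pchar (@polyC k) char5) //.
set H := g *m gram k *m frob_adj g.
have -> : vec3 1 'X ('X ^+ 2) *m map_mx (@polyC k) g *m gram {poly k} *m
    (frob_adj (map_mx (@polyC k) g) *m frob_adj (vec3 1 'X ('X ^+ 2))) =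
  vec3 1 'X ('X ^+ 2) *m map_mx (@polyC k) H *m frob_adj (vec3 1 'X ('X ^+ 2)).
  by rewrite !map_mxM map_frob_adj map_gram !mulmxA.
rewrite {}/H {x}; move: (g *m gram k *m frob_adj g) => H.
by rewrite /sesqui_poly !(mxE, sum3) /= -!mul_polyC; ring.
Qed.

Lemma prod_sqr_dvdp (k : fieldType) (rs : seq k) (p : {poly k}) : uniq rs ->
  {in rs, forall r, ('X - r%:P) ^+ 2 %| p} ->
  (\prod_(r <- rs) ('X - r%:P)) ^+ 2 %| p.
Proof.
elim: rs => [|r rs IH] /= => [_ _|/andP[r_rs urs] rsp].
  by rewrite big_nil expr1n dvd1p.
rewrite big_cons exprMn Gauss_dvdp.
  by rewrite rsp ?mem_head // IH // => a a_rs; apply: rsp; rewrite inE a_rs orbT.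
apply: coprimep_expl; apply: coprimep_expr.
by rewrite coprimep_sym coprimep_XsubC root_prod_XsubC.
Qed.

(* The coefficients of degrees 9, 8 and 4 of [G ^+ 2] vanish, whence those of
   degrees 4, 3 and 2 of [G]. *)
Lemma quintic_of_square (k : fieldType) (G : {poly k}) : (2%:R : k) != 0 ->
  G \is monic -> size G = 6%N -> G.[0] = 0 -> G.[1] = 0 ->
  (G ^+ 2)`_9 = 0 -> (G ^+ 2)`_8 = 0 -> (G ^+ 2)`_4 = 0 -> G = 'X^5 - 'X.
Proof.
move=> two0 /monicP mG sG G0 G1 c9 c8 c4.
have big n : (5 < n)%N -> G`_n = 0 by move=> n5; rewrite nth_default // sG.
have g5 : G`_5 = 1 by rewrite -mG lead_coefE sG.
have g0 : G`_0 = 0 by rewrite -horner_coef0.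
have sq0 (x : k) : x *+ 2 = 0 -> x = 0.
  by move/eqP; rewrite -mulr_natr mulf_eq0 (negPf two0) orbF => /eqP.
have g4 : G`_4 = 0.
  apply: sq0; rewrite -[RHS]c9 expr2 coefM !big_ord_recr big_ord0 /=.
  by rewrite !(big 9%N, big 8, big 7, big 6) // g5 g0; ring.
have g3 : G`_3 = 0.
  apply: sq0; rewrite -[RHS]c8 expr2 coefM !big_ord_recr big_ord0 /=.
  by rewrite !(big 8, big 7, big 6) // g5 g4 g0; ring.
have g2 : G`_2 = 0.
  apply/eqP; rewrite -sqrf_eq0; apply/eqP.
  rewrite -[RHS]c4 [in RHS]expr2 coefM !big_ord_recr big_ord0 /=.
  by rewrite g4 g3 g0; ring.
have GE : G = G`_1 *: 'X + 'X^5.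
  rewrite -[LHS]coefK poly_def sG !big_ord_recr big_ord0 /=.
  by rewrite g0 g2 g3 g4 g5 !scale0r scale1r; ring.
have g1 : G`_1 = - 1.
  move: G1; rewrite {1}GE hornerD hornerZ hornerX hornerXn expr1n mulr1 => /eqP.
  by rewrite addr_eq0 => /eqP.
by rewrite GE g1 scaleN1r addrC.
Qed.

(** * Totally tangent conics have unitary frames *)

Section TangentFrames.
Variable k : closedFieldType.
Hypothesis char5 : 5%N \in [pchar k].
Variables (Gam : plane_curve k 6) (E : 'M[k]_3) (c : k).
Hypothesis E_unit : E \in unitmx.
Hypothesis c_neq0 : c != 0.
Hypothesis GamE : equation Gam = c *: herm (coordinates E) (coordinates E).
Implicit Types (g w : 'M[k]_3) (P : plane_point k) (p : option k).

Local Notation frame_coord := (frame_coord E).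
Local Notation frame_conic := (frame_conic E).
Local Notation tt := (totally_tangent_conics Gam).

Definition gam_poly g : {poly k} := pullback (conic_param (g *m E)) (equation Gam).

Lemma gam_polyE g : gam_poly g = c *: sesqui_poly (g *m gram k *m frob_adj g).
Proof. by rewrite /gam_poly (gam_param E_unit GamE) herm_sesqui_poly. Qed.

Lemma horner_gam_poly g t : (gam_poly g).[t] =
  c * herm (conic_pt (Some t) *m g) (conic_pt (Some t) *m g).
Proof. by rewrite horner_conic_param mulmxA (gam_value E_unit GamE). Qed.

Lemma conic_points_list g n (X : set (plane_point k)) : g \in unitmx ->
  (forall P, X P -> points (frame_conic g) P) -> X #= `I_n ->
  exists ps : seq (option k), [/\ uniq ps, size ps = n &
    forall p, p \in ps <-> exists2 P, X P &
      proportional (frame_coord P) (conic_pt p *m g)].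
Proof.
move=> gU XQ /card_projectiveP[s [ss us sX]].
have gEu : g *m E \in unitmx by rewrite unitmx_mul gU.
have /choice[pt_of ptE] : forall v, exists p, v \in s ->
    proportional v (conic_pt p *m (g *m E)).
  move=> v; have [/sX[P PX ->]|] := boolP (v \in s); last by exists None.
  have [p pE] := proj1 (frame_conic_pointsP E_unit P gU) (XQ P PX).
  exists p => _; rewrite mulmxA; exact: (proj2 (proportional_coord E_unit _ _)) pE.
exists (map pt_of s); split; last 1 first.
- move=> p; split=> [/mapP[v vs ->]|[P PX PE]].
    have /sX[P PX vE] := vs; exists P => //; apply/(proportional_coord E_unit).
    by have := ptE _ vs; rewrite vE mulmxA.
  have Ps : generator P \in s by apply/sX; exists P.
  apply/mapP; exists (generator P) => //; apply: conic_pt_inj.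
  have := proj2 (proportional_coord E_unit _ _) PE; rewrite -mulmxA => PE'.
  have := proportional_trans (proportional_sym PE') (ptE _ Ps).
  by move/(proportionalM (invmx (g *m E))); rewrite !mulmxK.
- rewrite map_inj_in_uniq // => v w vs ws vw.
  have := proportional_trans (ptE v vs) (proportional_sym _).
  move/(_ w); rewrite vw => /(_ (ptE w ws)).
  have [[P _ ->] [P' _ ->]] := (proj1 (sX v) vs, proj1 (sX w) ws).
  by move/generator_inj->.
- by rewrite size_map.
Qed.

Lemma exists_frame_point g p : g \in unitmx ->
  exists P, proportional (frame_coord P) (conic_pt p *m g).
Proof.
move=> gU; apply: (exists_coord E_unit).
apply: contra (conic_pt_neq0 p) => /eqP p_0.
by rewrite -(mulmxK gU (conic_pt p)) p_0 mul0mx.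
Qed.

Lemma tangency_list g : g \in unitmx ->
  points (frame_conic g) `&` points Gam #= `I_6 ->
  exists ps : seq (option k), [/\ uniq ps, size ps = 6%N &
    forall p, herm (conic_pt p *m g) (conic_pt p *m g) = 0 <-> p \in ps].
Proof.
move=> gU X6; have [|ps [ups sps psE]] := conic_points_list gU _ X6.
  by move=> P [].
exists ps; split=> // p; split=> [p0|/psE[P [_ PG] /proportional_sym[a a0 ->]]].
  have [P PE] := exists_frame_point p gU; apply/psE; exists P => //.
  split; first by apply/(frame_conic_pointsP E_unit P gU); exists p.
  apply/(gam_points E_unit c_neq0 GamE).
  by case: PE => a a0 ->; rewrite hermZ p0 mulr0.
by rewrite hermZ (proj1 (gam_points E_unit c_neq0 GamE P) PG) mulr0.
Qed.

(** A zero restriction would make every parameter a common point, against there being six. *)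
Lemma gam_poly_neq0 g : g \in unitmx ->
  points (frame_conic g) `&` points Gam #= `I_6 -> gam_poly g != 0.
Proof.
move=> gU /(tangency_list gU)[ps [_ _ psE]]; apply/eqP => g0.
have [t] := exists_notin (pmap id ps); apply/negP; rewrite negbK.
rewrite mem_pmap map_id; apply/psE; have := horner_gam_poly g t.
by rewrite g0 horner0 => /esym/eqP; rewrite mulf_eq0 (negPf c_neq0) => /eqP.
Qed.

(** The order of vanishing at 0 is the intersection multiplicity, which is 2 by hypothesis. *)
Lemma gam_poly_tangent g : g \in unitmx -> tt (frame_conic g) ->
  herm (row i0 g) (row i0 g) = 0 ->
  exists2 u, gam_poly g = 'X^2 * u & u.[0] != 0.
Proof.
move=> gU [nsQ card6 mult2] g0.
have gEu : g *m E \in unitmx by rewrite unitmx_mul gU.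
have gp0 := gam_poly_neq0 gU card6.
have row0E : row i0 g = conic_pt (Some 0) *m g.
  by apply/rowP => j; rewrite !mxE sum3 !mxE /=; ring.
have [P] := exists_frame_point (Some 0) gU; rewrite -row0E => PE.
have PQ : points (frame_conic g) P.
  by apply/(frame_conic_pointsP E_unit P gU); exists (Some 0); rewrite -row0E.
have PG : points Gam P.
  apply/(gam_points E_unit c_neq0 GamE); case: PE => a a0 ->.
  by rewrite hermZ g0 mulr0.
have [m [u u0 gE]] := multiplicity_XsubC (gam_poly g) 0.
move: u0; rewrite gp0 /= => u0; rewrite subr0 mulrC in gE.
have [a a0 QE] := conic_ofE gEu.
have PrE : proportional (coord_of P) (row i0 (g *m E)).
  by rewrite row_mul; apply/(proportional_coord E_unit).
have := conic_multiplicity 2 gEu a0 QE PrE gE u0 isT.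
case=> /(_ (mult2 P PQ PG)) m2 _; subst m.
by exists u.
Qed.

Lemma frame_conicZ a g : a != 0 -> g \in unitmx ->
  frame_conic (a *: g) = frame_conic g.
Proof.
move=> a0 gU; rewrite -mul_scalar_mx; apply/frame_conic_eq => //.
  by rewrite unitmxE det_scalar unitfE expf_neq0.
by move=> p; rewrite mul_mx_scalar conic_valueZ conic_value_pt mulr0.
Qed.

Lemma horner_gam_poly_frame_at g r t :
  (gam_poly (frame_at (Some r) *m g)).[t] = (gam_poly g).[t + r].
Proof.
rewrite !horner_gam_poly mulmxA mul_frame_at !mxE /= mul1r.
suff -> : vec3 1 (r + t) (1 * r ^+ 2 + t * (r *+ 2) + t ^+ 2) = conic_pt (Some (t + r)).
  by [].
by apply: row3P; rewrite !mxE /=; ring.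
Qed.

Lemma gam_poly_dvdp g r : g \in unitmx -> tt (frame_conic g) ->
  (gam_poly g).[r] = 0 -> ('X - r%:P) ^+ 2 %| gam_poly g.
Proof.
move=> gU gtt gr0; have sU := frame_at_unit (Some r).
have sgU : frame_at (Some r) *m g \in unitmx by rewrite unitmx_mul sU.
have [||u uE u0] := gam_poly_tangent sgU.
- by rewrite frame_conic_frame_at.
- rewrite row_mul row_frame_at; move: gr0; rewrite horner_gam_poly => /eqP.
  by rewrite mulf_eq0 (negPf c_neq0) => /eqP.
apply/dvdpP; exists (u \Po ('X - r%:P)); apply/eqP; rewrite -subr_eq0; apply/eqP.
apply: poly_eq0_horner => t; apply/eqP; rewrite hornerD hornerN subr_eq0 hornerM.
have -> : (gam_poly g).[t] = (gam_poly (frame_at (Some r) *m g)).[t - r].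
  by have /esym := horner_gam_poly_frame_at g r (t - r); rewrite subrK.
apply/eqP; rewrite uE [LHS]hornerM horner_comp !horner_exp hornerX !hornerXsubC.
exact: mulrC.
Qed.

Lemma totally_tangent_unitary Q : tt Q -> exists2 g, unitary g & Q = frame_conic g.
Proof.
move=> Qtt; case: (Qtt) => nsQ card6 _.
have two0 : 2%:R != 0 :> k by rewrite -(dvdn_pcharf char5).
have [s [ss us sX]] := card_projectiveP card6.
case: s ss us sX => [|v0 [|v1 [|v2 s]]] // ss us sX.
have sP v : v \in [:: v0, v1, v2 & s] -> exists2 P, points Q P /\ points Gam P &
    v = generator P by case/sX => P; exists P.
have [P0 [PQ0 PG0] v0E] := sP v0 (mem_head _ _).
have [|P1 [PQ1 PG1] v1E] := sP v1; first by rewrite !inE eqxx !orbT.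
have [|P2 [PQ2 PG2] v2E] := sP v2; first by rewrite !inE eqxx !orbT.
have {us} [n01 n02 n12] : [/\ P0 <> P1, P0 <> P2 & P1 <> P2].
  move: us; rewrite /= !inE v0E v1E v2E !negb_or -!andbA.
  case/and5P => /eqP n01 /eqP n02 _ /eqP n12 _.
  by split=> e; [apply: n01|apply: n02|apply: n12]; rewrite e.
have [B [Bu QB]] := conic_frame char5 nsQ PQ0 PQ1 PQ2 n01 n02 n12.
pose g := B *m invmx E; have gU : g \in unitmx by rewrite unitmx_mul Bu unitmx_inv.
have BE : B = g *m E by rewrite mulmxKV.
rewrite !BE mulmxA => E0; rewrite mulmxA => E1; rewrite mulmxA => E2.
have {}QB : Q = frame_conic g by rewrite /frame_conic -BE.
rewrite QB in Qtt card6 *; clear Q nsQ QB PQ0 PQ1 PQ2 sX sP.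
have tangent P p : points Gam P -> proportional (coord_of P) (conic_pt p *m g *m E) ->
    herm (conic_pt p *m g) (conic_pt p *m g) = 0.
  move=> /(gam_points E_unit c_neq0 GamE) + /(proportional_coord E_unit)/proportional_sym[a a0 ->].
  by move=> P0'; rewrite hermZ P0' mulr0.
have T0 := tangent _ _ PG0 E0; have T1 := tangent _ _ PG1 E1.
have T2 := tangent _ _ PG2 E2.
have [ps [ups sps psE]] := tangency_list gU card6.
set H := g *m gram k *m frob_adj g.
have fE : gam_poly g = c *: sesqui_poly H := gam_polyE g.
(* Reversing the frame brings infinity to 0 and reverses the indices of [H]; double vanishing there
   reads off the three lowest coefficients. Thus the polynomial has degree exactly 0 + 5 * 2 =
   10. *)
have [H22 H12 H02] : [/\ H i2 i2 = 0, H i1 i2 = 0 & H i0 i2 != 0].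
  have sgU : frame_at None *m g \in unitmx by rewrite unitmx_mul frame_at_unit.
  have [||u uE u0] := gam_poly_tangent sgU; first by rewrite frame_conic_frame_at.
    by rewrite row_mul row_frame_at.
  have H'E i j : (frame_at None *m g *m gram k *m frob_adj (frame_at None *m g)) i j =
      H (rev_ord i) (rev_ord j).
    have -> : frame_at None *m g *m gram k *m frob_adj (frame_at None *m g) =
        frame_at None *m H *m frob_adj (frame_at None) by rewrite frob_adjM // /H !mulmxA.
    move: H {fE} => H; rewrite !(mxE, sum3) /=.
    case: (ord3P i) (ord3P j) => -> [] ->; rewrite /= ?mxE /=;
    rewrite ?expr1n ?expr0n ?(mulr0, mul0r, mulr1, mul1r, addr0, add0r);
    by congr (fun_of_matrix H _ _); apply: val_inj.
  move: uE; rewrite gam_polyE.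
  set H' := _ *m frob_adj _ => uE.
  have cE i j : c * H' i j = ('X^2 * u)`_(i + 5 * j).
    by rewrite -uE coefZ coef_sesqui_poly_ij.
  have r0 : rev_ord i0 = i2 by apply: val_inj.
  have r1 : rev_ord i1 = i1 by apply: val_inj.
  have r2 : rev_ord i2 = i0 by apply: val_inj.
  have := (cE i0 i0, cE i1 i0, cE i2 i0).
  rewrite /H' !H'E r0 r1 r2 !coefXnM /= => -[[e0 e1] e2]; split.
  - by move/eqP: e0; rewrite mulf_eq0 (negPf c_neq0) => /eqP.
  - by move/eqP: e1; rewrite mulf_eq0 (negPf c_neq0) => /eqP.
  - by apply: contra u0 => /eqP H0; rewrite horner_coef0 -e2 H0 mulr0.
have size_f : size (gam_poly g) = 11%N.
  rewrite fE size_scale //; apply/anti_leq/andP; split.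
    apply/leq_sizeP => n n11; rewrite coef_sesqui_poly.
    have neq i : (i <= 10)%N -> (n == i) = false.
      by move=> i10; apply/eqP => ni; move: n11; rewrite ni ltnNge i10.
    rewrite big1 // => i _; rewrite big1 // => j _.
    by case: (ord3P i) (ord3P j) => -> [] ->; rewrite ?H22 ?H12 ?mul0r // neq ?mulr0.
  rewrite ltnNge; apply/negP => /leq_sizeP/(_ (i0 + 5 * i2)%N isT)/eqP.
  by rewrite coef_sesqui_poly_ij (negPf H02).
have noneF : None \in ps by apply/psE; move: T2.
pose rs := pmap id ps.
have urs : uniq rs by apply: (pmap_uniq (g := Some)) => // -[].
have srs : size rs = 5%N.
  have := count_predC (pred1 None) ps.
  rewrite sps (count_uniq_mem _ ups) noneF add1n => -[<-].
  by rewrite size_pmap; apply: eq_count; case.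
have mem_rs t : t \in rs <-> herm (conic_pt (Some t) *m g) (conic_pt (Some t) *m g) = 0.
  by rewrite mem_pmap map_id; split=> /psE.
pose G := \prod_(r <- rs) ('X - r%:P).
have sG : size G = 6 by rewrite size_prod_XsubC srs.
have G_monic : G \is monic by exact: monic_prod_XsubC.
have Gdvd : G ^+ 2 %| gam_poly g.
  apply: prod_sqr_dvdp => // r /mem_rs r0; apply: gam_poly_dvdp => //.
  by rewrite horner_gam_poly r0 mulr0.
have [a a0 Ga] : exists2 a, a != 0 & gam_poly g = a *: G ^+ 2.
  (* Both have degree 10: the five finite tangency points account for the whole polynomial. *)
  have : G ^+ 2 %= gam_poly g.
    by rewrite -dvdp_size_eqp // size_f expr2 size_Mmonic ?monic_neq0 // sG.
  case/eqpP => -[x y] /= /andP[x0 y0] xy; exists (x / y).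
    by rewrite mulf_neq0 ?invr_eq0.
  by apply: (scalerI y0); rewrite -xy scalerA mulrCA divff ?mulr1.
have root_G t : t \in rs -> G.[t] = 0.
  by move=> t_rs; apply/rootP; rewrite root_prod_XsubC.
have coefG n : (forall i j : 'I_3, n == (i + 5 * j)%N = false) -> (G ^+ 2)`_n = 0.
  move=> nE; have : (gam_poly g)`_n = 0.
    rewrite fE coefZ coef_sesqui_poly big1 ?mulr0 // => i _.
    by rewrite big1 // => j _; rewrite nE mulr0.
  by rewrite Ga coefZ => /eqP; rewrite mulf_eq0 (negPf a0) => /eqP.
(* The frame puts two tangency points at 0 and 1, and 9, 8, 4 are not of the form [i + 5 j]. *)
have GE : G = 'X^5 - 'X.
  apply: quintic_of_square => //; try (by apply: root_G; apply/mem_rs);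
  by apply: coefG => i j; case: (ord3P i) (ord3P j) => -> [] ->.
(* The identity frame yields the same polynomial up to a constant, and the polynomial determines its
   matrix. *)
have HE : H = (a / c) *: gram k.
  have /polyP HP : c *: sesqui_poly H = a *: sesqui_poly (gram k).
    rewrite -fE Ga GE -herm_conic_pt; congr (_ *: _).
    have := herm_sesqui_poly 1%:M char5; rewrite /= map_mx1 mulmx1 => ->.
    by rewrite mul1mx frob_adj1 // mulmx1.
  apply/matrixP => i j; have := HP (i + 5 * j)%N.
  rewrite !coefZ !coef_sesqui_poly_ij => e; apply: (mulfI c_neq0); rewrite [in RHS]mxE.
  by rewrite /= e mulrA mulrCA divff ?mulr1.
(* Scaling the frame by [l] multiplies its Gram matrix by l * l^5. *)
have /closed_rootP[l /rootP] : size ('X^6 - (c / a)%:P) != 1%N.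
  by rewrite size_XnsubC.
rewrite hornerD hornerN hornerXn hornerC => /eqP; rewrite subr_eq0 => /eqP lE.
have l0 : l != 0.
  by apply: contraTneq (mulf_neq0 c_neq0 (invr_neq0 a0)) => l0; rewrite -lE l0 expr0n negbK.
exists (l *: g); last by rewrite frame_conicZ.
rewrite /unitary frob_adjZ -!scalemxAl -scalemxAr scalerA -exprS lE -/H HE scalerA.
by rewrite mulrA divfK // divff // scale1r.
Qed.

End TangentFrames.

(** * Special secant lines and adjacency *)

Definition dot3 (R : pzRingType) (x y : 'rV[R]_3) : R :=
  x 0 i0 * y 0 i0 + x 0 i1 * y 0 i1 + x 0 i2 * y 0 i2.

Definition cross3 (R : pzRingType) (x y : 'rV[R]_3) : 'rV[R]_3 :=
  vec3 (x 0 i1 * y 0 i2 - x 0 i2 * y 0 i1) (x 0 i2 * y 0 i0 - x 0 i0 * y 0 i2)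
       (x 0 i0 * y 0 i1 - x 0 i1 * y 0 i0).

Section CrossProduct.
Variable k : fieldType.
Implicit Types x y z : 'rV[k]_3.

Lemma dot3_cross3l x y : dot3 x (cross3 x y) = 0.
Proof. by rewrite /dot3 !mxE /=; ring. Qed.

Lemma dot3_cross3r x y : dot3 y (cross3 x y) = 0.
Proof. by rewrite /dot3 !mxE /=; ring. Qed.

Lemma dot3Zr a x y : dot3 x (a *: y) = a * dot3 x y.
Proof. by rewrite /dot3 !mxE; ring. Qed.

Lemma dot3Zl a x y : dot3 (a *: x) y = a * dot3 x y.
Proof. by rewrite /dot3 !mxE; ring. Qed.

Lemma cross3_eq0 x y : x != 0 -> y != 0 -> cross3 x y = 0 -> proportional x y.
Proof.
move=> x0 y0 /rowP xy; have := (xy i0, xy i1, xy i2); rewrite !mxE /=.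
move=> [[/subr0_eq e0 /subr0_eq e1] /subr0_eq e2].
have [i yi] : exists i, y 0 i != 0.
  apply/existsP; rewrite -negb_forall; apply: contra y0 => /forallP y0.
  by apply/eqP/rowP => i; rewrite mxE; apply/eqP.
have xE : x = (x 0 i / y 0 i) *: y.
  apply: (scalerI yi); rewrite scalerA mulrCA divff // mulr1.
  apply: row3P; rewrite !mxE; case: (ord3P i) => ->;
  by rewrite ?(mulrC (y 0 _)) ?e0 ?e1 ?e2 ?(mulrC (x 0 _)) // -?e0 -?e1 -?e2 mulrC.
exists (x 0 i / y 0 i) => //; apply: contraNneq x0 => c0.
by rewrite xE c0 scale0r.
Qed.

Lemma dot3_eq0 x y z : x != 0 -> y != 0 -> z != 0 -> ~ proportional x y ->
  dot3 x z = 0 -> dot3 y z = 0 -> proportional z (cross3 x y).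
Proof.
move=> x0 y0 z0 xy xz yz; apply: cross3_eq0 => //.
  by apply/eqP => /(cross3_eq0 x0 y0).
have -> : cross3 z (cross3 x y) = dot3 y z *: x - dot3 x z *: y.
  by apply: row3P; rewrite /dot3 !mxE /= ?mxE /=; ring.
by rewrite xz yz !scale0r subrr.
Qed.

(** A Vandermonde determinant: no three points of a conic are collinear. *)
Lemma conic_pt_triple (p q r : option k) : p != q -> q != r -> r != p ->
  dot3 (conic_pt r) (cross3 (conic_pt p) (conic_pt q)) != 0.
Proof.
have sub (a b : k) : Some a != Some b -> a - b != 0.
  by rewrite subr_eq0; apply: contra => /eqP->.
case: p q r => [p|] [q|] [r|] // pq qr rp; rewrite /dot3 !mxE /= ?mxE /=.
- suff -> : 1 * (p * q ^+ 2 - p ^+ 2 * q) + r * (p ^+ 2 * 1 - 1 * q ^+ 2) +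
    r ^+ 2 * (1 * q - p * 1) = (p - q) * (q - r) * (r - p).
    by rewrite !mulf_neq0 ?sub.
  by ring.
- by rewrite !mul0r !add0r !mul1r mulr1 -opprB oppr_eq0 sub.
- by rewrite !mulr0 !mulr1 subr0 sub0r mulrN1 subr0 mulr0 addr0 mul1r -opprB oppr_eq0 sub.
- by rewrite !mul0r !mul1r sub0r subr0 mulr1 subrr mulr0 addr0 addrC -opprB oppr_eq0 sub.
Qed.

End CrossProduct.

Section LineForms.
Variable k : closedFieldType.
Implicit Types (B : 'M[k]_3) (xi x : 'rV[k]_3).

Definition line_form B xi : {mpoly k[3]} :=
  \sum_(i < 3) xi 0 i *: coordinates B 0 i.

Lemma line_form_homog B xi : line_form B xi \is 1.-homog.
Proof.
by apply: rpred_sum => i _; rewrite rpredZ // coordinates_homog.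
Qed.

Lemma meval_line_form B xi x : B \in unitmx ->
  (line_form B xi).@[(x *m B) 0] = dot3 x xi.
Proof.
move=> Bu; rewrite /line_form sum3 !mevalD !mevalZ !meval_coordinates mulmxK //.
by rewrite /dot3; ring.
Qed.

Lemma line_formZ B a xi : line_form B (a *: xi) = a *: line_form B xi.
Proof.
rewrite /line_form scaler_sumr; apply: eq_bigr => i _.
by rewrite mxE scalerA.
Qed.

Lemma linear_form_coordinates B (F : {mpoly k[3]}) : B \in unitmx -> F \is 1.-homog ->
  exists xi, F = line_form B xi.
Proof.
move=> Bu /dhomogP F1; rewrite (mpolyE F) big_seq.
elim/big_rec: _ => [|m F' /F1 /= m1 [xi ->]].
  by exists 0; rewrite /line_form big1 // => i _; rewrite mxE scale0r.
have [s ss ->] := mpolyX_seq k m; rewrite m1 in ss.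
case: s ss => [|i [|? ?]] // _; rewrite big_seq1.
have /rowP/(_ i) := coordinates_inv Bu; rewrite [RHS]mxE => <-.
exists (F@_m *: (col i B)^T + xi); rewrite mxE scaler_sumr /line_form -big_split /=.
apply: eq_bigr => j _; rewrite !mxE mulrC mul_mpolyC scalerA scalerDl.
by congr (_ *: _ + _).
Qed.

Lemma line_form_inj B xi xi' : B \in unitmx ->
  line_form B xi = line_form B xi' -> xi = xi'.
Proof.
move=> Bu E; have vE x : dot3 x xi = dot3 x xi'.
  by rewrite -!(meval_line_form _ _ Bu) E.
have := (vE (vec3 1 0 0), vE (vec3 0 1 0), vE (vec3 0 0 1)).
rewrite /dot3 !mxE /= !mul1r !mul0r !add0r !addr0 => -[[e0 e1] e2].
exact: row3P.
Qed.

End LineForms.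

(* Points [0, .., 5] of the projective line over F_5, in the order of [P1F5]. *)
Definition P1F5_pt (k : nzRingType) (i : nat) : 'rV[k]_3 :=
  conic_pt (nth None (P1F5 k) i).

Definition pairs6 : seq (nat * nat) :=
  [seq (i, j) | j <- iota 0 6, i <- iota 0 j].

Definition secant (k : nzRingType) (ij : nat * nat) : 'rV[k]_3 :=
  cross3 (P1F5_pt k ij.1) (P1F5_pt k ij.2).

Definition shared_secant (k : nzRingType) (w : 'M[k]_3) (ij : nat * nat) : bool :=
  (1 < count (fun r => dot3 (P1F5_pt k r *m w) (secant k ij) == 0%R) (iota 0 6))%N.

Definition shared (k : nzRingType) (w : 'M[k]_3) : nat :=
  count (shared_secant w) pairs6.

Section Secants.
Variable k : closedFieldType.
Hypothesis char5 : 5%N \in [pchar k].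
Variables (Gam : plane_curve k 6) (E : 'M[k]_3) (c : k).
Hypothesis E_unit : E \in unitmx.
Hypothesis c_neq0 : c != 0.
Hypothesis GamE : equation Gam = c *: herm (coordinates E) (coordinates E).
Implicit Types (g w : 'M[k]_3) (P : plane_point k) (p : option k).

Local Notation frame_conic := (frame_conic E).

Lemma gam_unitary g : unitary g ->
  equation Gam = c *: herm (coordinates (g *m E)) (coordinates (g *m E)).
Proof.
move=> gu; have gu' : unitary (map_mx (@mpolyC 3 k) (invmx g)).
  exact: map_unitary (unitary_inv char5 gu).
have key (y : 'rV[{mpoly k[3]}]_3) G : unitary G -> herm y y = herm (y *m G) (y *m G).
  by move=> Gu; rewrite (herm_unitary (pchar5_mpoly char5)).
rewrite GamE.
rewrite (coordinatesM (unitary_unit char5 gu) E_unit).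
have k2 := key (coordinates E) _ gu'.
exact: (congr1 (fun F : {mpoly k[3]} => c *: F) k2).
Qed.

Lemma mderiv_coordinates (B : 'M[k]_3) i j :
  (coordinates B 0 i)^`M(j) = (invmx B j i)%:MP.
Proof.
rewrite coordinatesE raddf_sum (bigD1 j) //= big1 => [|l lj].
  by rewrite mderivZ mderivX mnm1E eqxx -[X in (X - _)%MM]add0m addmK mpolyX0 scale1r addr0 alg_mpolyC.
by rewrite mderivZ mderivX mnm1E (negPf lj) scale0r scaler0.
Qed.

Lemma mderiv_exp (F : {mpoly k[3]}) i n :
  (F ^+ n)^`M(i) = F^`M(i) * F ^+ n.-1 *+ n.
Proof.
elim: n => [|n IH]; first by rewrite expr0 -[1]/(1%:MP) mderivC mulr0n.
rewrite exprS mderivM IH mulrnAr mulrCA mulrS.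
by case: n {IH} => [|n]; rewrite ?mulr0n //= -exprS.
Qed.

Lemma mderiv_pow5 (F : {mpoly k[3]}) i : (F ^+ 5)^`M(i) = 0.
Proof. by rewrite mderiv_exp -mulr_natr (nat5 (pchar5_mpoly char5)) mulr0. Qed.

(** Fifth powers have zero derivative in characteristic 5, so only the linear factors are
    differentiated. *)
Lemma mderiv_herm (Y : 'rV[{mpoly k[3]}]_3) i :
  (herm Y Y)^`M(i) = (Y 0 i0)^`M(i) * Y 0 i2 ^+ 5
    - 2%:R * (Y 0 i1)^`M(i) * Y 0 i1 ^+ 5 + (Y 0 i2)^`M(i) * Y 0 i0 ^+ 5.
Proof.
have d5 (F G : {mpoly k[3]}) : (F * G ^+ 5)^`M(i) = F^`M(i) * G ^+ 5.
  by rewrite mderivM (mderiv_pow5 G) mulr0 addr0.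
by rewrite hermE mderivD mderivB !d5 !mulr_natl mderivMn.
Qed.

(** In a frame where the point is (1, 0, 0) the gradient of [herm] is that of the last coordinate,
    so the tangent is Y2 = 0. On this line, at (1, t, 0), the form equals -2 t^6. *)
Lemma tangency_weierstrass g P : unitary g ->
  points (frame_conic g) P -> points Gam P -> weierstrass_points Gam P.
Proof.
move=> gu PQ PG; split=> //.
have [p pF pE] := proj1 (mem_tangency char5 E_unit c_neq0 GamE P gu) (conj PQ PG).
have hu := unitaryM char5 (frame_at_unitary char5 pF) gu.
set h := frame_at p *m g in hu; have hU := unitary_unit char5 hu.
have hEu : h *m E \in unitmx by rewrite unitmx_mul hU.
have PrE : proportional (coord_of P) (row i0 (h *m E)).
  by rewrite /h !row_mul row_frame_at; apply/(proportional_coord E_unit).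
have GE := gam_unitary hu; set Y := coordinates (h *m E) in GE.
have Y2_neq0 : Y 0 i2 != 0.
  apply/eqP => /(congr1 (meval ((vec3 0 0 1 *m (h *m E)) 0))).
  rewrite rmorph0 meval_coordinates mulmxK // mxE /=.
  by apply/eqP/oner_neq0.
have [l [b b0 lE']] := exists_generator (V := dhomog 3 k 1)
  (v := DHomog (coordinates_homog (h *m E) i2)) Y2_neq0.
have lE : equation l = b *: Y 0 i2 by rewrite /equation -/(generator l) lE'.
exists l.
  split=> //; case: PrE => a a0 PE.
  have YP i : (Y 0 i).@[coord_of P 0] = (a *: vec3 1 0 0) 0 i.
    have e0 : row i0 (1%:M : 'M[k]_3) = vec3 1 0 0 by apply: row3P; rewrite !mxE.
    by rewrite meval_coordinates PE -scalemxAl -row_mul mulmxV // e0.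
  exists (b / (c * a ^+ 5)); first by rewrite !mulf_neq0 ?invr_eq0 ?mulf_neq0 ?expf_neq0.
  have dG i : eval_at P (equation Gam)^`M(i) = c * a ^+ 5 * invmx (h *m E) i i2.
    rewrite eval_atE GE mderivZ mevalZ mderiv_herm !mderiv_coordinates.
    have ev (F G : {mpoly k[3]}) :
        (F * G ^+ 5).@[coord_of P 0] = F.@[coord_of P 0] * G.@[coord_of P 0] ^+ 5.
      by rewrite mevalM (rmorphXn (meval _)).
    rewrite mevalD mevalB !ev !YP !mxE /= mulr1 mulr0 !expr0n !mulr0 subr0 add0r.
    by rewrite mevalC mulrA mulrAC.
  rewrite lE /Y coordinatesE !scaler_sumr; apply: eq_bigr => i _.
  by rewrite dG !scalerA [X in _ = X *: _]mulrA divfK ?mulf_neq0 ?expf_neq0.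
apply: intersection_multiplicityC.
apply/(line_multiplicity (D := Gam) (r := 6) (u := (- (c *+ 2))%:P) 6 hEu b0 lE PrE) => //.
- rewrite GE mmapZ /= mul_polyC (map_herm (pullback _)) -mul_polyC.
  have -> : map_mx (pullback (line_param (h *m E))) Y = vec3 1 'X 0.
    by apply/rowP => i; rewrite mxE pullback_line_coordinates.
  by rewrite hermE !mxE /= rmorphN rmorphMn /=; ring.
- rewrite hornerC oppr_eq0 -mulr_natr mulf_neq0 //.
  by rewrite -(dvdn_pcharf char5).
Qed.

End Secants.

Lemma mem_pairs6 (i j : nat) : ((i, j) \in pairs6) = (i < j < 6)%N.
Proof.
apply/allpairsPdep/andP => [[j' [i' [j'6 i'j [-> ->]]]]|[ij j6]].
  by move: j'6 i'j; rewrite !mem_iota.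
by exists j, i; rewrite !mem_iota.
Qed.

Lemma pairs6_uniq : uniq pairs6. Proof. by []. Qed.

Lemma count_gt1P (T : eqType) (a : pred T) (s : seq T) : uniq s ->
  (1 < count a s)%N <-> exists x y, [/\ x \in s, y \in s, x != y, a x & a y].
Proof.
move=> us; rewrite -size_filter; have := filter_uniq a us.
have mem x : (x \in [seq x <- s | a x]) = a x && (x \in s) by rewrite mem_filter.
split=> [|[x [y [xs ys xy ax ay]]]].
  case E: [seq x <- s | a x] => [|x [|y t]] // _.
  move: H; rewrite E /= inE negb_or -andbA => /andP[xy _].
  have := mem x; rewrite E mem_head => /esym/andP[ax xs].
  have := mem y; rewrite E !inE eqxx orbT => /esym/andP[ay ys].
  by exists x, y.
have xf : x \in [seq x <- s | a x] by rewrite mem ax.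
have yf : y \in [seq x <- s | a x] by rewrite mem ay.
case: [seq x <- s | a x] xf yf => [|u [|v t]] //.
by rewrite !inE => /eqP xu /eqP yu; rewrite xu yu eqxx in xy.
Qed.

Definition four_points (k : nzRingType) (w : 'M[k]_3) : Prop :=
  exists ps : seq (option k), [/\ uniq ps, size ps = 4%N &
    forall p, p \in ps <-> conic_value (conic_pt p *m w) = 0].

(** * Adjacency in terms of the quotient of two frames *)

Section Adjacency.
Variable k : closedFieldType.
Hypothesis char5 : 5%N \in [pchar k].
Variables (Gam : plane_curve k 6) (E : 'M[k]_3) (c : k).
Hypothesis E_unit : E \in unitmx.
Hypothesis c_neq0 : c != 0.
Hypothesis GamE : equation Gam = c *: herm (coordinates E) (coordinates E).
Implicit Types (g w : 'M[k]_3) (P : plane_point k) (p : option k) (l : plane_line k).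

Local Notation frame_coord := (frame_coord E).
Local Notation frame_conic := (frame_conic E).
Local Notation P1F5 := (P1F5 k).

Lemma P1F5_pt_inj i j : (i < 6)%N -> (j < 6)%N ->
  proportional (P1F5_pt k i) (P1F5_pt k j) -> i = j.
Proof.
move=> i6 j6 /conic_pt_inj/eqP; rewrite nth_uniq ?(P1F5_uniq char5) //.
by move/eqP.
Qed.

Lemma meval_proportional d (C : plane_curve k d) P (x : 'rV[k]_3) :
  proportional (coord_of P) x -> points C P <-> (equation C).@[x 0] = 0.
Proof.
case=> a a0 PE; rewrite /points /= eval_atE PE.
have -> : (equation C).@[(a *: x) 0] = a ^+ d * (equation C).@[x 0].
  rewrite /meval -(dhomog_mmapZ _ _ _ (equation_homog C)).
  by rewrite -/(meval _ _); apply: meval_eq => i; rewrite mxE.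
by split=> [/eqP|->]; rewrite ?mulr0 // mulf_eq0 expf_eq0 (negPf a0) andbF => /eqP.
Qed.

(** The secants are automatically special, tangency points being Weierstrass points. *)
Lemma secants_of_conicE g l : unitary g -> secants_of_conic Gam (frame_conic g) l <->
  exists i j, [/\ (i < 6)%N, (j < 6)%N, i != j,
    (equation l).@[(P1F5_pt k i *m g *m E) 0] = 0 &
    (equation l).@[(P1F5_pt k j *m g *m E) 0] = 0].
Proof.
move=> gu; have gU := unitary_unit char5 gu.
have memT := mem_tangency char5 E_unit c_neq0 GamE _ gu.
split=> [[_ [P [P' [PX PX' PP' Pl Pl']]]]|[i [j [i6 j6 ij li lj]]]].
  have [p pF pE] := proj1 (memT P) PX; have [p' pF' pE'] := proj1 (memT P') PX'.
  exists (index p P1F5), (index p' P1F5).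
  rewrite /P1F5_pt !nth_index // -![6%N]/(size P1F5) !index_mem pF pF'; split=> //.
  - apply/eqP => ipp; apply: PP'; apply: (frame_coord_inj E_unit).
    apply: proportional_trans pE (proportional_sym _).
    by rewrite -(nth_index None pF) ipp nth_index.
  - by apply/(meval_proportional l (P := P)); [apply/(proportional_coord E_unit)|].
  - by apply/(meval_proportional l (P := P')); [apply/(proportional_coord E_unit)|].
have [P PE] := exists_frame_point E_unit (nth None P1F5 i) gU.
have [P' PE'] := exists_frame_point E_unit (nth None P1F5 j) gU.
have PX : points (frame_conic g) P /\ points Gam P.
  by apply/memT; exists (nth None P1F5 i) => //; rewrite mem_nth.
have PX' : points (frame_conic g) P' /\ points Gam P'.
  by apply/memT; exists (nth None P1F5 j) => //; rewrite mem_nth.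
have PP' : P <> P'.
  move=> e; have := proportional_trans (proportional_sym PE) _ => /(_ _ _).
  rewrite e => /(_ _ PE')/(proportionalM (invmx g)); rewrite !mulmxK //.
  by move/(P1F5_pt_inj i6 j6) => ijE; rewrite ijE eqxx in ij.
have Pl : points l P.
  by apply/(meval_proportional l (P := P)); [apply/(proportional_coord E_unit); exact: PE|].
have Pl' : points l P'.
  by apply/(meval_proportional l (P := P')); [apply/(proportional_coord E_unit); exact: PE'|].
split; last by exists P, P'.
have tW := tangency_weierstrass char5 E_unit c_neq0 GamE gu.
exists P, P'; split=> //; first by case: PX => a b; apply: tW.
by case: PX' => a b; apply: tW.
Qed.

Lemma secant_triple i j r : (i < j < 6)%N -> (r < 6)%N -> r != i -> r != j ->
  dot3 (P1F5_pt k r) (secant k (i, j)) != 0.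
Proof.
move=> /andP[ij j6] r6 ri rj; have i6 := ltn_trans ij j6.
by apply: conic_pt_triple; rewrite nth_uniq ?(P1F5_uniq char5) ?[j == r]eq_sym ?(ltn_eqF ij).
Qed.

(** A secant contains none of the other four points, so it determines its pair. *)
Lemma secant_inj (ij ij' : nat * nat) : ij \in pairs6 -> ij' \in pairs6 ->
  proportional (secant k ij) (secant k ij') -> ij = ij'.
Proof.
case: ij ij' => [i j] [i' j']; rewrite !mem_pairs6 => ij ij' [a a0 aE].
have on r : dot3 (P1F5_pt k r) (secant k (i', j')) = 0 -> (r < 6)%N -> (r == i) || (r == j).
  move=> r0 r6; apply/negPn/negP; rewrite negb_or => /andP[ri rj].
  have := secant_triple ij r6 ri rj; rewrite aE dot3Zr r0 mulr0 eqxx //.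
have i'on := on i' (dot3_cross3l _ _); have j'on := on j' (dot3_cross3r _ _).
case/andP: ij ij' => ij j6 /andP[ij' j6'].
have /orP[/eqP i'E|/eqP i'E] := i'on (ltn_trans ij' j6');
have /orP[/eqP j'E|/eqP j'E] := j'on j6'; rewrite i'E j'E // in ij' *.
- by rewrite ltnn in ij'.
- by have := ltn_trans ij ij'; rewrite ltnn.
- by rewrite ltnn in ij'.
Qed.

Lemma secant_line g l : unitary g -> secants_of_conic Gam (frame_conic g) l <->
  exists2 ij, ij \in pairs6 &
    exists2 a, a != 0 & equation l = a *: line_form (g *m E) (secant k ij).
Proof.
move=> gu; have gU := unitary_unit char5 gu.
have gEu : g *m E \in unitmx by rewrite unitmx_mul gU.
split=> [/(secants_of_conicE l gu)[i [j [i6 j6 ij]]]|[[i j] ij [a a0 lE]]].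
  have [xi lE] := linear_form_coordinates gEu (equation_homog l).
  rewrite lE -!mulmxA !(meval_line_form _ _ gEu) => xi_i xi_j.
  have xi0 : xi != 0.
    apply: contra (equation_neq0 l) => /eqP x0; rewrite lE x0 /line_form.
    by rewrite big1 // => r _; rewrite mxE scale0r.
  wlog lij : i j i6 j6 ij xi_i xi_j / (i < j)%N.
    move=> H; case: (ltngtP i j) => ltij; [exact: (H i j)| |by rewrite ltij eqxx in ij].
    by apply: (H j i) => //; rewrite eq_sym.
  exists (i, j); first by rewrite mem_pairs6 lij.
  have [|a a0 aE] := dot3_eq0 (conic_pt_neq0 _) (conic_pt_neq0 _) xi0 _ xi_i xi_j.
    by move/(P1F5_pt_inj i6 j6) => ijE; rewrite ijE eqxx in ij.
  by exists a => //; rewrite aE line_formZ.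
move: ij; rewrite mem_pairs6 => /andP[ij j6]; apply/(secants_of_conicE l gu).
exists i, j; rewrite j6 (ltn_trans ij j6) (ltn_eqF ij) lE !mevalZ -!mulmxA.
rewrite !(meval_line_form _ _ gEu); split=> //.
  by rewrite /secant dot3_cross3l mulr0.
by rewrite /secant dot3_cross3r mulr0.
Qed.

(** Shared secants are secants of the first conic passing through two points of the second, so pairs
    of points of the first conic index them. *)
Lemma card_shared_secants g w : unitary g -> unitary w ->
  secants_of_conic Gam (frame_conic g) `&` secants_of_conic Gam (frame_conic (w *m g))
    #= `I_(shared w).
Proof.
move=> gu wu; have gU := unitary_unit char5 gu; have wgu := unitaryM char5 wu gu.
have gEu : g *m E \in unitmx by rewrite unitmx_mul gU.
pose form ij : dhomog 3 k 1 := DHomog (line_form_homog (g *m E) (secant k ij)).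
have formP ij ij' : proportional (form ij) (form ij') ->
    proportional (secant k ij) (secant k ij').
  case=> a a0 /(congr1 (@mpoly_of_dhomog _ _ _)) /= E0; exists a => //.
  by apply: (line_form_inj gEu); rewrite line_formZ E0.
rewrite /shared -size_filter -(size_map form); apply: card_projective.
  split.
  - rewrite map_inj_in_uniq ?filter_uniq ?pairs6_uniq // => ij ij'.
    rewrite !mem_filter => /andP[_ ijP] /andP[_ ijP'] e.
    by apply: secant_inj => //; apply: formP; rewrite e; exact: proportional_refl.
  - apply/mapP => -[[i j]]; rewrite mem_filter mem_pairs6 => /andP[_ ij].
    move=> /(congr1 (@mpoly_of_dhomog _ _ _)) /= form0.
    have sec0 : secant k (i, j) = 0.
      by apply: (line_form_inj gEu); rewrite -form0 /line_form big1 // => r _;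
        rewrite mxE scale0r.
    have [r [r6 ri rj]] : exists r, [/\ (r < 6)%N, r != i & r != j].
      have /allP := isT : all (fun ij => has (fun r => (r != ij.1) && (r != ij.2)) (iota 0 6)) pairs6.
      move=> /(_ (i, j)); rewrite mem_pairs6 => /(_ ij)/hasP[r].
      by rewrite mem_iota => r6 /andP[? ?]; exists r.
    have := secant_triple ij r6 ri rj; rewrite sec0 /dot3 !mxE.
    by rewrite !mulr0 !addr0 eqxx.
  - move=> _ _ /mapP[ij + ->] /mapP[ij' + ->]; rewrite !mem_filter.
    move=> /andP[_ ijP] /andP[_ ijP'] /formP e; congr form.
    exact: secant_inj.
move=> l; split=> [[/(secant_line l gu)[ij ijP [a a0 lE]]]|[_ /mapP[ij + ->] [a a0]]].
  move=> /(secants_of_conicE l wgu)[r [s [r6 s6 rs r0 s0]]].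
  exists (form ij); last by exists a => //; apply: val_inj.
  apply: map_f; rewrite mem_filter ijP andbT.
  apply/count_gt1P; first exact: iota_uniq.
  exists r, s; rewrite !mem_iota; split=> //.
    move: r0; rewrite lE mevalZ mulmxA -mulmxA meval_line_form // => /eqP.
    by rewrite mulf_eq0 (negPf a0).
  move: s0; rewrite lE mevalZ mulmxA -mulmxA meval_line_form // => /eqP.
  by rewrite mulf_eq0 (negPf a0).
rewrite mem_filter => /andP[sh ijP] /(congr1 (@mpoly_of_dhomog _ _ _)).
rewrite -/(equation l) /= => lE; split.
  by apply/(secant_line l gu); exists ij => //; exists a.
apply/(secants_of_conicE l wgu).
have [r [s [+ + rs /eqP r0 /eqP s0]]] := proj1 (count_gt1P _ (iota_uniq 0 6)) sh.
rewrite !mem_iota => r6 s6; exists r, s; split=> //;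
by rewrite lE mevalZ mulmxA -mulmxA meval_line_form // ?r0 ?s0 mulr0.
Qed.

Lemma card_common_points g w : unitary g -> unitary w ->
  points (frame_conic g) `&` points (frame_conic (w *m g)) #= `I_4 <-> four_points w.
Proof.
move=> gu wu; have gU := unitary_unit char5 gu; have wU := unitary_unit char5 wu.
have wgU : w *m g \in unitmx by rewrite unitmx_mul wU.
have common P p : proportional (frame_coord P) (conic_pt p *m (w *m g)) ->
    points (frame_conic g) P <-> conic_value (conic_pt p *m w) = 0.
  case=> a a0 PE; have PQ := frame_conic_points E_unit P gU.
  rewrite PE -scalemxAl mulmxA mulmxK // conic_valueZ in PQ.
  split=> [/PQ/eqP|w0]; last by apply/PQ; rewrite w0 mulr0.
  by rewrite mulf_eq0 expf_eq0 (negPf a0) => /eqP.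
split=> [X4|[ps [ups sps psE]]].
  have [|ps [ups sps psE]] := conic_points_list E_unit wgU _ X4; first by move=> P [].
  exists ps; split=> // p; split=> [/psE[P [PQ _] PE]|p0]; first exact/(common P p).
  have [P PE] := exists_frame_point E_unit p wgU; apply/psE; exists P => //.
  split; first exact/(common P p).
  by apply/(frame_conic_pointsP E_unit P wgU); exists p.
rewrite -sps; apply: (card_conic_pts E_unit wgU ups) => P; split=> [[PQ]|[p /psE p0 PE]].
  move=> /(frame_conic_pointsP E_unit P wgU)[p PE]; exists p => //.
  by apply/psE/(common P p).
split; first exact/(common P p).
by apply/(frame_conic_pointsP E_unit P wgU); exists p.
Qed.

Lemma conic_adjacentE g w : unitary g -> unitary w ->
  conic_adjacent Gam (frame_conic g) (frame_conic (w *m g)) <->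
  [/\ ~ (forall p, conic_value (conic_pt p *m w) = 0), four_points w & shared w = 3%N].
Proof.
move=> gu wu; have gU := unitary_unit char5 gu; have wU := unitary_unit char5 wu.
have eqV := frame_conic_eq E_unit gU wU.
have sh := card_shared_secants gu wu; have pt4 := card_common_points gu wu.
split=> [[neq p4 s3]|[neq p4 s3]]; split.
- by move/eqV => e; apply: neq.
- exact/pt4.
- by have := card_eq_trans (card_esym sh) s3; move/card_eq_II.
- by move=> e; apply: neq; apply/eqV.
- exact/pt4.
- exact: (card_eq_trans sh (eq_rect _ (fun n => `I_(shared w) #= `I_n) (card_eqxx _) _ s3)).
Qed.

End Adjacency.

(** * The graph *)

Section Embedding.
Variable k : closedFieldType.
Hypothesis char5 : 5%N \in [pchar k].
Variable rt2 : k.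
Hypothesis rt2_sq : rt2 ^+ 2 = 2%:R.

Definition emb5 (x : f5) : k := (nat_of_f5 x)%:R.

Definition emb (x : f25) : k := let: F25 a b := x in emb5 a + emb5 b * rt2.

Definition embv (x : vec) : 'rV[k]_3 :=
  let: Vec a b c := x in vec3 (emb a) (emb b) (emb c).

Definition embm (g : mat) : 'M[k]_3 :=
  let: Mat u v w := g in mx3 (embv u) (embv v) (embv w).

Lemma natr_mod5 n : (n %% 5)%:R = n%:R :> k.
Proof. by rewrite [in RHS](divn_eq n 5) natrD natrM (nat5 char5) mulr0 add0r. Qed.

Lemma emb5D x y : emb5 (f5_add x y) = emb5 x + emb5 y.
Proof. by rewrite /emb5 -natrD -natr_mod5 -[RHS]natr_mod5; case: x; case: y. Qed.

Lemma emb5M x y : emb5 (f5_mul x y) = emb5 x * emb5 y.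
Proof. by rewrite /emb5 -natrM -natr_mod5 -[RHS]natr_mod5; case: x; case: y. Qed.

Lemma emb5N x : emb5 (f5_opp x) = - emb5 x.
Proof.
apply/eqP; rewrite -subr_eq0 opprK -emb5D; apply/eqP.
by rewrite /emb5; case: x.
Qed.

Lemma emb5_pow x : emb5 x ^+ 5 = emb5 x.
Proof. exact: pFrobenius_aut_nat char5 _. Qed.

Lemma emb5_eq0 x : (emb5 x == 0) = f5_is0 x.
Proof. by rewrite /emb5 -(dvdn_pcharf char5); case: x. Qed.

Lemma embD x y : emb (f25_add x y) = emb x + emb y.
Proof. by case: x => a b; case: y => c d; rewrite /= !emb5D; ring. Qed.

Lemma embN x : emb (f25_opp x) = - emb x.
Proof. by case: x => a b; rewrite /= !emb5N; ring. Qed.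

Lemma embM x y : emb (f25_mul x y) = emb x * emb y.
Proof.
case: x => a b; case: y => c d; rewrite /= !(emb5D, emb5M).
transitivity (emb5 a * emb5 c + emb5 b * emb5 d * 2%:R +
  (emb5 a * emb5 d + emb5 b * emb5 c) * rt2); first by ring.
by rewrite -rt2_sq; ring.
Qed.

Lemma emb_conj x : emb (f25_conj x) = emb x ^+ 5.
Proof.
case: x => a b; rewrite /= (pow5D char5) exprMn !emb5_pow emb5N.
have -> : rt2 ^+ 5 = - rt2.
  have -> : rt2 ^+ 5 = (rt2 ^+ 2) ^+ 2 * rt2 by ring.
  rewrite rt2_sq; have -> : 2%:R ^+ 2 * rt2 = 5%:R * rt2 - rt2 by ring.
  by rewrite (nat5 char5) mul0r sub0r.
by ring.
Qed.

(** Multiplying by the conjugate gives a^2 - 2 b^2, which vanishes in F_5 only for a = b = 0. *)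
Lemma emb_is0 x : (emb x == 0) = f25_is0 x.
Proof.
apply/eqP/idP; last first.
  case: x => a b /= /andP[]; rewrite -!emb5_eq0 => /eqP-> /eqP->.
  by rewrite mul0r addr0.
case: x => a b /= ab.
have : emb5 (f5_add (f5_mul a a) (f5_mul A3 (f5_mul b b))) == 0.
  rewrite !(emb5D, emb5M); apply/eqP.
  transitivity ((emb5 a + emb5 b * rt2) * (emb5 a - emb5 b * rt2) + emb5 b ^+ 2 * (rt2 ^+ 2 + 3%:R)).
    by rewrite /emb5 /=; ring.
  by rewrite ab mul0r rt2_sq -natrD (nat5 char5) mulr0 addr0.
by rewrite emb5_eq0; case: a {ab}; case: b.
Qed.

Lemma emb_eq x y : f25_eq x y = (emb x == emb y).
Proof. by rewrite /f25_eq -emb_is0 embD embN subr_eq0. Qed.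

Lemma emb_inj : injective emb.
Proof.
move=> x y /eqP; rewrite -emb_eq; case: x => a b; case: y => c d.
by case: a; case: b; case: c; case: d.
Qed.

Lemma emb0 : emb f25_0 = 0. Proof. by rewrite /= /emb5 /=; ring. Qed.
Lemma emb1 : emb f25_1 = 1. Proof. by rewrite /= /emb5 /=; ring. Qed.
Lemma emb2 : emb f25_2 = 2%:R. Proof. by rewrite /= /emb5 /=; ring. Qed.
Lemma emb3 : emb f25_3 = - 2%:R.
Proof.
rewrite /= /emb5 /=; transitivity (5%:R - 2%:R : k); first by ring.
by rewrite (nat5 char5) sub0r.
Qed.

Lemma emb_pow25 a : emb a ^+ 25 = emb a.
Proof. by rewrite (exprM _ 5 5) -!emb_conj; case: a => a b; case: b. Qed.

(** The 25 embedded elements already exhaust the roots of X^25 - X. *)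
Lemma emb_surj x : x ^+ 25 = x -> exists a, x = emb a.
Proof.
move=> x25; have [/mapP[a _ ->]|xn] := boolP (x \in map emb f25_all); first by exists a.
have p0 : 'X^25 - 'X != 0 :> {poly k}.
  by rewrite -size_poly_eq0 size_polyDl ?size_polyN ?size_polyX size_polyXn.
have uall : uniq (x :: map emb f25_all).
  by rewrite cons_uniq xn (map_inj_uniq emb_inj) f25_all_uniq.
have allroot : all (root ('X^25 - 'X)) (x :: map emb f25_all).
  apply/allP => y; rewrite rootE hornerD hornerN hornerXn hornerX subr_eq0.
  by rewrite inE => /orP[/eqP->|/mapP[a _ ->]]; rewrite ?x25 ?emb_pow25.
have := max_poly_roots p0 allroot uall.
by rewrite size_polyDl ?size_polyN ?size_polyX size_polyXn.
Qed.

Lemma embv_vec3 a b c : embv (Vec a b c) = vec3 (emb a) (emb b) (emb c).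
Proof. by []. Qed.

Lemma embv_mul x g : embv (vec_mul x g) = embv x *m embm g.
Proof.
case: x => x0 x1 x2; case: g => [[a b c] [d e f] [p q r]].
apply: row3P; rewrite [RHS]mxE sum3; cbn [embm embv vec_mul]; rewrite !mxE;
cbn [nth nat_of_ord i0 i1 i2]; rewrite ?mxE; cbn [nth nat_of_ord i0 i1 i2];
rewrite !(embD, embM); ring.
Qed.

Lemma row_embm g i : row i (embm g) =
  let: Mat u v w := g in nth 0 [:: embv u; embv v; embv w] i.
Proof. by case: g => u v w; rewrite rowK. Qed.

Lemma embm_mul g h : embm (mat_mul g h) = embm g *m embm h.
Proof.
case: g => u v w; apply/row_matrixP => i; rewrite row_mul !row_embm.
by case: (ord3P i) => -> /=; rewrite embv_mul.
Qed.

Lemma embm_1 : embm mat_1 = 1%:M.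
Proof.
apply/matrixP => i j; cbn [embm mat_1 embv]; rewrite emb0 emb1 !mxE.
by case: (ord3P i) (ord3P j) => -> [] ->; rewrite /= ?mxE.
Qed.

Lemma emb_dot x y : emb (vec_dot x y) = dot3 (embv x) (embv y).
Proof.
case: x => x0 x1 x2; case: y => y0 y1 y2.
rewrite /dot3; cbn [embv vec_dot]; rewrite !mxE; cbn [nth nat_of_ord i0 i1 i2].
by rewrite !(embD, embM) addrA.
Qed.

Lemma embv_cross x y : embv (vec_cross x y) = cross3 (embv x) (embv y).
Proof.
case: x => x0 x1 x2; case: y => y0 y1 y2; apply: row3P;
cbn [embv vec_cross]; rewrite !mxE; cbn [nth nat_of_ord i0 i1 i2];
rewrite ?mxE; cbn [nth nat_of_ord i0 i1 i2]; by rewrite !(embD, embM, embN).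
Qed.

Lemma emb_herm x y : emb (vec_herm x y) = herm (embv x) (embv y).
Proof.
case: x => x0 x1 x2; case: y => y0 y1 y2.
rewrite hermE; cbn [embv vec_herm]; rewrite !mxE; cbn [nth nat_of_ord i0 i1 i2].
rewrite !(embD, embM, emb_conj) emb3; ring.
Qed.

Lemma emb_conic x : emb (vec_conic x) = conic_value (embv x).
Proof.
case: x => x0 x1 x2; rewrite /conic_value; cbn [embv vec_conic].
rewrite !mxE; cbn [nth nat_of_ord i0 i1 i2].
by rewrite !(embD, embM, embN) expr2.
Qed.

Lemma embv_eq0 x : (embv x == 0) = vec_eq x vec_0.
Proof.
case: x => a b c /=; rewrite !emb_eq emb0; apply/eqP/and3P => [/rowP x0|[/eqP a0 /eqP b0 /eqP c0]].
  by have := (x0 i0, x0 i1, x0 i2); rewrite !mxE /= => -[[-> ->] ->].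
by apply: row3P; rewrite !mxE.
Qed.

(** Hermitian symmetry needs x^25 = x, hence the restriction to vectors over F_25. *)
Lemma herm_embv_conj x y : herm (embv x) (embv y) = herm (embv y) (embv x) ^+ 5.
Proof.
case: x => a b c; case: y => d e f; rewrite !hermE !mxE; cbn [nth nat_of_ord i0 i1 i2].
have -> (u v w : k) : (u - v + w) ^+ 5 = u ^+ 5 - v ^+ 5 + w ^+ 5.
  by rewrite !(pow5D char5) (_ : (- v) ^+ 5 = - v ^+ 5); last by ring.
have two5 : 2%:R ^+ 5 = 2%:R :> k by exact: pFrobenius_aut_nat char5 2.
have powM (u v : k) : (u * v ^+ 5) ^+ 5 = u ^+ 5 * v ^+ 25.
  by rewrite exprMn -exprM.
have pow2M (u : k) : (2%:R * u) ^+ 5 = 2%:R * u ^+ 5 by rewrite exprMn two5.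
by rewrite !powM !pow2M !emb_pow25; ring.
Qed.

Lemma embm_unitary g : mat_unitary g <-> unitary (embm g).
Proof.
case: g => u v w; have eE x y z : f25_eq (vec_herm x y) z = (herm (embv x) (embv y) == emb z).
  by rewrite emb_eq emb_herm.
have e0 x y : f25_is0 (vec_herm x y) = (herm (embv x) (embv y) == 0).
  by rewrite -emb_is0 emb_herm.
rewrite /mat_unitary !e0 !eE emb1 emb3; split.
  case/and5P => /eqP uu /eqP uv /eqP uw /eqP vv /andP[/eqP vw /eqP ww].
  have vu : herm (embv v) (embv u) = 0 by rewrite herm_embv_conj uv expr0n.
  have wu : herm (embv w) (embv u) = 1 by rewrite herm_embv_conj uw expr1n.
  have wv : herm (embv w) (embv v) = 0 by rewrite herm_embv_conj vw expr0n.
  apply/unitary_herm => i j; rewrite !row_embm.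
  by case: (ord3P i) (ord3P j) => -> [] ->; rewrite !mxE /= ?mxE.
move/unitary_herm => gE; have := (gE i0 i0, gE i0 i1, gE i0 i2, gE i1 i1, gE i1 i2, gE i2 i2).
rewrite !row_embm !mxE /= ?mxE /= => -[[[[[-> ->] ->] ->] ->] ->].
by rewrite !eqxx.
Qed.

Lemma embm_inv g : mat_unitary g -> embm (mat_inv g) = invmx (embm g).
Proof.
move=> /embm_unitary gu; have gU := unitary_unit char5 gu.
have invE : embm (mat_inv g) *m gram k = gram k *m frob_adj (embm g).
  case: g {gu gU} => [[a b c] [d e f] [p q r]].
  cbn [mat_inv]; apply/matrixP => i j; rewrite !mxE !sum3 !mxE.
  cbn [embm embv]; rewrite !(embM, emb_conj, emb2, emb3).
  have n4 x : 2%:R * x * - 2%:R = x :> k.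
    transitivity (x - 5%:R * x); first by ring.
    by rewrite (nat5 char5) mul0r subr0.
  by case: (ord3P i) (ord3P j) => -> [] ->; rewrite !mxE /= ?mxE /=;
     rewrite ?(mulr0, mul0r, mulr1, mul1r, addr0, add0r) ?n4 //; ring.
have : embm g *m (embm (mat_inv g) *m gram k) = gram k by rewrite invE mulmxA.
move/(congr1 (mulmx (invmx (embm g)))); rewrite mulKmx // => e.
have hU := gram_unit char5; rewrite -(mulmxK hU (embm _)) e.
by rewrite mulmxK.
Qed.

(** Unitary entries satisfy x^25 = x; this is what lets finite checks speak about all unitary frames
    over [k]. *)
Lemma embm_surj (h : 'M[k]_3) : unitary h -> exists2 g, h = embm g & mat_unitary g.
Proof.
move=> hu; have /choice[G GE] : forall ij, exists a, h ij.1 ij.2 = emb a.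
  by move=> [i j]; apply: emb_surj; exact: unitary_pow25.
pose r i := Vec (G (i, i0)) (G (i, i1)) (G (i, i2)).
have hE : h = embm (Mat (r i0) (r i1) (r i2)).
  apply/matrixP => i j; rewrite (GE (i, j)) /=.
  by case: (ord3P i) (ord3P j) => -> [] ->; rewrite !mxE /= ?mxE.
by exists (Mat (r i0) (r i1) (r i2)) => //; apply/embm_unitary; rewrite -hE.
Qed.

Lemma conic_value_quartic g t : conic_value (conic_pt (Some t) *m embm g) =
  \sum_(i < 5) emb (nth f25_0 (quartic g) i) * t ^+ i.
Proof.
have sum5 (G : nat -> k) : \sum_(i < 5) G i * t ^+ i =
    G 0%N + G 1%N * t + G 2 * t ^+ 2 + G 3 * t ^+ 3 + G 4 * t ^+ 4.
  by rewrite !big_ord_recr big_ord0 /= add0r expr0 mulr1 expr1.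
rewrite (sum5 (fun i => emb (nth f25_0 (quartic g) i))).
case: g => [[a b c] [d e f] [p q r]].
rewrite /conic_value !mxE !sum3 !mxE; cbn [quartic embm embv nth nat_of_ord i0 i1 i2].
rewrite ?mxE; cbn [nth nat_of_ord i0 i1 i2].
rewrite !(embD, embM, embN, emb2); ring.
Qed.

Lemma conic_value_quartic_inf g :
  conic_value (conic_pt None *m embm g) = emb (nth f25_0 (quartic g) 4).
Proof.
case: g => [[a b c] [d e f] [p q r]].
rewrite /conic_value !mxE !sum3 !mxE; cbn [quartic embm embv nth nat_of_ord i0 i1 i2].
rewrite ?mxE; cbn [nth nat_of_ord i0 i1 i2].
rewrite !(embD, embM, embN, emb2); ring.
Qed.

Lemma size_quartic g : size (quartic g) = 5.
Proof. by case: g => [[? ? ?] [? ? ?] [? ? ?]]. Qed.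

Lemma same_conicP g :
  same_conic g <-> forall p : option k, conic_value (conic_pt p *m embm g) = 0.
Proof.
split=> [/allP q0 p|p0].
  have {}q0 i : (i < 5)%N -> emb (nth f25_0 (quartic g) i) = 0.
    by move=> i5; apply/eqP; rewrite emb_is0 q0 // mem_nth // size_quartic.
  case: p => [t|]; last by rewrite conic_value_quartic_inf q0.
  by rewrite conic_value_quartic big1 // => i _; rewrite q0 ?mul0r.
pose q := \poly_(i < 5) emb (nth f25_0 (quartic g) i).
have q0 : q = 0.
  by apply: poly_eq0_horner => t; rewrite horner_poly -conic_value_quartic p0.
apply/(all_nthP f25_0) => i; rewrite size_quartic => i5; rewrite -emb_is0.
by have /polyP/(_ i) := q0; rewrite coef_poly i5 coef0 => ->.
Qed.

Lemma embv_pt i : embv (pt i) = P1F5_pt k i.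
Proof.
have e a : emb (F25 a A0) = emb5 a by rewrite /= {2}/emb5 /= mul0r addr0.
have ptE a : embv (Vec f25_1 (F25 a A0) (F25 (f5_mul a a) A0)) = conic_pt (Some (emb5 a)).
  by rewrite embv_vec3 emb1 !e emb5M.
have inf : embv (Vec f25_0 f25_0 f25_1) = conic_pt None.
  by rewrite embv_vec3 emb0 emb1.
case: i => [|[|[|[|[|[|i]]]]]]; rewrite /pt /P1F5_pt; cbn [nth map f5_all F5 iota];
rewrite ?nth_nil ?ptE ?inf //.
by rewrite nth_default.
Qed.

Lemma count_sharedE g : count_shared g = shared (embm g).
Proof.
apply: eq_count => -[i j]; rewrite /shares /shared_secant; congr (_ < _)%N.
apply: eq_count => r.
by rewrite -emb_is0 emb_dot embv_mul embv_cross !embv_pt.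
Qed.

End Embedding.

Lemma poly_eq0_roots (R : idomainType) (q : {poly R}) (s : seq R) : uniq s ->
  (size q <= size s)%N -> (forall t, t \in s -> q.[t] = 0) -> q = 0.
Proof.
move=> us qs s0; apply/eqP/negPn/negP => q0.
have /(max_poly_roots q0)/(_ us) : all (root q) s by apply/allP => t /s0/eqP.
by rewrite ltnNge qs.
Qed.

Section BiquadraticForms.
Variable k : closedFieldType.
Hypothesis two_neq0 : 2%:R != 0 :> k.

Definition biquadratic (a b c : k) (p : option k) : k :=
  if p is Some t then a + b * t ^+ 2 + c * t ^+ 4 else c.

Lemma exists_sqrt (a : k) : exists t, t ^+ 2 = a.
Proof.
have /closed_rootP[t] : size ('X^2 - a%:P) != 1%N by rewrite size_XnsubC.
by rewrite /root !hornerE subr_eq0 => /eqP; exists t.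
Qed.

(** In each degenerate case some polynomial of too small a degree vanishes at all finite roots: a +
    b t^2 when infinity is a root, b t + c t^3 when a = 0, and b + 2 c t^2 when the discriminant is
    0, since its square is then 4 c times the quartic. Conversely two square roots give the four
    roots. *)
Lemma biquadratic_four_points (a b c : k) :
  (exists ps, [/\ uniq ps, size ps = 4%N &
     forall p, p \in ps <-> biquadratic a b c p = 0]) <->
  [/\ a != 0, c != 0 & b * b - 4%:R * (a * c) != 0].
Proof.
split=> [[ps [ups sps psE]]|[a0 c0 d0]].
  have un : uniq (pmap id ps) by apply: (@pmap_uniq _ _ id Some) => // -[].
  have mem t : (t \in pmap id ps) = (Some t \in ps).
    by rewrite mem_pmap map_id.
  have sz : size (pmap id ps) = (4 - (None \in ps))%N.
    rewrite size_pmap.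
    have -> : (None \in ps : nat) = count (fun p => p == None) ps by rewrite count_uniq_mem.
    rewrite -sps -(count_predC (fun p => p == None) ps) addKn.
    by apply: eq_count => -[].
  have [t0 t0n] : exists t, Some t \notin ps.
    by have [t tn] := exists_notin (pmap id ps); exists t; rewrite -mem.
  have root0 (q : {poly k}) : (size q <= 4 - (None \in ps))%N ->
      (forall t, biquadratic a b c (Some t) = 0 -> q.[t] = 0) -> q = 0.
    rewrite -sz => sq q0; apply: (poly_eq0_roots un sq) => t.
    by rewrite mem => /psE; exact: q0.
  have c0 : c != 0.
    apply/eqP => c0; have nps : None \in ps by apply/psE.
    have q0 : Poly [:: a; 0; b] = 0.
      apply: root0 => [|t]; first by rewrite nps size_Poly.
      by rewrite horner_Poly /= c0 => t_0; rewrite -[RHS]t_0; ring.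
    have : (Poly [:: a; 0; b]).[t0] = 0 by rewrite q0 horner0.
    rewrite horner_Poly /= => t00; move/negP: t0n; apply; apply/psE.
    by rewrite /= c0 -[RHS]t00; ring.
  have nps : None \in ps = false by apply/negP => /psE/eqP; apply/negP.
  rewrite nps subn0 in root0.
  split=> //.
    apply/eqP => a0.
    have q0 : Poly [:: 0; b; 0; c] = 0.
      apply: root0 => [|t]; first exact: size_Poly.
      rewrite horner_Poly /= a0 => /eqP.
      have -> : 0 + b * t ^+ 2 + c * t ^+ 4 =
        t * ((((0 * t + c) * t + 0) * t + b) * t + 0) by ring.
      rewrite mulf_eq0 => /orP[/eqP ->|/eqP //]; ring.
    by have /polyP/(_ 3) := q0; rewrite coef_Poly coef0 /=; apply/eqP.
  apply/eqP => d0.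
  have q0 : Poly [:: b; 0; 2%:R * c] = 0.
    apply: root0 => [|t]; first by apply: leq_trans (size_Poly _) _.
    rewrite horner_Poly /= => t_0; set v := (v in v = 0).
    have : v ^+ 2 = 4%:R * c * (a + b * t ^+ 2 + c * t ^+ 4) + (b * b - 4%:R * (a * c)).
      by rewrite /v; ring.
    by rewrite t_0 d0 mulr0 addr0 => /eqP; rewrite expf_eq0 => /eqP.
  have /polyP/(_ 2%N) := q0; rewrite coef_Poly coef0 /= => /eqP.
  by rewrite mulf_eq0 (negPf c0) (negPf two_neq0).
have [s sE] := exists_sqrt (b * b - 4%:R * (a * c)).
have [t1 t1E] := exists_sqrt ((- b + s) / (2%:R * c)).
have [t2 t2E] := exists_sqrt ((- b - s) / (2%:R * c)).
have c20 : 2%:R * c != 0 by rewrite mulf_neq0.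
have s0 : s != 0 by apply: contra d0 => /eqP s0; rewrite -sE s0 expr0n.
have fact t : biquadratic a b c (Some t) = c * ((t - t1) * (t + t1) * ((t - t2) * (t + t2))).
  have -> : (t - t1) * (t + t1) * ((t - t2) * (t + t2)) = (t ^+ 2 - t1 ^+ 2) * (t ^+ 2 - t2 ^+ 2) by ring.
  rewrite t1E t2E /=.
  have := divff c20; set d := (2%:R * c)^-1 => cd.
  have -> : c * ((t ^+ 2 - (- b + s) * d) * (t ^+ 2 - (- b - s) * d)) =
    c * t ^+ 4 + b * t ^+ 2 * (2%:R * c * d) + c * (b * b - s ^+ 2) * d ^+ 2 by ring.
  rewrite cd sE mulr1.
  have -> : c * (b * b - (b * b - 4%:R * (a * c))) * d ^+ 2 = a * (2%:R * c * d) ^+ 2 by ring.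
  by rewrite cd expr1n mulr1; ring.
have t12 : t1 ^+ 2 - t2 ^+ 2 != 0.
  rewrite t1E t2E -mulrBl (_ : - b + s - (- b - s) = 2%:R * s); last by ring.
  by rewrite !mulf_neq0 // invr_neq0.
have a0E : a = c * (t1 ^+ 2 * t2 ^+ 2).
  by transitivity (biquadratic a b c (Some 0)); [rewrite /=; ring | rewrite fact; ring].
have t10 : t1 != 0 by apply: contra a0 => /eqP t0; rewrite a0E t0; apply/eqP; ring.
have t20 : t2 != 0 by apply: contra a0 => /eqP t0; rewrite a0E t0; apply/eqP; ring.
have neqN (t : k) : t != 0 -> t != - t.
  by move=> tn0; rewrite -subr_eq0 (_ : t - - t = 2%:R * t) ?mulf_neq0 //; ring.
have [t12' t12''] : t1 != t2 /\ t1 != - t2.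
  by split; apply: contra t12 => /eqP ->; apply/eqP; ring.
exists (map Some [:: t1; - t1; t2; - t2]); split=> //.
  rewrite (map_inj_uniq Some_inj) /= !inE !negb_or !eqr_opp !neqN // t12' t12''.
  by rewrite eqr_oppLR t12'' .
case=> [t|]; last by rewrite /=; split=> // c0'; rewrite c0' eqxx in c0.
rewrite (mem_map Some_inj) fact !inE.
have -> : [|| t == t1, t == - t1, t == t2 | t == - t2] =
  (c * ((t - t1) * (t + t1) * ((t - t2) * (t + t2))) == 0).
  rewrite !mulf_eq0 (negPf c0) /= !subr_eq0 !addr_eq0.
  by rewrite !orbA.
by split=> /eqP.
Qed.

End BiquadraticForms.

(** * The neighbours of the base conic *)

Section Neighbours.
Variable k : closedFieldType.
Hypothesis char5 : 5%N \in [pchar k].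
Variables (Gam : plane_curve k 6) (E : 'M[k]_3) (c : k).
Hypothesis E_unit : E \in unitmx.
Hypothesis c_neq0 : c != 0.
Hypothesis GamE : equation Gam = c *: herm (coordinates E) (coordinates E).
Variable rt2 : k.
Hypothesis rt2_sq : rt2 ^+ 2 = 2%:R.
Implicit Types (g h u w : 'M[k]_3).

Local Notation V := (frame_conic E).
Local Notation emb := (emb rt2).
Local Notation embv := (embv rt2).
Local Notation embm := (embm rt2).
Local Notation adj := (conic_adjacent Gam).
Local Notation embE := (embD char5, embN char5, embM char5 rt2_sq,
  emb_conj char5 rt2_sq, emb0 rt2, emb1 rt2, emb2 rt2, emb3 char5 rt2).
Local Notation unitU := (unitary_unit char5).

Lemma frame_conic_mulr g h u : unitary g -> unitary h -> unitary u ->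
  V g = V h -> V (g *m u) = V (h *m u).
Proof.
move=> gu hu uu; have wU : g *m invmx h \in unitmx.
  by rewrite unitmx_mul unitmx_inv !unitU.
have gE : g = g *m invmx h *m h by rewrite mulmxKV ?unitU.
rewrite [in V g]gE => /(frame_conic_eq E_unit (unitU hu) wU) w0.
rewrite [in LHS]gE -mulmxA; apply/frame_conic_eq => //.
by rewrite unitmx_mul !unitU.
Qed.

(** The quotient [h g^-1], which decides adjacency, is unchanged by a common right factor. *)
Lemma conic_adjacent_mulr g h u : unitary g -> unitary h -> unitary u ->
  adj (V g) (V h) -> adj (V (g *m u)) (V (h *m u)).
Proof.
move=> gu hu uu; have wu : unitary (h *m invmx g).
  exact: unitaryM hu (unitary_inv char5 gu).
have hE : h = h *m invmx g *m g by rewrite mulmxKV ?unitU.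
rewrite [in V h]hE => /(conic_adjacentE char5 E_unit c_neq0 GamE gu wu) a.
rewrite [in V (h *m u)]hE -[_ *m g *m u]mulmxA.
exact/(conic_adjacentE char5 E_unit c_neq0 GamE (unitaryM char5 gu uu) wu).
Qed.

Lemma same_framesP a b : mat_unitary a -> mat_unitary b ->
  same_frames a b <-> V (embm a) = V (embm b).
Proof.
move=> /[dup] aM /(embm_unitary char5 rt2_sq) au /[dup] bM /(embm_unitary char5 rt2_sq) bu.
have wE : embm (mat_mul a (mat_inv b)) = embm a *m invmx (embm b).
  by rewrite (embm_mul char5 rt2_sq) (embm_inv char5 rt2_sq).
have wU : embm a *m invmx (embm b) \in unitmx by rewrite unitmx_mul unitmx_inv !unitU.
have S := same_conicP char5 rt2_sq (mat_mul a (mat_inv b)).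
have F := frame_conic_eq E_unit (unitU bu) wU.
rewrite wE in S; rewrite mulmxKV ?unitU // in F.
by split=> [/S/F|/F/S].
Qed.

Lemma frame_conic_same a g : mat_unitary a -> same_conic a -> g \in unitmx ->
  V (embm a *m g) = V g.
Proof.
move=> /(embm_unitary char5 rt2_sq) au /(same_conicP char5 rt2_sq) a0 gU.
exact/(frame_conic_eq E_unit gU (unitU au)).
Qed.

Lemma separable_quarticP a :
  f25_is0 (nth f25_0 (quartic a) 1) -> f25_is0 (nth f25_0 (quartic a) 3) ->
  separable_quartic a <-> four_points (embm a).
Proof.
move=> q1 q3; have two0 : 2%:R != 0 :> k by rewrite -(dvdn_pcharf char5).
pose q i := emb (nth f25_0 (quartic a) i).
have val p : conic_value (conic_pt p *m embm a) = biquadratic (q 0%N) (q 2%N) (q 4%N) p.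
  case: p => [t|]; last exact: conic_value_quartic_inf.
  rewrite conic_value_quartic // !big_ord_recr big_ord0 /= /q.
  move: q1 q3; rewrite -!(emb_is0 char5 rt2_sq) => /eqP -> /eqP ->.
  by ring.
have P := biquadratic_four_points two0 (q 0%N) (q 2%N) (q 4%N).
have -> : separable_quartic a =
    [&& q 0%N != 0, q 4%N != 0 & q 2%N * q 2%N - 4%:R * (q 0%N * q 4%N) != 0].
  rewrite /q /separable_quartic; have := size_quartic a.
  case: (quartic a) => [|x0 [|x1 [|x2 [|x3 [|x4 [|? ?]]]]]] // _; cbn [nth].
  rewrite -!(emb_is0 char5 rt2_sq) !embE.
  by rewrite -natrM.
have F : four_points (embm a) <->
    exists ps, [/\ uniq ps, size ps = 4%N &
      forall p, p \in ps <-> biquadratic (q 0%N) (q 2%N) (q 4%N) p = 0].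
  by split=> -[ps [ups sps psE]]; exists ps; split=> // p; rewrite psE val.
by split=> [/and3P/P/F|/F/P/and3P].
Qed.

Local Notation K n := (embm (component_frame n)).
Local Notation embU := (embm_unitary char5 rt2_sq).

Lemma component_frame_unitary n : mat_unitary (component_frame n).
Proof.
have [_ /(all_nthP mat_1) cf] := andP component_framesP.
have [n21|n21] := ltnP n 21; first exact: cf.
by rewrite /component_frame nth_default.
Qed.

Lemma vec_parallelP x y : vec_parallel x y -> proportional (embv x) (embv y).
Proof.
case/and3P; rewrite -!(embv_eq0 char5 rt2_sq) (embv_cross char5 rt2_sq) => x0 y0 /eqP.
exact: cross3_eq0.
Qed.

Lemma sl2_frameP i j (g := sl2_frame i j) : (i < 6)%N -> (j < 6)%N -> i != j ->
  [/\ mat_unitary g, same_conic g,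
      proportional (row i0 (embm g)) (P1F5_pt k i),
      proportional (row i2 (embm g)) (P1F5_pt k j) &
      proportional (row i1 (invmx (embm g))^T) (secant k (i, j))].
Proof.
move=> i6 j6 ij; have /allP/(_ i) := sl2_framesP; rewrite mem_iota => /(_ i6).
move=> /allP/(_ j); rewrite mem_iota => /(_ j6); rewrite (negPf ij) -/g /=.
have gi := @embm_inv _ char5 _ rt2_sq g.
move: gi; rewrite /g; move: (sl2_frame i j) => {}g gi.
case: (mat_inv g) gi => [[a b c'] [d e f] [p q r]].
case: g => u v w gi; case/and5P => gM gS up wp sp; split=> //.
- by rewrite row_embm -(embv_pt char5 rt2); exact: vec_parallelP.
- by rewrite row_embm -(embv_pt char5 rt2); exact: vec_parallelP.
rewrite /secant -!(embv_pt char5 rt2) -(embv_cross char5 rt2_sq) -(gi gM).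
have -> : row i1 (embm (Mat (Vec a b c') (Vec d e f) (Vec p q r)))^T = embv (Vec b e q).
  by apply: row3P; rewrite !mxE /= ?mxE.
exact: vec_parallelP.
Qed.

Lemma unitary_secant_frame (a c' d e f p r : f25) :
  mat_unitary (Mat (Vec a f25_0 c') (Vec d e f) (Vec p f25_0 r)) ->
  [/\ d = f25_0, f = f25_0 &
      separable_quartic (secant_frame (a, c') e (p, r)) ->
      count_shared (secant_frame (a, c') e (p, r)) == 3%N ->
      is_neighbour (secant_frame (a, c') e (p, r))].
Proof.
have n2 : - 2%:R != 0 :> k by rewrite oppr_eq0 -(dvdn_pcharf char5).
rewrite /mat_unitary => /and5P[uu uv uw vv /andP[vw ww]].
have iso x y : f25_is0 (vec_herm (Vec x f25_0 y) (Vec x f25_0 y)) ->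
    (x, y) \in isotropic_pairs.
  move=> x0; rewrite mem_filter; apply/andP; split.
    move: x0; cbn [vec_herm fst snd]; rewrite -!(emb_is0 char5 rt2_sq) !embE => /eqP <-.
    by apply/eqP; ring.
  by apply/allpairsP; exists (x, y); rewrite !mem_f25_all.
have := allP secant_framesP _ (iso _ _ uu) => /allP/(_ _ (iso _ _ ww)).
cbn [fst snd]; rewrite ifT; last first.
  move: uw; cbn [vec_herm]; rewrite !(emb_eq char5 rt2_sq) !embE => /eqP <-.
  by apply/eqP; ring.
rewrite -(emb_is0 char5 rt2_sq) !embE => /andP[det0 /allP/(_ e (mem_f25_all e)) chk].
have vu : emb (vec_herm (Vec d e f) (Vec a f25_0 c')) = 0.
  rewrite (emb_herm char5 rt2_sq) (herm_embv_conj char5 rt2_sq) -(emb_herm char5 rt2_sq).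
  by move: uv; rewrite -(emb_is0 char5 rt2_sq) => /eqP ->; rewrite expr0n.
move: vu vw; rewrite -!(emb_is0 char5 rt2_sq); cbn [vec_herm]; rewrite !embE.
rewrite (expr0n _ 5) !mulr0 !add0r => vu /eqP vw.
(* Orthogonality to the outer rows gives two linear equations in [d] and [f], solved by Cramer's
   rule. *)
have [d0 f0] : d = f25_0 /\ f = f25_0.
  split; apply: (emb_inj char5 rt2_sq); rewrite emb0; apply/eqP.
    have : emb d * (emb c' ^+ 5 * emb p ^+ 5 - emb a ^+ 5 * emb r ^+ 5) == 0.
      apply/eqP; transitivity ((emb d * emb c' ^+ 5 + emb f * emb a ^+ 5) * emb p ^+ 5 -
        (emb d * emb r ^+ 5 + emb f * emb p ^+ 5) * emb a ^+ 5); first by ring.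
      by rewrite vu vw !mul0r subr0.
    by rewrite mulf_eq0 (negPf det0) orbF.
  have : emb f * (emb c' ^+ 5 * emb p ^+ 5 - emb a ^+ 5 * emb r ^+ 5) == 0.
    apply/eqP; transitivity ((emb d * emb r ^+ 5 + emb f * emb p ^+ 5) * emb c' ^+ 5 -
      (emb d * emb c' ^+ 5 + emb f * emb a ^+ 5) * emb r ^+ 5); first by ring.
    by rewrite vu vw !mul0r subr0.
  by rewrite mulf_eq0 (negPf det0) orbF.
move: vv; rewrite d0 f0; cbn [vec_herm].
rewrite !(emb_eq char5 rt2_sq) !embE !mul0r add0r addr0 -[X in _ == X]mulr1.
move=> /eqP/(mulfI n2) ee; split=> // gs g3.
by move: chk; rewrite (emb_eq char5 rt2_sq) !embE ee eqxx gs g3.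
Qed.

Lemma secant_frame_neighbour h : unitary h -> h i0 i1 = 0 -> h i2 i1 = 0 ->
  four_points h -> shared h = 3%N ->
  exists2 n, n \in neighbour_indices & V h = V (K n).
Proof.
move=> hu h01 h21 h4 h3.
have [W hW WM] := embm_surj char5 rt2_sq hu; rewrite hW in hu h01 h21 h4 h3.
case: W WM hW hu h01 h21 h4 h3 => [[a b c'] [d e f] [p q r]] WM hW hu h01 h21 h4 h3.
have b0 : b = f25_0.
  by apply: (emb_inj char5 rt2_sq); rewrite emb0 -h01 !mxE /= ?mxE.
have q0 : q = f25_0.
  by apply: (emb_inj char5 rt2_sq); rewrite emb0 -h21 !mxE /= ?mxE.
rewrite {}b0 {}q0 in WM hW h4 h3 hu.
have [d0 f0 nb] := unitary_secant_frame WM; rewrite {}d0 {}f0 in WM hW h4 h3 hu.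
have q1 : f25_is0 (nth f25_0 (quartic (secant_frame (a, c') e (p, r))) 1).
  rewrite -(emb_is0 char5 rt2_sq); cbn [secant_frame quartic nth fst snd].
  by rewrite !embE; apply/eqP; ring.
have q3 : f25_is0 (nth f25_0 (quartic (secant_frame (a, c') e (p, r))) 3).
  rewrite -(emb_is0 char5 rt2_sq); cbn [secant_frame quartic nth fst snd].
  by rewrite !embE; apply/eqP; ring.
have sep := proj2 (separable_quarticP q1 q3) h4.
have : is_neighbour (secant_frame (a, c') e (p, r)).
  by apply: nb => //; rewrite (count_sharedE char5 rt2_sq); apply/eqP.
rewrite /is_neighbour => /hasP[n nn nE].
exists n => //; rewrite hW; apply/same_framesP => //.
exact: component_frame_unitary.
Qed.

Lemma mat_mul_unitary a b : mat_unitary a -> mat_unitary b -> mat_unitary (mat_mul a b).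
Proof.
move=> /embU au /embU bu; apply/embU; rewrite (embm_mul char5 rt2_sq).
exact: unitaryM.
Qed.

Lemma frame_conic_mat_mul a b d : mat_unitary a -> mat_unitary b -> mat_unitary d ->
  same_frames (mat_mul a b) d -> V (embm a *m embm b) = V (embm d).
Proof.
move=> aM bM dM; rewrite -(embm_mul char5 rt2_sq).
exact: (proj1 (same_framesP (mat_mul_unitary aM bM) dM)).
Qed.

(* A shared secant of the two conics is moved to the line [x1 = 0], on which both
   then contain the points 0 and 2 of their frames. *)
Lemma neighbour_of_one g : unitary g -> adj (V 1%:M) (V g) ->
  exists2 n, n \in neighbour_indices & V g = V (K n).
Proof.
have u1 : unitary (1%:M : 'M[k]_3) := unitary1 char5.
move=> gu gA; have gA' : adj (V 1%:M) (V (g *m 1%:M)) by rewrite mulmx1.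
have [_ _ g3] := proj1 (conic_adjacentE char5 E_unit c_neq0 GamE u1 gu) gA'.
have /hasP[[i j]] : has (shared_secant g) pairs6 by rewrite has_count -/(shared g) g3.
rewrite mem_pairs6 => /andP[ij j6].
move=> /(count_gt1P _ (iota_uniq 0 6))[r [s []]].
rewrite !mem_iota /= => r6 s6 rs /eqP r0 /eqP s0.
have i6 := ltn_trans ij j6; have {}ij : i != j by rewrite ltn_eqF.
have [gamM gamS _ _ gamT] := sl2_frameP i6 j6 ij.
have [delM delS delr dels _] := sl2_frameP r6 s6 rs.
set gam := embm _ in gamT; set del := embm _ in delr dels.
have gamu : unitary gam by apply/embU.
have delu : unitary del by apply/embU.
have gamu' := unitary_inv char5 gamu.
have gMu : unitary (g *m invmx gam) by apply: unitaryM.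
have hu : unitary (del *m (g *m invmx gam)) by apply: unitaryM.
have Vh : V (del *m (g *m invmx gam)) = V (g *m invmx gam).
  by apply: frame_conic_same; rewrite ?unitU.
have V1 : V (1%:M *m invmx gam) = V 1%:M.
  rewrite mul1mx -[in RHS](mulmxV (unitU gamu)); apply/esym/frame_conic_same => //.
  exact: unitU.
have hA : adj (V 1%:M) (V (del *m (g *m invmx gam) *m 1%:M)).
  by rewrite mulmx1 Vh -V1; apply: conic_adjacent_mulr.
have [_ h4 h3] := proj1 (conic_adjacentE char5 E_unit c_neq0 GamE u1 hu) hA.
have entry x y : proportional (row x del) y -> dot3 (y *m g) (secant k (i, j)) = 0 ->
    (del *m (g *m invmx gam)) x i1 = 0.
  case=> a _ rowE y0; case: gamT => b _ colE.
  transitivity (dot3 (row x del *m g) (row i1 (invmx gam)^T)).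
    by rewrite mulmxA mxE sum3 -row_mul /dot3 !mxE.
  by rewrite rowE colE -scalemxAl dot3Zl dot3Zr y0 !mulr0.
have [||n nn hE] := secant_frame_neighbour hu _ _ h4 h3.
- exact: entry delr r0.
- exact: entry dels s0.
(* The conic of [g] is obtained from the normalised one by applying [gam] again, which permutes the
   neighbours. *)
have := neighbour_movesP; rewrite /check_neighbour_moves => /allP/(_ n nn)/allP/(_ i).
rewrite mem_iota => /(_ i6)/allP/(_ j); rewrite mem_iota => /(_ j6).
rewrite (negPf ij) orFb /is_neighbour => /hasP[m mn].
have nM := component_frame_unitary n; have mM := component_frame_unitary m.
move=> /(frame_conic_mat_mul nM gamM mM) mE; exists m => //; rewrite -mE -/gam.
rewrite -{1}(mulmxKV (unitU gamu) g); apply: frame_conic_mulr => //.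
  exact/embU.
by rewrite -Vh.
Qed.

Lemma adjacent_oneP g : unitary g ->
  adj (V 1%:M) (V g) <-> exists2 n, n \in neighbour_indices & V g = V (K n).
Proof.
have u1 : unitary (1%:M : 'M[k]_3) := unitary1 char5.
move=> gu; split=> [|[n nn ->]]; first exact: neighbour_of_one.
(* A move preserving the base conic carries one of the two representatives to the given neighbour,
   so only those need a direct verification. *)
have [base /allP/(_ n nn)] := andP base_neighboursP.
case/hasP => m mb /hasP[i]; rewrite mem_iota => i6 /hasP[j]; rewrite mem_iota => j6.
have nM := component_frame_unitary n; have mM := component_frame_unitary m.
case/andP=> ij; have [gamM gamS _ _ _] := sl2_frameP i6 j6 ij.
move=> /(proj1 (same_framesP nM (mat_mul_unitary mM gamM))) ->.
rewrite (embm_mul char5 rt2_sq).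
have gamu : unitary (embm (sl2_frame i j)) by apply/embU.
have -> : V 1%:M = V (1%:M *m embm (sl2_frame i j)).
  rewrite mul1mx -[embm _ in RHS]mulmx1; apply/esym/frame_conic_same => //.
  exact: unitmx1.
have mu : unitary (K m) by apply/embU.
apply: conic_adjacent_mulr => //; rewrite -(mulmx1 (K m)).
apply/(conic_adjacentE char5 E_unit c_neq0 GamE) => //.
have /and4P[sep m3 q1 q3] := allP base m mb.
have m4 := proj1 (separable_quarticP q1 q3) sep.
split=> //; last by rewrite -(count_sharedE char5 rt2_sq); apply/eqP.
move=> all0; case: m4 => ps [_ _ psE].
have [t tn] := exists_notin (pmap id ps); move: tn; rewrite mem_pmap map_id.
by move/negP; apply; apply/psE.
Qed.
End Neighbours.

Section Graphs.
Variables (T : Type) (G : graph T).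

Lemma edge_rt_sym x y : clos_refl_trans T (edge G) x y -> clos_refl_trans T (edge G) y x.
Proof.
elim=> [u v [uG vG uv]|u|u v w _ vu _ wv]; last exact: rt_trans wv vu.
  by apply: rt_step; split=> //; apply: adjacent_sym.
exact: rt_refl.
Qed.

Lemma component_eq x y : component G x y -> component G y = component G x.
Proof.
move=> [yG xy]; apply/seteqP; split=> z [zG ?]; split=> //.
  exact: rt_trans xy _.
exact: rt_trans (edge_rt_sym xy) _.
Qed.

End Graphs.

(** * Pairs of indices as vertices of T(7) *)

Definition pair_set (p : nat * nat) : {set 'I_7} := [set inord p.1; inord p.2].

Lemma mem_index_pairs i j n : ((i, j) \in index_pairs n) = (i < j < n)%N.
Proof.
apply/allpairsPdep/andP => [[j' [i' [j'n i'j [-> ->]]]]|[ij jn]].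
  by move: j'n i'j; rewrite !mem_iota.
by exists j, i; rewrite !mem_iota.
Qed.

Lemma mem_pair_set (p : nat * nat) (x : 'I_7) : p \in index_pairs 7 ->
  (x \in pair_set p) = (val x == p.1) || (val x == p.2).
Proof.
case: p => i j; rewrite mem_index_pairs => /andP[ij j7] /=.
by rewrite !inE -!val_eqE /= !inordK // (ltn_trans ij j7).
Qed.

Lemma card_pair_set p : p \in index_pairs 7 -> #|pair_set p| = 2%N.
Proof.
case: p => i j; rewrite mem_index_pairs => /andP[ij j7].
by rewrite cards2 -val_eqE /= !inordK ?(ltn_trans ij j7) // ltn_eqF.
Qed.

Lemma pair_set_surj (A : {set 'I_7}) : #|A| = 2%N ->
  exists2 p, p \in index_pairs 7 & A = pair_set p.
Proof.
move/eqP/cards2P => [x [y [xy ->]]].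
wlog lxy : x y xy / (x < y)%N.
  move=> H; case: (ltngtP x y) => [|yx|/val_inj xyE]; first exact: H.
    by rewrite finset.setUC; apply: H; rewrite // eq_sym.
  by rewrite xyE eqxx in xy.
exists (val x, val y); first by rewrite mem_index_pairs lxy /=.
by rewrite /pair_set /= !inord_val.
Qed.

Lemma pair_set_inj p q : p \in index_pairs 7 -> q \in index_pairs 7 ->
  pair_set p = pair_set q -> p = q.
Proof.
move=> pI qI pq; have mem n : (n < 7)%N ->
    (n == p.1) || (n == p.2) = (n == q.1) || (n == q.2).
  by move=> n7; have /setP/(_ (Ordinal n7)) := pq; rewrite !mem_pair_set.
case: p q pI qI mem {pq} => [a b] [a' b']; rewrite !mem_index_pairs /=.
move=> /andP[ab b7] /andP[ab' b7'] mem.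
have := (mem _ (ltn_trans ab b7), mem _ b7); rewrite !eqxx orbT /=.
move=> [/esym/pred2P aE /esym/pred2P bE]; suff [-> ->] : a = a' /\ b = b' by [].
lia.
Qed.

Lemma pair_set_meet p q : p \in index_pairs 7 -> q \in index_pairs 7 ->
  pair_set p :&: pair_set q <> finset.set0 <->
  [|| p.1 == q.1, p.1 == q.2, p.2 == q.1 | p.2 == q.2].
Proof.
move=> pI qI; split=> [/eqP/set0Pn[x]|].
  by rewrite inE !mem_pair_set // => /andP[/pred2P[<-|<-] /orP[->|->]]; rewrite ?orbT.
move=> pq; apply/eqP/set0Pn.
have [n [n7 np nq]] : exists n, [/\ (n < 7)%N, (n == p.1) || (n == p.2) & (n == q.1) || (n == q.2)].
  case: p q pI qI pq => [a b] [a' b']; rewrite !mem_index_pairs /= => /andP[ab b7] _.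
  case/or4P => /eqP E; [exists a|exists a|exists b|exists b];
  by rewrite -?E ?eqxx ?orbT ?b7 ?(ltn_trans ab b7).
by exists (Ordinal n7); rewrite inE !mem_pair_set /= ?np ?nq.
Qed.

(** * Each component is a copy of T(7) *)

Section Components.
Variable k : closedFieldType.
Hypothesis char5 : 5%N \in [pchar k].
Variables (Gam : plane_curve k 6) (E : 'M[k]_3) (c : k).
Hypothesis E_unit : E \in unitmx.
Hypothesis c_neq0 : c != 0.
Hypothesis GamE : equation Gam = c *: herm (coordinates E) (coordinates E).
Variable rt2 : k.
Hypothesis rt2_sq : rt2 ^+ 2 = 2%:R.
Implicit Types (g h u w : 'M[k]_3).

Local Notation V := (frame_conic E).
Local Notation embm := (embm rt2).
Local Notation adj := (conic_adjacent Gam).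
Local Notation G := (conic_graph Gam).
Local Notation unitU := (unitary_unit char5).
Local Notation K n := (embm (component_frame n)).
Local Notation embU := (embm_unitary char5 rt2_sq).

Local Notation sameP := (same_framesP char5 E_unit rt2_sq).
Local Notation cfU := component_frame_unitary.
Local Notation V_mulr := (frame_conic_mulr char5 E_unit).
Local Notation adj_mulr := (conic_adjacent_mulr char5 E_unit c_neq0 GamE).

Lemma unitary_component_frame n : unitary (K n).
Proof. exact/embU/component_frame_unitary. Qed.
Let Ku := unitary_component_frame.

Lemma frame_conic_mulrI a b g : unitary a -> unitary b -> unitary g ->
  V (a *m g) = V (b *m g) -> V a = V b.
Proof.
move=> au bu gu ab; have gu' := unitary_inv char5 gu.
have := V_mulr (unitaryM char5 au gu) (unitaryM char5 bu gu) gu' ab.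
by rewrite (mulmxK (unitU gu) a) (mulmxK (unitU gu) b).
Qed.

Lemma adjacent_quotient a b : unitary a -> unitary b ->
  adj (V a) (V b) <-> adj (V 1%:M) (V (b *m invmx a)).
Proof.
move=> au bu; have au' := unitary_inv char5 au.
have u1 : unitary (1%:M : 'M[k]_3) := unitary1 char5.
split=> ab.
  by have := adj_mulr au bu au' ab; rewrite (mulmxV (unitU au)).
have := adj_mulr u1 (unitaryM char5 bu au') au ab.
by rewrite mul1mx (mulmxKV (unitU au) b).
Qed.

Lemma component_frame0 g : K 0 *m g = g.
Proof. by rewrite -[component_frame 0]/mat_1 embm_1 mul1mx. Qed.

Lemma component_frames_inj i j g : (i < 21)%N -> (j < 21)%N -> unitary g ->
  V (K i *m g) = V (K j *m g) -> i = j.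
Proof.
move=> i21 j21 gu /(frame_conic_mulrI (Ku i) (Ku j) gu) KE.
apply/eqP/negPn/negP => nij; have /allP/(_ i) := distinctP.
rewrite mem_iota => /(_ i21)/allP/(_ j); rewrite mem_iota => /(_ j21)/implyP/(_ nij).
by move/negP; apply; exact: proj2 (sameP (cfU i) (cfU j)) KE.
Qed.

Lemma mat_inv_unitary a : mat_unitary a -> mat_unitary (mat_inv a).
Proof.
move=> aM; apply/embU; rewrite (embm_inv char5 rt2_sq) //.
exact/(unitary_inv char5)/embU.
Qed.

Lemma component_adjacency i j g : (i < 21)%N -> (j < 21)%N -> unitary g ->
  adj (V (K i *m g)) (V (K j *m g)) <-> triangular_index i j.
Proof.
move=> i21 j21 gu.
have red := adjacent_quotient (unitaryM char5 (Ku i) gu) (unitaryM char5 (Ku j) gu).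
have wE : K j *m g *m invmx (K i *m g) = K j *m embm (mat_inv (component_frame i)).
  rewrite (invmxM (unitU (Ku i)) (unitU gu)) mulmxA (mulmxK (unitU gu) (K j)).
  by rewrite (embm_inv char5 rt2_sq (cfU i)).
rewrite {}wE in red.
have wu := unitaryM char5 (Ku j) (proj1 (embU _) (mat_inv_unitary (cfU i))).
have nbr := adjacent_oneP char5 E_unit c_neq0 GamE rt2_sq wu.
have /allP/(_ i) := adjacencyP; rewrite mem_iota => /(_ i21)/allP/(_ j).
rewrite mem_iota => /(_ j21)/hasP[m]; rewrite mem_iota => m21.
case/andP=> /(frame_conic_mat_mul char5 E_unit rt2_sq (cfU j) (mat_inv_unitary (cfU i)) (cfU m)) Wm /eqP <-.
rewrite {}Wm in red nbr.
split=> [/red/nbr[n nn mE]|mn]; last by apply/red/nbr; exists m.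
have n21 : (n < 21)%N by move: nn; rewrite mem_filter mem_iota => /andP[].
(* The neighbour index [n] found above must be [m] itself, since distinct listed frames have
   distinct conics. *)
have u1 : unitary (1%:M : 'M[k]_3) := unitary1 char5.
suff -> : m = n by [].
apply: (component_frames_inj m21 n21 u1).
by rewrite (mulmx1 (K m)) (mulmx1 (K n)).
Qed.

Lemma component_closed i g h : (i < 21)%N -> unitary g -> unitary h ->
  adj (V (K i *m g)) (V h) -> exists2 j, (j < 21)%N & V h = V (K j *m g).
Proof.
move=> i21 gu hu; have iu := unitaryM char5 (Ku i) gu.
have wu := unitaryM char5 hu (unitary_inv char5 iu).
move=> /(adjacent_quotient iu hu) /(adjacent_oneP char5 E_unit c_neq0 GamE rt2_sq wu)[n nn hn].
have := closedP; rewrite /check_closed => /allP/(_ i); rewrite mem_iota => /(_ i21)/allP/(_ n nn)/hasP[j]; rewrite mem_iota => j21.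
move=> /(frame_conic_mat_mul char5 E_unit rt2_sq (cfU n) (cfU i) (cfU j)) nj.
exists j => //.
have := V_mulr wu (Ku n) iu hn; rewrite (mulmxKV (unitU iu) h) => ->.
rewrite mulmxA; exact: (V_mulr (unitaryM char5 (Ku n) (Ku i)) (Ku j) gu nj).
Qed.

Lemma vertexP Q : vertices G Q <-> exists2 g, unitary g & Q = V g.
Proof.
split=> [|[g gu ->]]; first exact: (totally_tangent_unitary char5 E_unit c_neq0 GamE).
exact: (unitary_totally_tangent char5 E_unit c_neq0 GamE gu).
Qed.

(** Paths cannot leave the list, by [component_closed]; conversely every vertex of T(7) is within
    distance 2 of the first one. *)
Lemma componentP g Q : unitary g ->
  component G (V g) Q <-> exists2 i, (i < 21)%N & Q = V (K i *m g).
Proof.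
move=> gu; have KV i : vertices G (V (K i *m g)).
  by apply/vertexP; exists (K i *m g) => //; apply: unitaryM.
have KE i j : (i < 21)%N -> (j < 21)%N -> triangular_index i j ->
    clos_refl_trans _ (edge G) (V (K i *m g)) (V (K j *m g)).
  by move=> i21 j21 ij; apply: rt_step; split=> //; apply/component_adjacency.
split=> [[_ gQ]|[i i21 ->]].
  have {gQ} gQ := clos_rt_rtn1 _ _ _ _ gQ.
  elim: gQ => [|Q1 Q2 [_ /vertexP[h hu ->] a] _ [i i21 QE]].
    by exists 0%N => //; rewrite component_frame0.
  by rewrite QE in a; apply: component_closed a.
split=> //; rewrite -[in V g](component_frame0 g).
have /allP/(_ i) : all (fun i => [|| i == 0%N, triangular_index 0 i |
    has (fun m => triangular_index 0 m && triangular_index m i) (iota 0 21)]) (iota 0 21).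
  by vm_compute.
rewrite mem_iota => /(_ i21)/or3P[/eqP ->|i0|/hasP[m + /andP[m0 mi]]].
- exact: rt_refl.
- exact: KE.
rewrite mem_iota => m21; exact: rt_trans (KE 0%N m isT m21 m0) (KE m i m21 i21 mi).
Qed.

Lemma component_triangular g : unitary g ->
  graph_isomorphic (induced_subgraph G (component G (V g))) (triangular_graph 7).
Proof.
move=> gu; pose C := component G (V g).
have /choice[ix ixE] : forall Q, exists i, C Q -> (i < 21)%N /\ Q = V (K i *m g).
  move=> Q; have [CQ|nCQ] := pselect (C Q); last by exists 0%N.
  by have [i i21 QE] := proj1 (componentP Q gu) CQ; exists i.
pose p i := nth (0, 0)%N (index_pairs 7) i.
have pI i : (i < 21)%N -> p i \in index_pairs 7 by move=> i21; apply: mem_nth.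
have p_inj i j : (i < 21)%N -> (j < 21)%N -> pair_set (p i) = pair_set (p j) -> i = j.
  move=> i21 j21 /(pair_set_inj (pI i i21) (pI j j21))/eqP.
  by rewrite nth_uniq // => /eqP.
exists (fun Q => pair_set (p (ix Q))); first split.
- by move=> Q [_ /ixE[i21 _]]; apply: card_pair_set; exact: pI.
- move=> Q Q' /set_mem[_ /ixE[i21 QE]] /set_mem[_ /ixE[i21' QE']].
  by move=> /(p_inj _ _ i21 i21') ii; rewrite QE QE' ii.
- move=> A /pair_set_surj[_ /(nthP (0, 0)%N)[i i21 <-] ->].
  have Ci : C (V (K i *m g)) by apply/componentP => //; exists i.
  exists (V (K i *m g)); first by split=> //; case: Ci.
  have [j21 jE] := ixE _ Ci; congr (pair_set (p _)).
  exact: component_frames_inj (esym jE).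
move=> Q Q' [_ /ixE[i21 QE]] [_ /ixE[j21 QE']] /=.
rewrite [in adj Q]QE [in adj _ Q']QE'; apply: (iff_trans (component_adjacency i21 j21 gu)).
have meet := pair_set_meet (pI _ i21) (pI _ j21).
have neq : ix Q != ix Q' <-> pair_set (p (ix Q)) <> pair_set (p (ix Q')).
  split=> [/eqP ij /(p_inj _ _ i21 j21) //|ij].
  by apply/eqP => e; apply: ij; rewrite e.
rewrite /triangular_index -/(p (ix Q)) -/(p (ix Q')).
case: (p (ix Q)) (p (ix Q')) meet neq => [a b] [a' b'] /= meet neq.
by split=> [/andP[/neq ij /meet m]|[/neq -> /meet ->]].
Qed.

End Components.

Lemma f25_mulV x : ~~ f25_is0 x -> f25_mul x (f25_inv x) = f25_1.
Proof. by case: x => -[] []. Qed.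

Lemma f25_mul0 x : f25_mul f25_0 x = f25_0. Proof. by case: x => -[] []. Qed.
Lemma f25_mulr0 x : f25_mul x f25_0 = f25_0. Proof. by case: x => -[] []. Qed.
Lemma f25_mul1 x : f25_mul f25_1 x = x. Proof. by case: x => -[] []. Qed.
Lemma f25_mulr1 x : f25_mul x f25_1 = x. Proof. by case: x => -[] []. Qed.
Lemma f25_add0 x : f25_add f25_0 x = x. Proof. by case: x => -[] []. Qed.
Lemma f25_addr0 x : f25_add x f25_0 = x. Proof. by case: x => -[] []. Qed.

Lemma count1_index (T : Type) (x0 : T) (a : pred T) (s : seq T) : count a s = 1%N ->
  exists i, [/\ (i < size s)%N, a (nth x0 s i) &
    forall j, (j < size s)%N -> a (nth x0 s j) -> j = i].
Proof.
move=> s1; have /hasP[i] : has (fun i => a (nth x0 s i)) (iota 0 (size s)).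
  by rewrite has_count -(count_map (nth x0 s)) map_nth_iota0 // take_size s1.
rewrite mem_iota => /= iS ai; exists i; split=> // j jS aj.
apply/eqP/negPn/negP => ji.
have : (1 < count (fun i => a (nth x0 s i)) (iota 0 (size s)))%N.
  by apply/(count_gt1P _ (iota_uniq 0 (size s))); exists j, i; rewrite !mem_iota.
by rewrite -(count_map (nth x0 s)) map_nth_iota0 // take_size s1.
Qed.

(** * Conics through one tangency point and the number of components *)

Section Pencil.
Variable k : closedFieldType.
Hypothesis char5 : 5%N \in [pchar k].
Variables (Gam : plane_curve k 6) (E : 'M[k]_3) (c : k).
Hypothesis E_unit : E \in unitmx.
Hypothesis c_neq0 : c != 0.
Hypothesis GamE : equation Gam = c *: herm (coordinates E) (coordinates E).
Variable rt2 : k.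
Hypothesis rt2_sq : rt2 ^+ 2 = 2%:R.
Variable B : plane_point k.
Hypothesis baseE : proportional (frame_coord E B) (conic_pt None).
Implicit Types (g h : 'M[k]_3).

Local Notation V := (frame_conic E).
Local Notation emb := (emb rt2).
Local Notation embv := (embv rt2).
Local Notation embm := (embm rt2).
Local Notation G := (conic_graph Gam).
Local Notation embE := (embD char5, embN char5, embM char5 rt2_sq,
  emb_conj char5 rt2_sq, emb0 rt2, emb1 rt2, emb2 rt2, emb3 char5 rt2).
Local Notation unitU := (unitary_unit char5).
Local Notation K n := (embm (component_frame n)).
Local Notation embU := (embm_unitary char5 rt2_sq).
Local Notation sameP := (same_framesP char5 E_unit rt2_sq).
Local Notation cfU := component_frame_unitary.
Local Notation Ku := (unitary_component_frame char5 rt2_sq).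

Lemma on_frameP x (g : mat) : mat_unitary g ->
  on_frame x g <-> conic_value (embv x *m invmx (embm g)) = 0.
Proof.
move=> gM; rewrite /on_frame -(emb_is0 char5 rt2_sq) (emb_conic char5 rt2_sq).
rewrite (embv_mul char5 rt2_sq) (embm_inv char5 rt2_sq gM).
by split=> /eqP.
Qed.

Lemma isotropic_frame (x : vec) : embv x != 0 -> herm (embv x) (embv x) = 0 ->
  exists i, [/\ (i < 21)%N, conic_value (embv x *m invmx (K i)) = 0 &
    forall j, (j < 21)%N -> conic_value (embv x *m invmx (K j)) = 0 -> j = i].
Proof.
move=> x0 xx; suff [y [a a0 xE] y1] : exists2 y, proportional (embv x) (embv y) &
    count (on_frame y) component_frames = 1%N.
  have [i [i21 iy iu]] := count1_index mat_1 y1.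
  have sz : size component_frames = 21%N by have [/eqP] := andP component_framesP.
  rewrite sz in i21 iu.
  have val j : conic_value (embv x *m invmx (K j)) = 0 <-> on_frame y (component_frame j).
    rewrite xE -scalemxAl conic_valueZ (on_frameP _ (cfU j)).
    split=> [/eqP|->]; last by rewrite mulr0.
    by rewrite mulf_eq0 expf_eq0 (negPf a0) => /eqP.
  exists i; split=> //; first exact/val.
  by move=> j j21 /val jy; apply: iu.
have [one_inf one_fin] := andP partitionP.
case: x x0 xx => a b d x0; rewrite -(emb_herm char5 rt2_sq); cbn [vec_herm].
have n2 : - 2%:R != 0 :> k by rewrite oppr_eq0 -(dvdn_pcharf char5).
(* With last coordinate 0, isotropy kills the middle coordinate and leaves the point (1, 0, 0). *)
rewrite !embE; have [d0|d0] := eqVneq (emb d) 0.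
  rewrite d0 (expr0n _ 5) !(mulr0, mul0r) add0r addr0 => /eqP.
  rewrite mulf_eq0 (negPf n2) -exprS expf_eq0 => /andP[_ /eqP b0].
  exists (Vec f25_1 f25_0 f25_0); last exact/eqP.
  exists (emb a).
    apply: contra x0 => /eqP a0; apply/eqP.
    by apply: row3P; cbn [embv]; rewrite a0 b0 d0 !mxE.
  by apply: row3P; cbn [embv]; rewrite b0 d0 emb0 emb1 !mxE;
    cbn [nth nat_of_ord i0 i1 i2]; rewrite ?mulr1 ?mulr0.
(* The normalised coordinates stay in F_25, so the finite check applies to them. *)
have fix25 (u v : f25) : ((emb u / emb v) ^+ 25 = emb u / emb v).
  by rewrite exprMn exprVn !(emb_pow25 char5 rt2_sq).
have [a' aE] := emb_surj char5 rt2_sq (fix25 a d).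
have [b' bE] := emb_surj char5 rt2_sq (fix25 b d).
move=> xx; exists (Vec a' b' f25_1).
  exists (emb d) => //; apply: row3P; cbn [embv]; rewrite -aE -bE emb1 !mxE;
    cbn [nth nat_of_ord i0 i1 i2].
  - by rewrite mulrC divfK.
  - by rewrite mulrC divfK.
  - by rewrite mulr1.
have := allP (allP one_fin a' (mem_f25_all _)) b' (mem_f25_all _).
cbn beta zeta; rewrite ifT; first by move/eqP.
rewrite -(emb_is0 char5 rt2_sq); cbn [vec_herm]; rewrite !embE -aE -bE.
have : emb d ^+ 6 * (emb a / emb d * 1 ^+ 5 + (- 2%:R * (emb b / emb d * (emb b / emb d) ^+ 5) + 1 * (emb a / emb d) ^+ 5)) = 0.
  rewrite -[RHS]xx; set i := (emb d)^-1; have di : emb d * i = 1 by rewrite divff.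
  transitivity (emb a * emb d ^+ 5 * (emb d * i) + (- 2%:R * (emb b * emb b ^+ 5) * (emb d * i) ^+ 6
    + emb d * emb a ^+ 5 * (emb d * i) ^+ 5)); first by ring.
  by rewrite di; ring.
by move/eqP; rewrite mulf_eq0 expf_eq0 (negPf d0).
Qed.

Lemma base_conic g : unitary g -> exists i, [/\ (i < 21)%N, points (V (K i *m g)) B &
  forall j, (j < 21)%N -> points (V (K j *m g)) B -> j = i].
Proof.
move=> gu; have [h hE hM] := embm_surj char5 rt2_sq (unitary_inv char5 gu).
have hu := proj1 (embU h) hM; have hU := unitU hu.
(* The point [B] seen in the frame [g]: (0, 0, 1) times [g^-1] is the last row of a unitary matrix,
   hence isotropic and defined over F_25. *)
pose x := let: Mat _ _ w := h in w.
have xE : embv x = row i2 (invmx g) by rewrite hE row_embm /x; case: (h).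
have x0 : embv x != 0.
  by rewrite xE hE rowE; apply/eqP => /(congr1 (mulmx^~ (invmx (embm h)))) e;
    move: e; rewrite /= mulmxK // mul0mx => /rowP/(_ i2); rewrite !mxE eqxx; apply/eqP/oner_neq0.
have xx : herm (embv x) (embv x) = 0.
  by rewrite xE hE; rewrite (proj1 (unitary_herm _) hu) !mxE /= ?mxE.
have [i [i21 xi iu]] := isotropic_frame x0 xx.
have val j : points (V (K j *m g)) B <-> conic_value (embv x *m invmx (K j)) = 0.
  have U : K j *m g \in unitmx by rewrite unitmx_mul !unitU //; exact: Ku.
  have F := frame_conic_points E_unit B U.
  have [a a0 BE] := baseE.
  rewrite BE (invmxM (unitU (Ku j)) (unitU gu)) mulmxA -!scalemxAl conic_valueZ in F.
  have rE : conic_pt None *m invmx g = embv x.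
    rewrite xE rowE; congr (_ *m _); apply: row3P; by rewrite !mxE.
  rewrite {}rE in F; split=> [/F/eqP|e]; last by apply/F; rewrite e mulr0.
  by rewrite mulf_eq0 expf_eq0 (negPf a0) => /eqP.
exists i; split=> //; first exact/val.
by move=> j j21 /val; exact: iu.
Qed.

(** Pairing the first row with the other two gives [a mu^5 = 1] and [a x^5 = 2 b]; the coefficient 3
    in [borel_frame] is 1/2 modulo 5. *)
Lemma unitary_borel_frame a b d x mu :
  mat_unitary (Mat (Vec a b d) (Vec f25_0 f25_1 x) (Vec f25_0 f25_0 mu)) ->
  ~~ f25_is0 mu /\
  Mat (Vec a b d) (Vec f25_0 f25_1 x) (Vec f25_0 f25_0 mu) = borel_frame mu x d.
Proof.
case/and5P=> _ + + _ _; cbn [vec_herm].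
rewrite -(emb_is0 char5 rt2_sq) (emb_eq char5 rt2_sq) !embE.
rewrite (expr0n _ 5) expr1n !(mulr0, mulr1, addr0) => /eqP ux /eqP umu.
have mu0 : emb mu != 0.
  by apply/eqP => mu0; move: umu; rewrite mu0 expr0n mulr0 => /eqP; rewrite eq_sym oner_eq0.
have mun : ~~ f25_is0 mu by rewrite -(emb_is0 char5 rt2_sq).
split=> //; have muV : emb mu * emb (f25_inv mu) = 1.
  by rewrite -(embM char5 rt2_sq) f25_mulV // emb1.
have aE : emb a = emb (f25_inv mu) ^+ 5.
  rewrite -[LHS]mulr1 -[1 in LHS](expr1n _ 5) -muV exprMn mulrA umu mul1r //.
have bE : emb b = - 2%:R * (emb a * emb x ^+ 5).
  have -> : emb a * emb x ^+ 5 = 2%:R * emb b by apply/eqP; rewrite -subr_eq0 -mulNr ux.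
  transitivity (emb b - 5%:R * emb b); last by ring.
  by rewrite (nat5 char5) mul0r subr0.
have {}aE : a = f25_conj (f25_inv mu) by apply: (emb_inj char5 rt2_sq); rewrite embE.
rewrite /borel_frame -aE; congr (Mat (Vec _ _ _) _ _).
by apply: (emb_inj char5 rt2_sq); rewrite !embE.
Qed.

Lemma mem_pencil_frames mu s (w : f25) : mu \in borel_scales ->
  mat_unitary (borel_frame mu (f25_mul (F25 A0 s) mu) w) ->
  borel_frame mu (f25_mul (F25 A0 s) mu) w \in pencil_frames.
Proof.
move=> muS gM; rewrite mem_filter gM; apply/allpairsP; exists ((mu, s), w); split=> //.
  by apply/allpairsP; exists (mu, s); split=> //; case: (s).
exact: mem_f25_all.
Qed.

Lemma base_borel_frame g : unitary g -> points (V g) B ->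
  exists mu x (w : f25), [/\ mat_unitary (borel_frame mu x w), ~~ f25_is0 mu &
    V (embm (borel_frame mu x w)) = V g].
Proof.
move=> gu gB; have gU := unitU gu.
have n2 : - 2%:R != 0 :> k by rewrite oppr_eq0 -(dvdn_pcharf char5).
have gamB : points Gam B.
  apply/(gam_points E_unit c_neq0 GamE); have [a a0 ->] := baseE.
  by rewrite hermZ (proj2 (herm_ptP char5 None)) ?mulr0 // inE eqxx.
have [p pF pE] := proj1 (mem_tangency char5 E_unit c_neq0 GamE B gu) (conj gB gamB).
have [m m0 mE] := proportional_trans (proportional_sym pE) baseE.
(* [frame_at p] makes [B] the first row up to a scalar, and the reversal makes it the last; the
   conic is unchanged. *)
pose g1 := frame_at None *m (frame_at p *m g).
have u0 : unitary (frame_at None : 'M[k]_3) by apply: frame_at_unitary; rewrite ?inE ?eqxx.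
have g1u : unitary g1.
  by apply: unitaryM => //; apply: unitaryM => //; exact: frame_at_unitary.
have V1 : V g1 = V g.
  rewrite (frame_conic_frame_at E_unit None) ?(frame_conic_frame_at E_unit p gU) //.
  by rewrite unitmx_mul frame_at_unit.
have r2 : row i2 g1 = m *: conic_pt None.
  have r0 : row i2 (frame_at None) = delta_mx 0 i0 :> 'rV[k]_3.
    by rewrite rowK; apply: row3P; rewrite !mxE.
  by rewrite -mE /g1 row_mul r0 mulmxA -rowE row_frame_at.
clearbody g1; have hrow i j : herm (row i g1) (row j g1) = gram k i j.
  exact: (proj1 (unitary_herm _) g1u).
have d0 : g1 i1 i0 = 0.
  have := hrow i1 i2; rewrite r2 hermE !mxE /= ?mxE /=.
  rewrite !(mulr0, mulr1) (expr0n _ 5) !mulr0 subr0 addr0 => /eqP.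
  by rewrite mulf_eq0 expf_eq0 (negPf m0) orbF => /eqP.
have e6 : g1 i1 i1 ^+ 6 = 1.
  apply: (mulfI n2); have := hrow i1 i1; rewrite hermE !mxE /= ?mxE /= d0 => h11.
  by rewrite mulr1 -[RHS]h11; ring.
have e0 : g1 i1 i1 != 0.
  by apply/eqP => e0; move: e6; rewrite e0 expr0n => /eqP; rewrite eq_sym oner_eq0.
(* The middle entry has sixth power 1, so dividing by it keeps the matrix unitary. *)
pose g2 := (g1 i1 i1)^-1 *: g1.
have g2u : unitary g2.
  rewrite /unitary frob_adjZ -!scalemxAl -scalemxAr g1u scalerA -exprS exprVn e6 invr1.
  by rewrite scale1r.
have V2 : V g2 = V g1 by apply: (frame_conicZ E_unit); rewrite ?invr_eq0 ?unitU.
have [[[a b d] [u v x] [r s mu]] g2E WM] := embm_surj char5 rt2_sq g2u.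
have ent i j : g2 i j = (g1 i1 i1)^-1 * g1 i j by rewrite mxE.
have u_0 : u = f25_0.
  by apply: (emb_inj char5 rt2_sq); have := ent i1 i0; rewrite g2E d0 mulr0 !mxE emb0.
have v_1 : v = f25_1.
  by apply: (emb_inj char5 rt2_sq); have := ent i1 i1; rewrite g2E mulVf // !mxE emb1.
have r2' j : g1 i2 j = m * conic_pt None 0 j by have /rowP/(_ j) := r2; rewrite !mxE.
have r_0 : r = f25_0.
  apply: (emb_inj char5 rt2_sq); have -> : emb r = g2 i2 i0 by rewrite g2E !mxE.
  by rewrite ent r2' emb0 !mxE /= !mulr0.
have s_0 : s = f25_0.
  apply: (emb_inj char5 rt2_sq); have -> : emb s = g2 i2 i1 by rewrite g2E !mxE.
  by rewrite ent r2' emb0 !mxE /= !mulr0.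
rewrite {}u_0 {}v_1 {}r_0 {}s_0 in WM g2E.
have [mu0 WE] := unitary_borel_frame WM.
by exists mu, x, d; rewrite -WE -g2E V2 V1; split.
Qed.

Lemma frame_conic_pencil g : unitary g -> points (V g) B ->
  exists2 a, a \in pencil_frames & V g = V (embm a).
Proof.
move=> gu /(base_borel_frame gu)[mu [x [w [gM mu0 <-]]]].
have := normalisationP; rewrite /check_normalisation => /andP[/allP shears /allP norms].
have := norms mu (mem_f25_all mu); rewrite (negPf mu0) orFb.
move=> /allP/(_ x (mem_f25_all x))/hasP[a _ /and3P[aS aM /hasP[r rI]]].
cbn zeta => /andP[]; set mu' := f25_mul (F25 a A0) mu => muS /hasP[s _ xs].
have /andP[rS rM] := shears r rI.
(* Both left factors preserve the base conic and the triangular shape, so [W] is again a Borel frame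
   with the same conic. *)
pose W := mat_mul (shear_frame r) (mat_mul (diag_frame a) (borel_frame mu x w)).
have aWM := mat_mul_unitary char5 rt2_sq aM gM.
have WM : mat_unitary W := mat_mul_unitary char5 rt2_sq rM aWM.
have gU : embm (borel_frame mu x w) \in unitmx by apply/unitU/embU.
have aWU : embm (diag_frame a) *m embm (borel_frame mu x w) \in unitmx.
  by rewrite -(embm_mul char5 rt2_sq); apply/unitU/embU.
have VW : V (embm W) = V (embm (borel_frame mu x w)).
  rewrite /W !(embm_mul char5 rt2_sq) (frame_conic_same char5 E_unit rt2_sq rM rS aWU).
  exact: (frame_conic_same char5 E_unit rt2_sq aM aS gU).
have xs' : f25_add x (f25_mul (F25 (f5_add r r) A0) mu') = f25_mul (F25 A0 s) mu'.
  by apply: (emb_inj char5 rt2_sq); apply/eqP; rewrite -(emb_eq char5 rt2_sq).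
have [u [v [d WE]]] : exists u v d, W =
    Mat (Vec u v d) (Vec f25_0 f25_1 (f25_mul (F25 A0 s) mu')) (Vec f25_0 f25_0 mu').
  rewrite /W; cbn [mat_mul vec_mul shear_frame diag_frame borel_frame].
  rewrite !(f25_mul0, f25_mulr0, f25_mul1, f25_mulr1, f25_add0, f25_addr0) xs'.
  by do 3 eexists.
rewrite {}WE in WM VW; have [_ WE] := unitary_borel_frame WM.
rewrite {}WE in WM VW; rewrite -VW.
by eexists; first exact: mem_pencil_frames WM.
Qed.

Lemma pencil_frame_unitary a : a \in pencil_frames -> unitary (embm a).
Proof. by rewrite mem_filter => /andP[/embU]. Qed.

Lemma pencil_frame_base a : a \in pencil_frames -> points (V (embm a)) B.
Proof.
move=> /[dup] /pencil_frame_unitary au; rewrite mem_filter => /andP[_].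
case/allpairsP => -[[mu s] w] [_ _ aE]; have aU := unitU au.
apply/(frame_conic_pointsP E_unit B aU); exists None.
apply: proportional_trans baseE _.
have r2 : conic_pt None *m embm a = emb mu *: conic_pt None.
  rewrite aE; apply: row3P; rewrite !mxE sum3 !mxE; cbn [borel_frame fst snd embm embv nth nat_of_ord i0 i1 i2];
  rewrite ?mxE; cbn [nth nat_of_ord i0 i1 i2]; rewrite ?emb0; ring.
have mu0 : emb mu != 0.
  apply: contra (conic_pt_neq0 (None : option k)) => /eqP mu0.
  by rewrite -(mulmxK aU (conic_pt None)) r2 mu0 scale0r mul0mx.
by apply: proportional_sym; exists (emb mu).
Qed.

Lemma pencil_frames_inj i j : (i < 150)%N -> (j < 150)%N ->
  V (embm (nth mat_1 pencil_frames i)) = V (embm (nth mat_1 pencil_frames j)) -> i = j.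
Proof.
have := pencilP; rewrite /check_pencil => /andP[/eqP sz /(pairwiseP mat_1) pw].
rewrite sz in pw; wlog ij : i j / (i < j)%N.
  move=> H i150 j150 e; case: (ltngtP i j) => // ij; first exact: (H i j).
  by apply/esym/(H j i).
move=> i150 j150 /(proj2 (sameP _ _)) e.
have mem n : (n < 150)%N -> mat_unitary (nth mat_1 pencil_frames n).
  by move=> n150; apply/embU/pencil_frame_unitary/mem_nth; rewrite sz.
have := pw i j i150 j150 ij; rewrite e //; exact: mem.
Qed.

Lemma card_components : components G #= `I_150.
Proof.
have [/eqP sz _] := andP pencilP.
pose P i := embm (nth mat_1 pencil_frames i).
have Pm i : (i < 150)%N -> nth mat_1 pencil_frames i \in pencil_frames.
  by move=> i150; apply: mem_nth; rewrite sz.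
have Pu i : (i < 150)%N -> unitary (P i) by move=> /Pm; exact: pencil_frame_unitary.
have PB i : (i < 150)%N -> points (V (P i)) B by move=> /Pm; exact: pencil_frame_base.
have vP := vertexP char5 E_unit c_neq0 GamE.
have cP := componentP char5 E_unit c_neq0 GamE rt2_sq.
pose F i := component G (V (P i)).
have K0 i : V (P i) = V (K 0 *m P i) by rewrite component_frame0.
have -> : components G = F @` `I_150.
  apply/seteqP; split=> [_ [_ /vP[g gu ->] <-]|_ [i i150 <-]]; last first.
    by exists (V (P i)) => //; apply/vP; exists (P i) => //; exact: Pu.
  have [m [m21 mB _]] := base_conic gu.
  have mu := unitaryM char5 (Ku m) gu.
  have [_ /(nthP mat_1)[i i150 <-] mE] := frame_conic_pencil mu mB.
  exists i; first by rewrite -sz.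
  apply: component_eq; rewrite -/(P i) -mE; apply/(cP g _ gu); by exists m.
apply: inj_card_eq => i j /set_mem i150 /set_mem j150 FE.
apply: pencil_frames_inj => //.
have [m m21 jE] : exists2 m, (m < 21)%N & V (P j) = V (K m *m P i).
  apply/(cP (P i) _ (Pu i i150)); rewrite -/(F i) FE.
  split; last exact: rt_refl.
  by apply/vP; exists (P j) => //; exact: Pu.
have [n [_ _ nu]] := base_conic (Pu i i150).
(* The conics of index [m] and of index 0 both contain [B], and only one conic of the component
   does. *)
have m0 : m = 0%N.
  rewrite (nu m) // -?jE; last exact: PB.
  by rewrite (nu 0%N) // -K0; exact: PB.
by rewrite -/(P i) -/(P j) jE m0 -K0.
Qed.

End Pencil.

Theorem proposition1p3 (k : closedFieldType) (char5 : 5%N \in [pchar k])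
    (Gam : plane_curve k 6) (hGam : hermitian_curve Gam) :
  components (conic_graph Gam) #= `I_150 /\
  forall C : set (plane_conic k), components (conic_graph Gam) C ->
    graph_isomorphic (induced_subgraph (conic_graph Gam) C)
                     (triangular_graph 7).
Proof.
have [E [c [E_unit c0 GamE]]] := hermitian_coordinates char5 hGam.
have [rt2 rt2_sq] := exists_sqrt (2%:R : k).
have [B baseE] := exists_coord E_unit (conic_pt_neq0 (None : option k)).
split; first exact: (card_components char5 E_unit c0 GamE rt2_sq baseE).
move=> _ [_ /(vertexP char5 E_unit c0 GamE)[g gu ->] <-].
exact: (component_triangular char5 E_unit c0 GamE rt2_sq gu).
Qed.
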